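(* Let $q\geq 5$ be an odd prime power, $A=\mathbb{F}_q[T]$, $F=\mathbb{F}_q(T)$, and fix positive integers $c_1,c_2$. Let $\mathcal{C}$ be the set of pairs $w=(g_1,g_2)\in A^2$ with $g_2\neq 0$, and for an integer $X>0$ let $\mathcal{C}(X)=\{(g_1,g_2)\in\mathcal{C} : \deg g_1< c_1X,\ \deg g_2<c_2X\}$ (equivalently $|w|<q^X$, where $|w|=\max\{|g_1|^{1/c_1},|g_2|^{1/c_2}\}$, $|f|=q^{\deg f}$). Let $\mathcal{T}\subseteq\mathcal{C}$ be the set of $w$ such that the $T$-adic Galois representation $\hat\rho_{\phi^w,(T)}:\operatorname{Gal}(F^{\mathrm{sep}}/F)\to\operatorname{GL}_2(A_{(T)})$ attached to the rank $2$ Drinfeld module $\phi^w$ is surjective, and $\mathcal{T}(X)=\mathcal{T}\cap\mathcal{C}(X)$. Then \[\liminf_{X\to\infty}\frac{\#\mathcal{T}(X)}{\#\mathcal{C}(X)}>0,\] i.e. there is a positive density of rank $2$ Drinfeld modules over $A$ whose $T$-adic Galois representation is surjective.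
   Context: For $w=(g_1,g_2)\in A^2$ with $g_2\ne0$, $\phi^w:A\to F\{\tau\}$ is the Drinfeld module of rank $2$ determined by $\phi^w_T=T+g_1\tau+g_2\tau^2$, where $F\{\tau\}$ is the twisted polynomial ring with $\tau c=c^q\tau$; $\phi^w_a(x)$ denotes the associated $\mathbb{F}_q$-linear polynomial. For a nonzero ideal $\mathfrak a=(a)$ of $A$, $\phi[\mathfrak a]$ is the set of roots of $\phi_a(x)$ in $F^{\mathrm{sep}}$, an $A$-module (via $b\ast\alpha=\phi_b(\alpha)$) isomorphic to $(A/\mathfrak a)^2$. With $\mathfrak p=(T)$, $A_{\mathfrak p}=\mathbb{F}_q[[T]]$ is the completion of $A$ at $\mathfrak p$, the Tate module $T_{\mathfrak p}(\phi)=\varprojlim_n\phi[\mathfrak p^n]$ is free of rank $2$ over $A_{\mathfrak p}$, and $\hat\rho_{\phi,\mathfrak p}$ is the action of $\operatorname{Gal}(F^{\mathrm{sep}}/F)$ on it with respect to an $A_{\mathfrak p}$-basis. *)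

(* Defs.v *)
From HB Require Import structures.
From mathcomp Require Import all_boot all_order all_algebra all_solvable.
From mathcomp Require Import all_field.
From mathcomp Require Import finmap.
From mathcomp Require Import all_classical all_reals all_analysis.

Set Implicit Arguments.
Unset Strict Implicit.
Unset Printing Implicit Defensive.

Import Order.TTheory GRing.Theory Num.Theory.
Local Open Scope ring_scope.
Local Open Scope classical_set_scope.

(* Skew polynomials K{tau} with tau c = s(c) tau. The element                 *)
(* \sum_i c_i tau^i is represented by the polynomial \sum_i c_i 'X^i.         *)
Record skewpoly (K : fieldType) (s : {rmorphism K -> K}) : Type :=
  SkewPoly { skew_poly : {poly K} }.

Section SkewPoly.
Variables (K : fieldType) (s : {rmorphism K -> K}).
Implicit Types (p q r : {poly K}) (c d : K).

Definition skew_mul p q : {poly K} :=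
  \sum_(i < size p) p`_i *: (iter i (map_poly s) q * 'X^i).

Let sh i q := iter i (map_poly s) q.

Let shD i : {morph sh i : p q / p + q}.
Proof. by move=> p q; elim: i => //= i ->; rewrite rmorphD. Qed.
Let sh0 i : sh i 0 = 0.
Proof. by elim: i => //= i ->; rewrite rmorph0. Qed.
Let sh1 i : sh i 1 = 1.
Proof. by elim: i => //= i ->; rewrite rmorph1. Qed.
Let shM i : {morph sh i : p q / p * q}.
Proof. by move=> p q; elim: i => //= i ->; rewrite rmorphM. Qed.
Let shC i c : sh i c%:P = (iter i s c)%:P.
Proof. by elim: i => //= i ->; rewrite map_polyC. Qed.
Let shX i n : sh i 'X^n = 'X^n.
Proof. by elim: i => //= i ->; rewrite map_polyXn. Qed.
Let sh_sum i n (F : 'I_n -> {poly K}) :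
  sh i (\sum_(k < n) F k) = \sum_(k < n) sh i (F k).
Proof. exact: (big_morph _ (shD i) (sh0 i)). Qed.

Let skew_mulE n p q : (size p <= n)%N ->
  skew_mul p q = \sum_(i < n) p`_i *: (sh i q * 'X^i).
Proof.
move=> le_pn; rewrite /skew_mul.
rewrite (big_ord_widen n (fun i => p`_i *: (sh i q * 'X^i))) //.
rewrite big_mkcond; apply: eq_bigr => i _ /=.
by case: ltnP => // ?; rewrite nth_default // scale0r.
Qed.

Fact skew_mulDl : left_distributive skew_mul +%R.
Proof.
move=> p q r; pose n := maxn (size p) (size q).
rewrite (@skew_mulE n (p + q)) ?size_polyD //.
rewrite (@skew_mulE n p) ?leq_maxl // (@skew_mulE n q) ?leq_maxr //.
by rewrite -big_split /=; apply: eq_bigr => i _; rewrite coefD scalerDl.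
Qed.

Fact skew_mulDr : right_distributive skew_mul +%R.
Proof.
move=> p q r; rewrite /skew_mul -big_split /=; apply: eq_bigr => i _.
by rewrite -/(sh _ _) shD mulrDl scalerDr.
Qed.

Let skew_mul0l q : skew_mul 0 q = 0.
Proof. by rewrite /skew_mul size_poly0 big_ord0. Qed.
Let skew_mul0r q : skew_mul q 0 = 0.
Proof.
by rewrite /skew_mul big1 // => i _; rewrite -/(sh _ _) sh0 mul0r scaler0.
Qed.

Let skew_mul_suml n (F : 'I_n -> {poly K}) r :
  skew_mul (\sum_(k < n) F k) r = \sum_(k < n) skew_mul (F k) r.
Proof.
exact: (big_morph (skew_mul^~ r) (fun p q => skew_mulDl p q r) (skew_mul0l r)).
Qed.
Let skew_mul_sumr n (F : 'I_n -> {poly K}) p :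
  skew_mul p (\sum_(k < n) F k) = \sum_(k < n) skew_mul p (F k).
Proof.
exact: (big_morph (skew_mul p) (skew_mulDr p) (skew_mul0r p)).
Qed.

Let skew_mulX c n q : skew_mul (c *: 'X^n) q = c *: (sh n q * 'X^n).
Proof.
rewrite (@skew_mulE n.+1).
  2: by rewrite (leq_trans (size_scale_leq _ _)) ?size_polyXn.
rewrite (bigD1 (Ordinal (ltnSn n))) //= coefZ coefXn eqxx mulr1.
rewrite big1 ?addr0 // => i; rewrite -val_eqE /= => /negbTE ne.
by rewrite coefZ coefXn ne mulr0 scale0r.
Qed.

Fact skew_mul1l : left_id (1 : {poly K}) skew_mul.
Proof.
by move=> q; have := skew_mulX 1 0 q; rewrite !scale1r expr0 mulr1.
Qed.

Fact skew_mul1r : right_id (1 : {poly K}) skew_mul.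
Proof.
move=> p; rewrite /skew_mul -[in RHS](coefK p) poly_def.
by apply: eq_bigr => i _; rewrite -/(sh _ _) sh1 mul1r.
Qed.

Let skew_mulA_mono c i d j r :
  skew_mul (c *: 'X^i) (skew_mul (d *: 'X^j) r) =
  skew_mul (skew_mul (c *: 'X^i) (d *: 'X^j)) r.
Proof.
rewrite !skew_mulX.
have -> : c *: (sh i (d *: 'X^j) * 'X^i) = (c * iter i s d) *: 'X^(i + j).
  by rewrite -!mul_polyC shM shC shX polyCM -!mulrA -exprD addnC.
rewrite skew_mulX -!mul_polyC !shM shC shX polyCM /sh iterD -!mulrA.
by rewrite -exprD addnC.
Qed.

Fact skew_mulA : associative skew_mul.
Proof.
move=> p q r; rewrite -[p]coefK poly_def skew_mul_suml.
rewrite [X in _ = skew_mul X _]skew_mul_suml [RHS]skew_mul_suml.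
apply: eq_bigr => i _; rewrite -[q]coefK poly_def.
rewrite [X in skew_mul _ X = _]skew_mul_suml [LHS]skew_mul_sumr.
rewrite [X in _ = skew_mul X _]skew_mul_sumr [RHS]skew_mul_suml.
by apply: eq_bigr => j _; apply: skew_mulA_mono.
Qed.

Local Notation S := (skewpoly s).
Implicit Types f g h : S.

HB.instance Definition _ := [isNew for @skew_poly K s].
HB.instance Definition _ := [Choice of S by <:].

Definition skp_zero : S := SkewPoly s 0.
Definition skp_opp f : S := SkewPoly s (- skew_poly f).
Definition skp_add f g : S := SkewPoly s (skew_poly f + skew_poly g).
Definition skp_one : S := SkewPoly s 1.
Definition skp_mul f g : S :=
  SkewPoly s (skew_mul (skew_poly f) (skew_poly g)).

Fact skp_addA : associative skp_add.
Proof. by move=> f g h; apply: val_inj; apply: addrA. Qed.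
Fact skp_addC : commutative skp_add.
Proof. by move=> f g; apply: val_inj; apply: addrC. Qed.
Fact skp_add0 : left_id skp_zero skp_add.
Proof. by move=> f; apply: val_inj; apply: add0r. Qed.
Fact skp_addN : left_inverse skp_zero skp_opp skp_add.
Proof. by move=> f; apply: val_inj; apply: addNr. Qed.
HB.instance Definition _ :=
  GRing.isZmodule.Build S skp_addA skp_addC skp_add0 skp_addN.

Fact skp_mulA : associative skp_mul.
Proof. by move=> f g h; apply: val_inj; apply: skew_mulA. Qed.
Fact skp_mul1l : left_id skp_one skp_mul.
Proof. by move=> f; apply: val_inj; apply: skew_mul1l. Qed.
Fact skp_mul1r : right_id skp_one skp_mul.
Proof. by move=> f; apply: val_inj; apply: skew_mul1r. Qed.
Fact skp_mulDl : left_distributive skp_mul skp_add.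
Proof. by move=> f g h; apply: val_inj; apply: skew_mulDl. Qed.
Fact skp_mulDr : right_distributive skp_mul skp_add.
Proof. by move=> f g h; apply: val_inj; apply: skew_mulDr. Qed.
Fact skp_one_neq0 : skp_one != 0.
Proof. by rewrite -val_eqE; apply: oner_neq0. Qed.
HB.instance Definition _ := GRing.Zmodule_isNzRing.Build S
  skp_mulA skp_mul1l skp_mul1r skp_mulDl skp_mulDr skp_one_neq0.

Definition skewC c : S := SkewPoly s c%:P.
Definition tau : S := SkewPoly s 'X.

Let skew_mulC c q : skew_mul c%:P q = c *: q.
Proof. by have := skew_mulX c 0 q; rewrite expr0 alg_polyC mulr1. Qed.

Fact skewC_is_zmod_morphism : zmod_morphism skewC.
Proof. by move=> c d; apply: val_inj; apply: polyCB. Qed.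
Fact skewC_is_monoid_morphism : monoid_morphism skewC.
Proof.
split=> // c d; apply: val_inj => /=.
by rewrite skew_mulC polyCM mul_polyC.
Qed.
HB.instance Definition _ :=
  GRing.isZmodMorphism.Build K S skewC skewC_is_zmod_morphism.
HB.instance Definition _ :=
  GRing.isMonoidMorphism.Build K S skewC skewC_is_monoid_morphism.

Lemma skewC_comm c d : GRing.comm (skewC c) (skewC d).
Proof. by rewrite /GRing.comm -!rmorphM mulrC. Qed.

Lemma tauC c : tau * skewC c = skewC (s c) * tau.
Proof.
apply: val_inj => /=; rewrite skew_mulC -[X in skew_mul X _]scale1r.
by rewrite (skew_mulX 1 1) /= map_polyC /= scale1r mul_polyC.
Qed.

End SkewPoly.

Record pseries (R : Type) : Type := PSeries { pscoef : nat -> R }.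

Section PSeries.
Variable R : comNzRingType.
Implicit Types a b c : pseries R.

HB.instance Definition _ := gen_eqMixin (pseries R).
HB.instance Definition _ := gen_choiceMixin (pseries R).

Lemma pseriesP a b : (forall n, pscoef a n = pscoef b n) -> a = b.
Proof. by case: a b => a [b] /= /funext ->. Qed.

Definition ps_zero : pseries R := PSeries (fun=> 0).
Definition ps_opp a : pseries R := PSeries (fun n => - pscoef a n).
Definition ps_add a b : pseries R := PSeries (fun n => pscoef a n + pscoef b n).
Definition ps_one : pseries R := PSeries (fun n => (n == 0%N)%:R).
Definition ps_mul a b : pseries R :=
  PSeries (fun n => \sum_(i < n.+1) pscoef a i * pscoef b (n - i)).

Fact ps_addA : associative ps_add.
Proof. by move=> a b c; apply: pseriesP => n /=; rewrite addrA. Qed.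
Fact ps_addC : commutative ps_add.
Proof. by move=> a b; apply: pseriesP => n /=; rewrite addrC. Qed.
Fact ps_add0 : left_id ps_zero ps_add.
Proof. by move=> a; apply: pseriesP => n /=; rewrite add0r. Qed.
Fact ps_addN : left_inverse ps_zero ps_opp ps_add.
Proof. by move=> a; apply: pseriesP => n /=; rewrite addNr. Qed.

HB.instance Definition _ :=
  GRing.isZmodule.Build (pseries R) ps_addA ps_addC ps_add0 ps_addN.

(* Reduction modulo T^n. *)
Definition ps_trunc n a : {poly R} := \poly_(i < n) pscoef a i.

Let coef_mul_trunc m n a b : (m < n)%N ->
  pscoef (ps_mul a b) m = (ps_trunc n a * ps_trunc n b)`_m.
Proof.
move=> lt_mn; rewrite coefM; apply: eq_bigr => i _; rewrite !coef_poly.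
rewrite (leq_ltn_trans _ lt_mn) ?(leq_ltn_trans (leq_subr _ _) lt_mn) //.
by rewrite -ltnS.
Qed.

Fact ps_mulA : associative ps_mul.
Proof.
move=> a b c; apply: pseriesP => n.
pose P := ps_trunc n.+1.
transitivity (P a * P b * P c)`_n.
  rewrite -mulrA coefM; apply: eq_bigr => i _.
  rewrite (@coef_mul_trunc _ n.+1) ?ltnS ?leq_subr //.
  by rewrite coef_poly ltn_ord.
rewrite coefM; apply: eq_bigr => i _; rewrite (@coef_mul_trunc _ n.+1) //.
by rewrite [in LHS]coef_poly ltnS leq_subr.
Qed.
Fact ps_mulC : commutative ps_mul.
Proof.
move=> a b; apply: pseriesP => n.
by rewrite !(@coef_mul_trunc _ n.+1) // mulrC.
Qed.
Fact ps_mul1 : left_id ps_one ps_mul.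
Proof.
move=> a; apply: pseriesP => n /=; rewrite big_ord_recl /= mul1r subn0.
by rewrite big1 ?addr0 // => i _; rewrite mul0r.
Qed.
Fact ps_mulDl : left_distributive ps_mul ps_add.
Proof.
move=> a b c; apply: pseriesP => n /=; rewrite -big_split /=.
by apply: eq_bigr => i _; rewrite mulrDl.
Qed.
Fact ps_one_neq0 : ps_one != 0.
Proof.
by apply/eqP => /(congr1 (fun a => pscoef a 0)) /eqP; rewrite oner_eq0.
Qed.

HB.instance Definition _ := GRing.Zmodule_isComNzRing.Build (pseries R)
  ps_mulA ps_mulC ps_mul1 ps_mulDl ps_one_neq0.

Definition ps_unit : {pred pseries R} := fun a => `[< exists b, b * a = 1 >].
Definition ps_inv a : pseries R :=
  if pselect (exists b, b * a = 1) is left ex then projT1 (cid ex) else a.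

Fact ps_mulV : {in ps_unit, left_inverse 1 ps_inv *%R}.
Proof.
move=> a /asboolP ex; rewrite /ps_inv; case: pselect => // ex'.
exact: projT2 (cid ex').
Qed.
Fact ps_unitP a b : b * a = 1 -> ps_unit a.
Proof. by move=> ba1; apply/asboolP; exists b. Qed.
Fact ps_inv_out : {in [predC ps_unit], ps_inv =1 id}.
Proof. by move=> a /asboolPn nex; rewrite /ps_inv; case: pselect. Qed.

HB.instance Definition _ := GRing.ComNzRing_hasMulInverse.Build (pseries R)
  ps_mulV ps_unitP ps_inv_out.

End PSeries.

Section SeparableClosure.
Variables (K L : fieldType) (iota : {rmorphism K -> L}).

Definition separably_closed : Prop :=
  forall p : {poly L}, separable_poly p -> (1 < size p)%N -> exists x, root p x.

Definition separable_algebraic : Prop :=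
  forall x : L,
    exists2 p : {poly K}, separable_poly p & root (map_poly iota p) x.

Definition separable_closure : Prop := separable_algebraic /\ separably_closed.

Definition in_galois_group (sigma : {rmorphism L -> L}) : Prop :=
  bijective sigma /\ forall x, sigma (iota x) = iota x.

End SeparableClosure.

(* K is an A-field via gamma; below it is F = Frac(A) with the inclusion.     *)
Section Drinfeld.
Variables (Fq : finFieldType) (K : fieldType).
Variable gamma : {rmorphism {poly Fq} -> K}.
Local Notation q := #|Fq|.
Local Notation A := {poly Fq}.

Definition frobq of {rmorphism A -> K} := fun x : K => x ^+ q.
Local Notation frob := (frobq gamma).

Fact pchar_natq : [pchar K].-nat q.
Proof.
have [p pr_p pcharFp] := finPcharP Fq.
have pK : p \in [pchar K].
  rewrite inE pr_p -(rmorph_nat gamma) -(rmorph_nat polyC).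
  by rewrite pcharf0 // !rmorph0 eqxx.
rewrite (eq_pnat _ (pcharf_eq pK)) -cardsT.
exact: abelem_pgroup (fin_ring_pchar_abelem pcharFp).
Qed.

Fact frobq_is_zmod_morphism : zmod_morphism frob.
Proof.
by move=> x y; rewrite /frobq exprDn_pchar ?exprNn_pchar ?pchar_natq.
Qed.
Fact frobq_is_monoid_morphism : monoid_morphism frob.
Proof. by split=> [|x y]; rewrite /frobq ?expr1n ?exprMn. Qed.

HB.instance Definition _ :=
  GRing.isZmodMorphism.Build K K frob frobq_is_zmod_morphism.
HB.instance Definition _ :=
  GRing.isMonoidMorphism.Build K K frob frobq_is_monoid_morphism.

Definition twisted : nzRingType := skewpoly frob.

Definition phi_T (w : A * A) : twisted :=
  skewC frob (gamma 'X) + skewC frob (gamma w.1) * tau frob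
    + skewC frob (gamma w.2) * tau frob ^+ 2.

Fact phi_T_comm (w : A * A) :
  commr_rmorph (skewC frob \o gamma \o polyC) (phi_T w).
Proof.
move=> c; rewrite /=; set d := skewC _ _.
have dC x : GRing.comm d (skewC frob x) by apply: skewC_comm.
have dtau : GRing.comm d (tau frob).
  rewrite /GRing.comm /d tauC; congr (skewC _ _ * _).
  by rewrite /= /frobq -(rmorphXn gamma) -(rmorphXn polyC) expf_card.
apply: commr_sym; apply: commrD; first apply: commrD => //.
  exact: commrM.
by apply: commrM => //; apply: commrX.
Qed.

(* The ring homomorphism phi^w : A -> K{tau} sending T to phi_T. *)
Definition drinfeld (w : A * A) : {rmorphism A -> twisted} :=
  horner_morph (phi_T_comm w).

(* The F_q-linear polynomial \sum_i c_i x^(q^i) of \sum_i c_i tau^i. *)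
Definition linearized (f : twisted) : {poly K} :=
  \sum_(i < size (skew_poly f)) (skew_poly f)`_i *: 'X^(q ^ i).

Section Torsion.
Variables (Fsep : fieldType) (iota : {rmorphism K -> Fsep}) (w : A * A).

Definition phi_eval (a : A) (x : Fsep) : Fsep :=
  (map_poly iota (linearized (drinfeld w a))).[x].

Definition torsion (a : A) : set Fsep :=
  [set x | root (map_poly iota (linearized (drinfeld w a))) x].

(* The inverse limit of the phi[T^n], with transition maps phi_T. *)
Definition tate : set (nat -> Fsep) :=
  [set x | (forall n, torsion 'X^n (x n)) /\
           (forall n, phi_eval 'X (x n.+1) = x n)].

(* F_q[[T]] acts on phi[T^n] through its quotient A/(T^n). *)
Definition tate_scale (a : pseries Fq) (x : nat -> Fsep) : nat -> Fsep :=
  fun n => phi_eval (ps_trunc n a) (x n).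

Definition tate_comb (a : 'cV[pseries Fq]_2) (e : 'I_2 -> nat -> Fsep) :
    nat -> Fsep :=
  fun n => \sum_(i < 2) tate_scale (a i 0) (e i) n.

Definition tate_basis (e : 'I_2 -> nat -> Fsep) : Prop :=
  (forall i, tate (e i)) /\
  (forall x, tate x -> exists! a : 'cV[pseries Fq]_2, x = tate_comb a e).

(* M is the matrix of sigma acting on the Tate module in the basis e. *)
Definition rho_matrix (e : 'I_2 -> nat -> Fsep)
    (sigma : {rmorphism Fsep -> Fsep}) (M : 'M[pseries Fq]_2) : Prop :=
  forall j, (fun n => sigma (e j n)) = tate_comb (col j M) e.

Definition rho_surjective : Prop :=
  exists2 e, tate_basis e &
    forall M : 'M[pseries Fq]_2, M \in unitmx ->
      exists2 sigma, in_galois_group iota sigma & rho_matrix e sigma M.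

End Torsion.

End Drinfeld.

Section Density.
Variable Fq : finFieldType.
Local Notation A := {poly Fq}.

Definition pairs : set (A * A) := [set w | w.2 != 0].

(* deg g < n is size g <= n, with deg 0 = -oo. *)
Definition pairs_below (c1 c2 X : nat) : set (A * A) :=
  pairs `&` [set w : A * A | (size w.1 <= c1 * X)%N /\ (size w.2 <= c2 * X)%N].

Definition surjective_pairs (Fsep : fieldType)
    (iota : {rmorphism {fraction A} -> Fsep}) : set (A * A) :=
  pairs `&` [set w | rho_surjective (@tofrac A) iota w].

Lemma finite_pairs_below c1 c2 X : finite_set (pairs_below c1 c2 X).
Proof.
pose P n : set A := [set g | (size g <= n)%N].
have finP n : finite_set (P n).
  apply: (@sub_finite_set _ _ [set rVpoly v | v in [set: 'rV[Fq]_n]]).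
    by move=> g /= gn; exists (poly_rV g) => //; rewrite poly_rV_K.
  exact/finite_image/finite_finset.
apply: (sub_finite_set _ (finite_setX (finP (c1 * X)%N) (finP (c2 * X)%N))).
by move=> w [_].
Qed.

End Density.

Arguments pairs_below : clear implicits.

(* Main.v *)
From Pilot Require Import Defs.
From HB Require Import structures.
From mathcomp Require Import all_boot all_order all_algebra all_fingroup all_solvable all_field.
From mathcomp Require Import finmap.
From mathcomp Require Import all_classical all_reals all_analysis.
From mathcomp Require Import ring.
(* Again, because MathComp-Analysis has another [pseries]. *)
Import Pilot.Defs.

Set Implicit Arguments.
Unset Strict Implicit.
Unset Printing Implicit Defensive.

Import Order.TTheory GRing.Theory Num.Theory.
Local Open Scope ring_scope.
Local Open Scope classical_set_scope.

(**
Write [D x = T x + g1 x^q + g2 x^(q^2)] for the operator of [phi_T].  Density is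
obtained from one residue class: fix [c] different from [0] and [1], and let
[g1 = (T - c) (1 + T (T - 1) h1)],
[g2 = (T - 1) (T - c) (1 + T (T - 1) (T - c) h2)] with [h1], [h2] arbitrary.

At [T = 1] the module degenerates: over [k[[X]]], [T = 1 + X^(q-1)], with [k] the
algebraic closure of [F_q], [D^n] factors as [F o E] where the kernel of [E] is
generated by an integral torsion point [f1], and [E x = z] with [z] of order [-1]
is a reversed Eisenstein equation.  Its roots [x + b f1] are therefore conjugate
over a field containing [f1], which gives all transvections fixing [f1].
At [T = 0] the reduction is ordinary: [D^n = F o E] with the kernel of [E] totally
ramified (Eisenstein) and all roots of [F] in [k[[T]]], which gives elements with
every determinant.  At [T = c] the equation [T + g1 Y + g2 Y^(q+1) = 0] is of
Eisenstein type, so the line spanned by [f1] is not Galois stable; a conjugate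
[f2] of [f1] completes it to a basis, and the transvections fixing [f1] or [f2]
generate [SL_2].

No extension of valuations is needed: a maximal isomorphism between a subfield of
[k((X))] and a subfield of the separable closure carries irreducibility over
[k((X))] to the Galois side.
*)

(** * Partial isomorphisms between fields *)

Lemma pair_invf (C D : fieldType) (z : C * D) :
  (z.1 == 0) = (z.2 == 0) -> z^-1 = (z.1^-1, z.2^-1).
Proof.
case: z => x y /=; have [->|x0] := eqVneq x 0 => [/esym/eqP->|/esym/negbT y0].
  by rewrite !invr0 (_ : (0, 0) = 0) ?invr0.
by apply: mulr1_eq; congr (_, _); apply: mulfV.
Qed.

Definition partial_iso (C D : fieldType) (R : set (C * D)) : Prop :=
  divring_closed (mem R) /\ {in R, forall z, (z.1 == 0) = (z.2 == 0)}.

Section PartialIsoField.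
Variables (C D : fieldType) (R : set (C * D)) (isoR : partial_iso R).

Definition partial_iso_dom of partial_iso R : Type := {z : C * D | z \in R}.
Local Notation E := (partial_iso_dom isoR).

HB.instance Definition _ := [isSub of E for @sval _ _].
HB.instance Definition _ := [Choice of E by <:].
HB.instance Definition _ :=
  GRing.SubChoice_isSubComUnitRing.Build _ _ E isoR.1.

Fact partial_iso_field : GRing.field_axiom E.
Proof.
move=> z; rewrite -(inj_eq val_inj) => z0.
rewrite -[_ \is a _]/(_ && _) !unitfE -(isoR.2 _ (valP z)) andbb.
apply: contraNneq z0 => z1.
by rewrite -pair_eqE /pair_eq -(isoR.2 _ (valP z)) z1 eqxx.
Qed.
HB.instance Definition _ := GRing.ComUnitRing_isField.Build E partial_iso_field.

Definition partial_iso_left : {rmorphism E -> C} := fst \o val.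
Definition partial_iso_right : {rmorphism E -> D} := snd \o val.

End PartialIsoField.

Section Graph.
Variables (C D : fieldType).
Implicit Type R : set (C * D).

Definition graph (E : Type) (u : E -> C) (v : E -> D) : set (C * D) :=
  range (fun e => (u e, v e)).

Lemma partial_iso_graph (E : fieldType)
    (u : {rmorphism E -> C}) (v : {rmorphism E -> D}) :
  partial_iso (graph u v).
Proof.
split; last by move=> z /set_mem[e _ <-] /=; rewrite !fmorph_eq0.
split=> [|z z' /set_mem[e _ <-] /set_mem[e' _ <-]
         |z z' /set_mem[e _ <-] /set_mem[e' _ <-]]; apply/mem_set.
- by exists 1 => //; rewrite !rmorph1.
- by exists (e - e') => //; rewrite !rmorphB.
- by exists (e / e') => //; rewrite pair_invf /= ?fmorph_eq0 // !fmorph_div.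
Qed.

Lemma partial_isoP R : partial_iso R ->
  exists (E : fieldType) (u : {rmorphism E -> C}) (v : {rmorphism E -> D}),
    R = graph u v.
Proof.
move=> isoR.
exists (partial_iso_dom isoR), (partial_iso_left isoR), (partial_iso_right isoR).
apply/seteqP; split=> [z Rz|_ [z _ <-]].
  by exists (exist _ z (mem_set Rz)) => //=; case: (z).
by have := set_mem (valP z); case: z => -[].
Qed.

Lemma Zorn_bigcup_above T (P : set (set T)) (A0 : set T) :
  P A0 ->
  (forall F : set (set T), F !=set0 -> F `<=` P -> total_on F subset ->
    P (\bigcup_(A in F) A)) ->
  exists A, [/\ P A, A0 `<=` A & forall B, P B -> A `<=` B -> B = A].
Proof.
move=> PA0 chain.
have [|A [PA maxA]] := @Zorn_bigcup T [set A | P (A0 `|` A)].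
  move=> F FP totF /=; pose G := setU A0 @` (set0 |` F).
  have -> : A0 `|` \bigcup_(A in F) A = \bigcup_(A in G) A.
    by rewrite /G bigcup_image bigcupUr ?bigcup_setU1 ?set0U; last by exists set0; left.
  apply: chain; first by exists (A0 `|` set0), set0 => //; left.
    by move=> _ [A [->|FA] <-]; [rewrite setU0|apply: FP].
  move=> _ _ [A FA <-] [B FB <-].
  have : A `<=` B \/ B `<=` A.
    move: FA FB => [->|FA] [->|FB]; try by [left|right].
    exact: totF.
  by case=> sub; [left|right]; apply: setUS.
exists (A0 `|` A); split=> // B PB subB.
apply/seteqP; split=> // z Bz; apply: contrapT => nz.
case: (maxA B).
  split=> [t At|/(_ z Bz) Az]; first by apply: subB; right.
  by apply: nz; right.
by rewrite /= (_ : A0 `|` B = B) //; apply/setUidPr => t A0t; apply: subB; left.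
Qed.

Lemma partial_iso_bigcup (F : set (set (C * D))) :
  F !=set0 -> total_on F subset -> (forall R, F R -> partial_iso R) ->
  partial_iso (\bigcup_(R in F) R).
Proof.
move=> [R0 FR0] totF isoF.
have common z z' : (\bigcup_(R in F) R) z -> (\bigcup_(R in F) R) z' ->
    exists R, [/\ F R, R z & R z'].
  move=> [R FR Rz] [R' FR' R'z'].
  by have [sub|sub] := totF _ _ FR FR'; [exists R'|exists R]; split=> //; apply: sub.
split; last by move=> z /set_mem[R FR Rz]; apply: (isoF _ FR).2; apply: mem_set.
split=> [|z z' /set_mem Uz /set_mem Uz'|z z' /set_mem Uz /set_mem Uz'];
  apply/mem_set.
- by exists R0 => //; apply/set_mem; have [[]] := isoF _ FR0.
- have [R [FR Rz Rz']] := common _ _ Uz Uz'; have [[_ RB _] _] := isoF _ FR.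
  by exists R => //; apply/set_mem/RB; apply: mem_set.
- have [R [FR Rz Rz']] := common _ _ Uz Uz'; have [[_ _ Rdiv] _] := isoF _ FR.
  by exists R => //; apply/set_mem/Rdiv; apply: mem_set.
Qed.

End Graph.

Section Descent.
Variables (K L : fieldType) (u : {rmorphism K -> L}).

Lemma irreducible_dvdp_root (m p : {poly K}) x :
  irreducible_poly m -> root (map_poly u m) x ->
  root (map_poly u p) x = (m %| p).
Proof.
move=> irr mx; apply/idP/idP => [px|/dvdpP[d ->]].
  apply: contraTT px => ndvd.
  have : coprimep (map_poly u m) (map_poly u p).
    by rewrite coprimep_map irreducible_poly_coprime.
  by move/coprimep_root/(_ mx).
by rewrite rmorphM rootM mx orbT.
Qed.

Lemma irreducible_map_poly (p : {poly K}) :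
  irreducible_poly (map_poly u p) -> irreducible_poly p.
Proof.
move=> [szp irr]; split=> [|d szd dvd]; first by rewrite size_map_poly in szp.
by rewrite -(eqp_map u); apply: irr; rewrite ?size_map_poly ?dvdp_map.
Qed.

Lemma irreducible_factor_root (p : {poly K}) x :
  p != 0 -> root (map_poly u p) x ->
  exists m, [/\ irreducible_poly m, m %| p & root (map_poly u m) x].
Proof.
move=> p0 px.
pose S k := `[< exists q, [/\ q != 0, root (map_poly u q) x & size q = k] >].
have exS : exists k, S k by exists (size p); apply/asboolP; exists p.
case: (ex_minnP exS) => k /asboolP[m [m0 mx <-]] minm.
have {minm} le_m q : q != 0 -> root (map_poly u q) x -> (size m <= size q)%N.
  by move=> q0 qx; apply: minm; apply/asboolP; exists q.
have irr : irreducible_poly m.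
  split=> [|d d1 dvd].
    rewrite ltnNge; apply: contraL mx => /size1_polyC mC.
    by rewrite mC map_polyC rootC fmorph_eq0 -polyC_eq0 -mC.
  have [e em] := dvdpP _ _ dvd.
  have [e0 d0] : e != 0 /\ d != 0 by apply/andP; rewrite -negb_or -mulf_eq0 -em.
  rewrite -dvdp_size_eqp // eqn_leq dvdp_leq //=.
  move: mx; rewrite {1}em rmorphM rootM => /orP[/(le_m e e0)|/(le_m d d0) //].
  rewrite em size_mul //; move: d1; rewrite -size_poly_gt0 in d0.
  by case: (size d) d0 => [|[|k']] // _ _; rewrite !addnS /= ltnNge leq_addr.
by exists m; split=> //; rewrite -(irreducible_dvdp_root p irr mx).
Qed.

End Descent.

Section Adjoin.
Variables (C D E : fieldType).
Variables (u : {rmorphism E -> C}) (v : {rmorphism E -> D}).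

Lemma partial_iso_adjoin (m : {poly E}) x y :
  irreducible_poly m -> root (map_poly u m) x -> root (map_poly v m) y ->
  partial_iso (graph (fun p => (map_poly u p).[x]) (fun p => (map_poly v p).[y])).
Proof.
move=> irr mx my.
have eq0 p : ((map_poly u p).[x] == 0) = ((map_poly v p).[y] == 0).
  exact: etrans (irreducible_dvdp_root p irr mx) (esym (irreducible_dvdp_root p irr my)).
split; last by move=> z /set_mem[p _ <-]; apply: eq0.
split=> [|z z' /set_mem[p _ <-] /set_mem[p' _ <-]
         |z z' /set_mem[p _ <-] /set_mem[p' _ <-]]; apply/mem_set.
- by exists 1 => //; rewrite !rmorph1 !hornerC.
- by exists (p - p') => //; rewrite !rmorphB !hornerE.
rewrite pair_invf //=; have [p'x|p'x] := eqVneq (map_poly u p').[x] 0.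
  have p'y : (map_poly v p').[y] = 0 by apply/eqP; rewrite -eq0 p'x.
  exists 0 => //=; rewrite !rmorph0 !horner0 p'x p'y !invr0.
  by congr (_, _); rewrite mulr0.
have : coprimep m p'.
  by rewrite irreducible_poly_coprime // -(irreducible_dvdp_root _ irr mx).
move=> /Bezout_eq1_coprimepP[[a b] /= bez].
have inv (F : fieldType) (w : {rmorphism E -> F}) t : root (map_poly w m) t ->
    (map_poly w b).[t] = (map_poly w p').[t]^-1.
  move=> mt; apply/esym/mulr1_eq; rewrite mulrC.
  have := congr1 (fun r => (map_poly w r).[t]) bez.
  by rewrite /= rmorphD !rmorphM hornerD !hornerM (rootP mt) mulr0 add0r rmorph1 hornerC.
by exists (p * b) => //; rewrite !rmorphM !hornerM !inv.
Qed.

Lemma graph_sub_adjoin x y : graph u v `<=`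
  graph (fun p => (map_poly u p).[x]) (fun p => (map_poly v p).[y]).
Proof. by move=> _ [e _ <-]; exists e%:P; rewrite ?map_polyC ?hornerC. Qed.

Lemma graph_adjoin_root x y :
  graph (fun p => (map_poly u p).[x]) (fun p => (map_poly v p).[y]) (x, y).
Proof. by exists 'X => //; rewrite !map_polyX !hornerX. Qed.

Lemma graph_sub_lift (E' : fieldType)
    (u' : {rmorphism E' -> C}) (v' : {rmorphism E' -> D}) :
  graph u v `<=` graph u' v' ->
  exists h : {rmorphism E -> E'}, (forall e, u' (h e) = u e) /\ (forall e, v' (h e) = v e).
Proof.
move=> sub.
have ex e : exists e', u' e' = u e /\ v' e' = v e.
  by have [|e' _ [ue ve]] := sub (u e, v e); [exists e|exists e'].
have [h hP] := choice ex.
have hu e : u' (h e) = u e by case: (hP e).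
have hB : zmod_morphism h.
  by move=> a b; apply: (fmorph_inj u'); rewrite rmorphB !hu rmorphB.
have hM : monoid_morphism h.
  split=> [|a b]; apply: (fmorph_inj u'); first by rewrite hu !rmorph1.
  by rewrite rmorphM !hu rmorphM.
pose h' : {rmorphism E -> E'} := HB.pack h
  (GRing.isZmodMorphism.Build _ _ h hB) (GRing.isMonoidMorphism.Build _ _ h hM).
by exists h'; split=> e; case: (hP e).
Qed.

End Adjoin.

Definition relatively_separably_closed (E C : fieldType) (u : {rmorphism E -> C}) :=
  forall (p : {poly E}) x, separable_poly p -> root (map_poly u p) x ->
    exists e, u e = x.

Lemma partial_iso_swap (C D : fieldType) (R : set (C * D)) :
  partial_iso R -> partial_iso [set z : D * C | R (z.2, z.1)].
Proof.
move=> [[R1 RB Rdiv] R0]; split=> [|z /set_mem Rz]; last first.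
  by rewrite -(R0 (z.2, z.1)) //; apply: mem_set.
split=> [|[y x] [y' x'] /set_mem/= Rz /set_mem/= Rz'
         |[y x] [y' x'] /set_mem/= Rz /set_mem/= Rz']; apply/mem_set => /=.
- exact: set_mem R1.
- by have /set_mem := RB _ _ (mem_set Rz) (mem_set Rz').
have eq0 := R0 _ (mem_set Rz').
by have /set_mem := Rdiv _ _ (mem_set Rz) (mem_set Rz'); rewrite !pair_invf.
Qed.

Section MaximalSpan.
Variables C D : fieldType.

Definition maximal_graph (E : Type) (u : E -> C) (v : E -> D) :=
  forall R, partial_iso R -> graph u v `<=` R -> R = graph u v.

Lemma maximal_graph_relatively_separably_closed (E : fieldType)
    (u : {rmorphism E -> C}) (v : {rmorphism E -> D}) :
  separably_closed D -> maximal_graph u v -> relatively_separably_closed u.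
Proof.
move=> closedD maxuv p x sepp px.
have [m [irr dvd mx]] := irreducible_factor_root (separable_poly_neq0 sepp) px.
have [||y my] := closedD (map_poly v m).
- by rewrite separable_map (dvdp_separable dvd).
- by rewrite size_map_poly irr.1.
have := maxuv _ (partial_iso_adjoin irr mx my) (@graph_sub_adjoin _ _ _ u v x y).
by have := graph_adjoin_root u v x y => /[swap] -> [e _ [ue _]]; exists e.
Qed.

End MaximalSpan.

Lemma maximal_graph_swap (C D : fieldType) (E : Type) (u : E -> C) (v : E -> D) :
  maximal_graph u v -> maximal_graph v u.
Proof.
move=> maxuv R isoR sub; have Req : [set z | R (z.2, z.1)] = graph u v.
  apply: maxuv; first exact: partial_iso_swap.
  by move=> _ [e _ <-]; apply: sub; exists e.
apply/seteqP; split=> [[y x] Ryx|]; last exact: sub.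
have : graph u v (x, y) by rewrite -Req.
by move=> [e _ [<- <-]]; exists e.
Qed.

Lemma exists_maximal_span (C D E : fieldType)
    (u : {rmorphism E -> C}) (v : {rmorphism E -> D}) :
  exists (E' : fieldType) (h : {rmorphism E -> E'})
    (u' : {rmorphism E' -> C}) (v' : {rmorphism E' -> D}),
  [/\ forall e, u' (h e) = u e, forall e, v' (h e) = v e,
      separably_closed D -> relatively_separably_closed u'
    & separably_closed C -> relatively_separably_closed v'].
Proof.
have [|R [isoR sub maxR]] := Zorn_bigcup_above (partial_iso_graph u v).
  by move=> F F0 isoF totF; apply: partial_iso_bigcup.
have [E' [u' [v' eR]]] := partial_isoP isoR; rewrite {}eR in sub maxR.
have [h [hu hv]] := graph_sub_lift sub.
exists E', h, u', v'; split=> // [closedD|closedC].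
  exact: maximal_graph_relatively_separably_closed closedD maxR.
apply: maximal_graph_relatively_separably_closed closedC _.
exact: maximal_graph_swap maxR.
Qed.

Lemma rmorphism_inverse (R S : nzRingType) (f : {rmorphism R -> S}) (g : S -> R) :
  cancel f g -> cancel g f ->
  exists2 g' : {rmorphism S -> R}, cancel f g' & cancel g' f.
Proof.
move=> fK gK.
pose g' : {rmorphism S -> R} := HB.pack g
  (GRing.isZmodMorphism.Build _ _ g (can2_zmod_morphism fK gK))
  (GRing.isMonoidMorphism.Build _ _ g (can2_monoid_morphism fK gK)).
by exists g'.
Qed.

Section GaloisGroup.
Variables (F L : fieldType) (iota : {rmorphism F -> L}).
Hypothesis sepF : separable_closure iota.

Lemma galois_extend (E : fieldType) (eta : {rmorphism F -> E})
    (u v : {rmorphism E -> L}) :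
  (forall a, u (eta a) = iota a) -> (forall a, v (eta a) = iota a) ->
  exists2 s, in_galois_group iota s & forall e, s (u e) = v e.
Proof.
move=> ueta veta.
have [E' [h [u' [v' [hu hv /(_ sepF.2) closu /(_ sepF.2) closv]]]]] :=
  exists_maximal_span u v.
have surj (w : {rmorphism E' -> L}) : (forall a, w (h (eta a)) = iota a) ->
    relatively_separably_closed w -> exists2 w' : {rmorphism L -> E'}, cancel w w' & cancel w' w.
  move=> weta closw.
  have ex x : exists e, w e = x.
    have [p sepp px] := sepF.1 x.
    apply: (closw (map_poly (h \o eta) p)); first by rewrite separable_map.
    by rewrite -map_poly_comp (eq_map_poly weta).
  have [w' w'K] := choice ex.
  by apply: (rmorphism_inverse (g := w')) => // e; apply: (fmorph_inj w).
have [|u'' u'K u''K] := surj u' _ closu; first by move=> a; rewrite hu.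
have [|v'' v'K v''K] := surj v' _ closv; first by move=> a; rewrite hv.
exists (v' \o u'').
  split=> [|a /=]; first by exists (u' \o v'') => x /=; rewrite ?v'K ?u'K ?v''K ?u''K.
  by rewrite -{1}ueta -hu u'K hv veta.
by move=> e /=; rewrite -hu u'K hv.
Qed.

Lemma galois_conjugate (E : fieldType) (eta : {rmorphism F -> E})
    (v : {rmorphism E -> L}) m x y :
  (forall a, v (eta a) = iota a) -> irreducible_poly m ->
  root (map_poly v m) x -> root (map_poly v m) y ->
  exists2 s, in_galois_group iota s & (forall e, s (v e) = v e) /\ s x = y.
Proof.
move=> veta irr mx my.
have [E' [u' [v' eR]]] := partial_isoP (partial_iso_adjoin irr mx my).
have := @graph_sub_adjoin _ _ _ v v x y; rewrite eR => /graph_sub_lift[h [hu hv]].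
have [e _ [ue ve]] : graph u' v' (x, y) by rewrite -eR; apply: graph_adjoin_root.
have [a|a|s gal_s su] := @galois_extend E' (h \o eta) u' v'.
- by rewrite /= hu.
- by rewrite /= hv.
by exists s => //; split=> [e'|]; [rewrite -{1}hu su hv|rewrite -ue su].
Qed.

Lemma galois_fixed x : (forall s, in_galois_group iota s -> s x = x) ->
  exists a, iota a = x.
Proof.
move=> fixx; have [p sepp px] := sepF.1 x.
have [m [irr dvd mx]] := irreducible_factor_root (separable_poly_neq0 sepp) px.
have /factor_theorem[n mn] := mx.
have sepm : separable_poly (map_poly iota m).
  by rewrite separable_map (dvdp_separable dvd).
have size_n : (size n <= 1)%N.
  rewrite leqNgt; apply/negP => n1; move: sepm; rewrite mn separable_mul.
  move=> /and3P[sepn _ copr]; have [y ny] := sepF.2 n sepn n1.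
  have my : root (map_poly iota m) y by rewrite mn rootM ny.
  have [s gal_s [_ sx]] := @galois_conjugate F idfun iota m x y (fun=> erefl) irr mx my.
  by move: copr; rewrite coprimep_XsubC -(fixx s gal_s) sx ny.
have m0 : map_poly iota m != 0 by rewrite map_poly_eq0 irredp_neq0.
have size_m : size m = 2.
  apply/eqP; rewrite eqn_leq irr.1 andbT -(size_map_poly iota) mn.
  by rewrite (leq_trans (size_polyMleq _ _)) // size_XsubC addn2.
have m1 : m`_1 != 0.
  by have := irredp_neq0 irr; rewrite -lead_coef_eq0 lead_coefE size_m.
exists (- m`_0 / m`_1); apply: (mulIf (_ : iota m`_1 != 0)); first by rewrite fmorph_eq0.
rewrite -rmorphM divfK // rmorphN; apply/esym/eqP; rewrite -subr_eq0 opprK.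
move/rootP: mx; rewrite (@horner_coef_wide _ 2) ?size_map_poly ?size_m //.
by rewrite !big_ord_recl big_ord0 !coef_map expr0 expr1 mulr1 addr0 addrC mulrC => ->.
Qed.

Lemma galois_comp (s t : {rmorphism L -> L}) :
  in_galois_group iota s -> in_galois_group iota t -> in_galois_group iota (s \o t).
Proof.
move=> [bij_s fix_s] [bij_t fix_t]; split=> [|x /=]; first exact: bij_comp.
by rewrite fix_t fix_s.
Qed.

Lemma galois_inverse (s : {rmorphism L -> L}) : in_galois_group iota s ->
  exists2 t : {rmorphism L -> L}, in_galois_group iota t & cancel s t /\ cancel t s.
Proof.
move=> [[t' sK tK] fix_s]; have [t st ts] := rmorphism_inverse sK tK.
by exists t => //; split=> [|x]; [exists s|rewrite -{1}(fix_s x) st].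
Qed.

(* The pairs [(x, y)] with [s n x = y] for all large [n] form a partial
   isomorphism, which is defined on all the [a m i]. *)
Lemma galois_limit (I : Type) (a b : nat -> I -> L) :
  (forall n, exists2 s, in_galois_group iota s &
     forall m i, (m < n)%N -> s (a m i) = b m i) ->
  exists2 s, in_galois_group iota s & forall m i, s (a m i) = b m i.
Proof.
move=> approx.
have /choice[s sP] : forall n, exists s, in_galois_group iota s /\
    forall m i, (m < n)%N -> s (a m i) = b m i.
  by move=> n; have [s gal_s sab] := approx n; exists s.
pose R : set (L * L) := [set z | exists N, forall n, (N <= n)%N -> s n z.1 = z.2].
have isoR : partial_iso R.
  split; last first.
    by move=> z /set_mem[N Nz]; rewrite -(Nz N (leqnn N)) fmorph_eq0.
  split=> [|z z' /set_mem[N Nz] /set_mem[N' Nz']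
           |z z' /set_mem[N Nz] /set_mem[N' Nz']]; apply/mem_set.
  - by exists 0%N => n _; rewrite rmorph1.
  - exists (maxn N N') => n; rewrite geq_max => /andP[leN leN'].
    by rewrite rmorphB Nz ?Nz'.
  - exists (maxn N N') => n; rewrite geq_max => /andP[leN leN'] /=.
    have eq0 : (z'.1 == 0) = (z'.2 == 0) by rewrite -(Nz' n leN') fmorph_eq0.
    by rewrite pair_invf //= fmorph_div Nz ?Nz'.
have [E [u [v RE]]] := partial_isoP isoR.
have [eta [uE vE]] : exists eta : {rmorphism F -> E},
    (forall x, u (eta x) = iota x) /\ (forall x, v (eta x) = iota x).
  apply: graph_sub_lift => _ [x _ <-]; rewrite -RE.
  by exists 0%N => n _; have [[_ ->]] := sP n.
have [t gal_t tP] := galois_extend uE vE; exists t => // m i.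
have : R (a m i, b m i) by exists m.+1 => n lt_mn; apply: (sP n).2.
by rewrite RE => -[e _ [<- <-]].
Qed.

End GaloisGroup.

(** * Power series *)

Section PowerSeriesRing.
Variable R : comNzRingType.
Local Notation O := (pseries R).
Implicit Types (a b c : O) (x : R).

Definition psX : O := PSeries (fun n => (n == 1%N)%:R).
Definition psC x : O := PSeries (fun n => if n == 0%N then x else 0).
Definition ps_shift a : O := PSeries (fun n => pscoef a n.+1).
Definition ps_const a : R := pscoef a 0.

Lemma pscoef0 n : pscoef (0 : O) n = 0. Proof. by []. Qed.

Lemma pscoefD a b n : pscoef (a + b) n = pscoef a n + pscoef b n.
Proof. by []. Qed.

Lemma pscoefB a b n : pscoef (a - b) n = pscoef a n - pscoef b n.
Proof. by []. Qed.

Lemma pscoefM a b n :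
  pscoef (a * b) n = \sum_(i < n.+1) pscoef a i * pscoef b (n - i).
Proof. by []. Qed.

Lemma pscoefCM x a n : pscoef (psC x * a) n = x * pscoef a n.
Proof.
rewrite pscoefM big_ord_recl /= subn0 big1 ?addr0 // => i _; by rewrite mul0r.
Qed.

Lemma pscoefXM a n : pscoef (psX * a) n = if n is n'.+1 then pscoef a n' else 0.
Proof.
case: n => [|n]; rewrite pscoefM big_ord_recl /= mul0r add0r ?big_ord0 //.
rewrite big_ord_recl /= mul1r subSS subn0 big1 ?addr0 // => i _.
by rewrite mul0r.
Qed.

Lemma pscoefXnM a m n :
  pscoef (psX ^+ m * a) n = if (n < m)%N then 0 else pscoef a (n - m).
Proof.
elim: m n => [|m IHm] n; first by rewrite expr0 mul1r subn0.
by rewrite exprS -mulrA pscoefXM; case: n => // n; rewrite IHm.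
Qed.

Fact psC_is_zmod_morphism : zmod_morphism psC.
Proof. by move=> x y; apply: pseriesP => -[|n] //=; rewrite subrr. Qed.
Fact psC_is_monoid_morphism : monoid_morphism psC.
Proof.
split=> [|x y]; first by apply: pseriesP => -[].
by apply: pseriesP => -[|n]; rewrite pscoefCM //= mulr0.
Qed.
HB.instance Definition _ := GRing.isZmodMorphism.Build R O psC psC_is_zmod_morphism.
HB.instance Definition _ := GRing.isMonoidMorphism.Build R O psC psC_is_monoid_morphism.

Fact ps_const_is_zmod_morphism : zmod_morphism ps_const.
Proof. by []. Qed.
Fact ps_const_is_monoid_morphism : monoid_morphism ps_const.
Proof. by split=> // a b; rewrite /ps_const pscoefM big_ord_recl big_ord0 addr0. Qed.
HB.instance Definition _ :=
  GRing.isZmodMorphism.Build O R ps_const ps_const_is_zmod_morphism.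
HB.instance Definition _ :=
  GRing.isMonoidMorphism.Build O R ps_const ps_const_is_monoid_morphism.

Lemma ps_constX : ps_const psX = 0. Proof. by []. Qed.

Lemma ps_constC x : ps_const (psC x) = x. Proof. by []. Qed.

Lemma ps_const_shift a : a = psC (ps_const a) + psX * ps_shift a.
Proof.
by apply: pseriesP => -[|n]; rewrite pscoefD pscoefXM /= ?addr0 ?add0r.
Qed.

Lemma ps_const_eq0 a : ps_const a = 0 -> a = psX * ps_shift a.
Proof. by move=> a0; rewrite [LHS]ps_const_shift a0 rmorph0 add0r. Qed.

Lemma ps_const_neq0 a : ps_const a != 0 -> a != 0.
Proof. by apply: contraNneq => ->. Qed.

Lemma ps_order a : a != 0 -> exists n b, ps_const b != 0 /\ a = psX ^+ n * b.
Proof.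
move=> a0; have ex : exists n, pscoef a n != 0.
  apply: contrapT => none; move/eqP: a0; apply; apply: pseriesP => n.
  by apply/eqP/negPn/negP => an; apply: none; exists n.
case: (ex_minnP ex) => n an minn.
exists n, (PSeries (fun i => pscoef a (i + n))); split=> //.
apply: pseriesP => i; rewrite pscoefXnM; case: ltnP => [lt_in|le_ni] /=.
  by apply/eqP/negPn/negP => /minn; rewrite leqNgt lt_in.
by rewrite subnK.
Qed.

Lemma ps_truncP n a b :
  ps_trunc n a = ps_trunc n b <-> forall i, (i < n)%N -> pscoef a i = pscoef b i.
Proof.
split=> [ab i lt_in|ab]; last by apply/polyP => i; rewrite !coef_poly; case: ltnP => // /ab.
by have := congr1 (fun p : {poly R} => p`_i) ab; rewrite !coef_poly lt_in.
Qed.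

Lemma ps_trunc_eq a b : (forall n, ps_trunc n a = ps_trunc n b) -> a = b.
Proof. by move=> ab; apply: pseriesP => n; have /ps_truncP := ab n.+1; apply. Qed.

Lemma ps_trunc_leq m n a b : (m <= n)%N ->
  ps_trunc n a = ps_trunc n b -> ps_trunc m a = ps_trunc m b.
Proof.
move=> le_mn /ps_truncP ab; apply/ps_truncP => i lt_im.
exact/ab/(leq_trans lt_im).
Qed.

Fact ps_trunc_is_zmod_morphism n : zmod_morphism (@ps_trunc R n).
Proof.
by move=> a b; apply/polyP => i; rewrite coefB !coef_poly; case: ltnP; rewrite ?subrr.
Qed.
HB.instance Definition _ n :=
  GRing.isZmodMorphism.Build O {poly R} (@ps_trunc R n) (ps_trunc_is_zmod_morphism n).

Lemma ps_trunc_eq0P n a :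
  ps_trunc n a = 0 <-> forall i, (i < n)%N -> pscoef a i = 0.
Proof. by rewrite -(raddf0 (@ps_trunc R n)); apply: ps_truncP. Qed.

Lemma ps_truncM n a b :
  ps_trunc n (a * b) = take_poly n (ps_trunc n a * ps_trunc n b).
Proof.
apply/polyP => i; rewrite coef_poly coef_take_poly; case: ltnP => // lt_in.
rewrite coefM pscoefM; apply: eq_bigr => j _; rewrite !coef_poly.
by rewrite !(leq_ltn_trans _ lt_in) ?leq_subr // -ltnS.
Qed.

Lemma ps_trunc_horner n (p : {poly O}) a b :
  ps_trunc n a = ps_trunc n b -> ps_trunc n p.[a] = ps_trunc n p.[b].
Proof.
move=> ab; elim/poly_ind: p => [|p c IHp]; first by rewrite !horner0.
by rewrite !hornerMXaddC !raddfD /= !ps_truncM IHp ab.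
Qed.

Lemma ps_trunc_XM n a b :
  ps_trunc n a = ps_trunc n b -> ps_trunc n.+1 (psX * a) = ps_trunc n.+1 (psX * b).
Proof.
by move=> /ps_truncP ab; apply/ps_truncP => -[|i] lt_in; rewrite !pscoefXM // ab.
Qed.

(* The map [b |-> c + psX * p.[b]] is contracting for the adic topology. *)
Lemma ps_fixpoint c (p : {poly O}) : exists b, b = c + psX * p.[b].
Proof.
pose f b := c + psX * p.[b].
have contr n a b : ps_trunc n a = ps_trunc n b -> ps_trunc n.+1 (f a) = ps_trunc n.+1 (f b).
  by move=> ab; rewrite !raddfD /=; congr (_ + _); apply/ps_trunc_XM/ps_trunc_horner.
pose s n := iter n f 0.
have s_stable n m : ps_trunc n (s n) = ps_trunc n (s (n + m)%N).
  elim: n m => [|n IHn] m; last by apply: contr; apply: IHn.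
  by apply/ps_truncP.
pose a : O := PSeries (fun n => pscoef (s n.+1) n).
have a_s n : ps_trunc n a = ps_trunc n (s n).
  apply/ps_truncP => i lt_in; have /ps_truncP := s_stable i.+1 (n - i.+1)%N.
  by rewrite subnKC //; apply.
by exists a; apply: ps_trunc_eq => -[|n]; [apply/ps_truncP|rewrite a_s; apply/contr].
Qed.

End PowerSeriesRing.
Arguments psX {R}.
Arguments psC {R} x : simpl never.
Arguments ps_const {R} a : simpl never.

Section PowerSeriesMap.
Variables (R S : comNzRingType) (f : {rmorphism R -> S}).

Definition ps_map (a : pseries R) : pseries S := PSeries (fun n => f (pscoef a n)).

Fact ps_map_is_zmod_morphism : zmod_morphism ps_map.
Proof. by move=> a b; apply: pseriesP => n; apply: rmorphB. Qed.
Fact ps_map_is_monoid_morphism : monoid_morphism ps_map.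
Proof.
split=> [|a b]; apply: pseriesP => n; first by rewrite /= rmorph_nat.
by rewrite /= rmorph_sum; apply: eq_bigr => i _; rewrite rmorphM.
Qed.
HB.instance Definition _ := GRing.isZmodMorphism.Build
  (pseries R) (pseries S) ps_map ps_map_is_zmod_morphism.
HB.instance Definition _ := GRing.isMonoidMorphism.Build
  (pseries R) (pseries S) ps_map ps_map_is_monoid_morphism.

Lemma ps_map_trunc n a b : ps_trunc n a = ps_trunc n b ->
  ps_trunc n (ps_map a) = ps_trunc n (ps_map b).
Proof. by move=> /ps_truncP ab; apply/ps_truncP => i lt_in; rewrite /= ab. Qed.

End PowerSeriesMap.

Lemma ps_map_comp (R S U : comNzRingType) (g : {rmorphism S -> U}) (f : {rmorphism R -> S}) a :
  ps_map g (ps_map f a) = ps_map (g \o f) a.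
Proof. by []. Qed.

Lemma eq_ps_map (R S : comNzRingType) (f g : {rmorphism R -> S}) :
  f =1 g -> ps_map f =1 ps_map g.
Proof. by move=> fg a; apply: pseriesP => n /=. Qed.

Lemma ps_unitE (R : comUnitRingType) (a : pseries R) :
  (a \is a GRing.unit) = (ps_const a \is a GRing.unit).
Proof.
apply/idP/idP => [/(rmorph_unit ps_const) //|a0].
pose d := psC (ps_const a)^-1.
have [b] := ps_fixpoint d ((- d * ps_shift a) *: 'X).
rewrite hornerZ hornerX => b_fix; apply/unitrPr; exists b.
have du : d \is a GRing.unit by rewrite /d rmorph_unit ?unitrV.
have da : d * a = 1 + psX * (d * ps_shift a).
  by rewrite {1}[a]ps_const_shift mulrDr -rmorphM mulVr // rmorph1 mulrCA.
apply: (mulrI du); rewrite mulrA da mulr1 mulrDl mul1r {1}b_fix.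
by rewrite !mulNr mulrN -addrA -[psX * _ * b]mulrA addNr addr0.
Qed.

(* Taylor expansion at [a] turns the equation into a fixpoint problem in
   [b], where [x = a + psX * b]. *)
Lemma ps_hensel (R : comUnitRingType) (p : {poly pseries R}) (a : R) :
  root (map_poly ps_const p) a ->
  (map_poly ps_const p)^`().[a] \is a GRing.unit ->
  exists2 x, ps_const x = a & root p x.
Proof.
rewrite deriv_map => pa p'a.
have const_horner (r : {poly pseries R}) : ps_const r.[psC a] = (map_poly ps_const r).[a].
  by rewrite -horner_map /= ps_constC.
pose p0 := ps_shift p.[psC a]; pose p1 := p^`().[psC a].
have p0E : p.[psC a] = psX * p0 by apply: ps_const_eq0; rewrite const_horner (rootP pa).
have p1u : p1 \is a GRing.unit by rewrite ps_unitE const_horner.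
pose tail := \sum_(i < (size p).-2) (p^`N(i.+2).[psC a] * psX ^+ i) *: 'X^(i.+2).
have [b b_fix] := ps_fixpoint (- p1^-1 * p0) (- p1^-1 *: tail).
exists (psC a + psX * b); first by rewrite rmorphD rmorphM /= ps_constX mul0r addr0.
have taylor : p.[psC a + psX * b] = psX * (p0 + p1 * b + psX * tail.[b]).
  have size_p : (size p <= (size p).-2.+2)%N by case: (size p) => [|[|n]].
  rewrite (nderiv_taylor_wide (mulrC _ _) size_p).
  rewrite !big_ord_recl expr0 mulr1 nderivn0 p0E nderivn1 expr1 -/p1.
  rewrite horner_sum !mulrDr mulrCA -addrA; congr (_ + (_ + _)).
  rewrite !mulr_sumr; apply: eq_bigr => i _; rewrite hornerZ hornerXn exprMn !exprS.
  by rewrite /bump /=; ring.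
have p1b : p1 * b = - (p1 / p1) * (p0 + psX * tail.[b]).
  by rewrite {1}b_fix hornerZ; ring.
by rewrite /root taylor p1b divrr // mulN1r opprD addNKr addNr mulr0.
Qed.

Section PowerSeriesDomain.
Variable R : idomainType.

Fact ps_integral : GRing.integral_domain_axiom (pseries R).
Proof.
move=> a b /eqP; apply: contraTT; rewrite negb_or => /andP[a0 b0].
have [n [a' [a'0 ->]]] := ps_order a0; have [m [b' [b'0 ->]]] := ps_order b0.
rewrite mulrACA -exprD; apply/eqP => /(congr1 (fun c => pscoef c (n + m))).
rewrite pscoefXnM ltnn subnn => /eqP.
by rewrite -[pscoef _ _]/(ps_const (a' * b')) rmorphM mulf_eq0 (negPf a'0) (negPf b'0).
Qed.
HB.instance Definition _ := GRing.ComUnitRing_isIntegral.Build (pseries R) ps_integral.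

Lemma psX_neq0 : psX != 0 :> pseries R.
Proof. by apply/eqP => /(congr1 (fun a => pscoef a 1))/eqP; rewrite oner_eq0. Qed.

End PowerSeriesDomain.

(** * Valuation rings and irreducibility *)

Lemma tofrac_inj (A : idomainType) : injective (@tofrac A).
Proof. by move=> a b /eqP; rewrite tofrac_eq => /eqP. Qed.

Lemma fractionP (A : idomainType) (x : {fraction A}) :
  exists ab : A * A, ab.2 != 0 /\ x = tofrac ab.1 / tofrac ab.2.
Proof.
elim/quotW: x => y; exists (frac y).
have y2 := denom_ratioP y; split=> //.
have y2F : tofrac (frac y).2 != 0 :> {fraction A} by rewrite tofrac_eq0.
apply: (mulIf y2F); rewrite divfK //; unlock tofrac.
rewrite -[LHS]FracField.pi_mul; apply/eqmodP; rewrite /= FracField.equivfE.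
by rewrite /FracField.mulf !numden_Ratio ?mulf_neq0 ?oner_neq0 // !mulr1 mulrC.
Qed.

Lemma fraction_lift (A : idomainType) (C : fieldType) (j : {rmorphism A -> C}) :
  injective j -> exists h : {rmorphism {fraction A} -> C}, forall a, h (tofrac a) = j a.
Proof.
move=> inj_j; have j0 a : (j a == 0) = (a == 0) by rewrite -(rmorph0 j) (inj_eq inj_j).
have [f fP] := choice (@fractionP A).
pose h x := j (f x).1 / j (f x).2.
have hE a b : b != 0 -> h (tofrac a / tofrac b) = j a / j b.
  move=> b0; rewrite /h; have [d0 /eqP] := fP (tofrac a / tofrac b).
  rewrite eqr_div ?tofrac_eq0 // -!rmorphM tofrac_eq => /eqP xE.
  by apply/eqP; rewrite eqr_div ?j0 // -!rmorphM xE.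
have common (x y : {fraction A}) : exists a a' b,
    [/\ b != 0, x = tofrac a / tofrac b & y = tofrac a' / tofrac b].
  have [dx xE] := fP x; have [dy yE] := fP y.
  exists ((f x).1 * (f y).2), ((f y).1 * (f x).2), ((f x).2 * (f y).2).
  split; first exact: mulf_neq0.
    by rewrite !rmorphM -mulf_div divff ?tofrac_eq0 ?mulr1.
  by rewrite [X in _ / tofrac X]mulrC !rmorphM -mulf_div divff ?tofrac_eq0 ?mulr1.
have hB : zmod_morphism h.
  move=> x y; have [a [a' [b [b0 -> ->]]]] := common x y.
  by rewrite -mulrBl -rmorphB !hE // rmorphB mulrBl.
have h1 a : h (tofrac a) = j a.
  by have := hE a 1 (oner_neq0 _); rewrite !rmorph1 !divr1.
have hM : monoid_morphism h.
  split=> [|x y]; first by rewrite -(rmorph1 (@tofrac A)) h1 rmorph1.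
  have [a [a' [b [b0 -> ->]]]] := common x y.
  by rewrite mulf_div -!rmorphM !hE ?mulf_neq0 // !rmorphM mulf_div.
pose h' : {rmorphism {fraction A} -> C} := HB.pack h
  (GRing.isZmodMorphism.Build _ _ h hB) (GRing.isMonoidMorphism.Build _ _ h hM).
by exists h'.
Qed.

Definition valuation_ring (O k : nzRingType) (C : fieldType) (incl : O -> C) (res : O -> k) :=
  forall x, (exists a, x = incl a) \/ (exists2 a, res a = 0 & x^-1 = incl a).

Section Gauss.
Variables (O : idomainType) (k C : fieldType).
Variables (incl : {rmorphism O -> C}) (res : {rmorphism O -> k}).
Hypotheses (incl_inj : injective incl) (valO : valuation_ring incl res).
Local Notation "p ^i" := (map_poly incl p) (at level 2).
Local Notation "p ^r" := (map_poly res p) (at level 2).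

Let incl_poly_inj : injective (map_poly incl).
Proof. by apply: map_inj_poly; rewrite ?rmorph0. Qed.

Lemma valuation_ring_common_divisor (s : seq C) : s != [::] ->
  exists2 x, x \in s & forall y, y \in s -> exists a, y = incl a * x.
Proof.
elim: s => // z s IHs _; have [->|/IHs[x xs x_dvd] {IHs}] := eqVneq s [::].
  by exists z; rewrite ?mem_head // => y /[!inE]/eqP->; exists 1; rewrite rmorph1 mul1r.
have dvd_z a : x = incl a * z -> forall y, y \in z :: s -> exists b, y = incl b * z.
  move=> xE y; rewrite inE => /predU1P[->|/x_dvd[b ->]].
    by exists 1; rewrite rmorph1 mul1r.
  by exists (b * a); rewrite xE rmorphM mulrA.
have zs : z \in z :: s := mem_head z s.
have [x0|x0] := eqVneq x 0.
  by exists z => //; apply: (dvd_z 0); rewrite rmorph0 mul0r.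
case: (valO (z / x)) => [[a zxE]|[a _ xzE]].
  exists x; first by rewrite inE xs orbT.
  by move=> y /[!inE]/predU1P[->|/x_dvd //]; exists a; rewrite -zxE divfK.
have [z0|z0] := eqVneq z 0.
  exists x; first by rewrite inE xs orbT.
  by move=> y /[!inE]/predU1P[->|/x_dvd //]; exists 0; rewrite z0 rmorph0 mul0r.
by exists z => //; apply: (dvd_z a); rewrite -xzE invf_div divfK.
Qed.

Lemma exists_primitive (p : {poly C}) : p != 0 ->
  exists c p1, [/\ c != 0, p1^r != 0 & p = c *: p1^i].
Proof.
move=> p0; have [|c cp c_dvd] := @valuation_ring_common_divisor p.
  by rewrite -size_eq0 size_poly_eq0.
have c0 : c != 0.
  have [|a lpE] := c_dvd (lead_coef p); first by rewrite mem_nth ?prednK ?size_poly_gt0.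
  by apply: contraNneq p0 => c0; rewrite -lead_coef_eq0 lpE c0 mulr0.
have ex i : exists a, p`_i = incl a * c.
  have [/mem_nth/c_dvd //|le_pi] := ltnP i (size p).
  by exists 0; rewrite nth_default // rmorph0 mul0r.
have [f fE] := choice ex; pose p1 := \poly_(i < size p) f i.
have f_default i : (size p <= i)%N -> f i = 0.
  move=> le_pi; have := fE i; rewrite nth_default // => /esym/eqP.
  by rewrite mulf_eq0 (negPf c0) orbF -(rmorph0 incl) (inj_eq incl_inj) => /eqP.
have p1E i : p1`_i = f i.
  by rewrite coef_poly; case: ltnP => // /f_default.
exists c, p1; split=> //; last first.
  by apply/polyP => i; rewrite coefZ coef_map p1E mulrC fE.
have ci := nth_index 0 cp; set i := index c p in ci.
apply: contraNneq (oner_neq0 k) => /polyP/(_ i); rewrite coef_map p1E coef0 => <-.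
rewrite -(rmorph1 res); apply/eqP; congr (res _); apply: incl_inj.
by apply: (mulIf c0); rewrite rmorph1 mul1r -fE.
Qed.

Lemma gauss_factor (p : {poly O}) (a b : {poly C}) : p^r != 0 -> p^i = a * b ->
  exists a1 b1, [/\ p = a1 * b1, size a1 = size a & size b1 = size b].
Proof.
move=> rp0 pE; have p0 : p != 0 by apply: contraNneq rp0 => ->; rewrite rmorph0.
have [a0 b0] : a != 0 /\ b != 0.
  by apply/andP; rewrite -negb_or -mulf_eq0 -pE -(rmorph0 (map_poly incl)) (inj_eq incl_poly_inj).
have [c [a1 [c0 ra1 aE]]] := exists_primitive a0.
have [d [b1 [d0 rb1 bE]]] := exists_primitive b0.
have {pE} pE : p^i = (c * d) *: (a1 * b1)^i.
  by rewrite pE aE bE -scalerAl -scalerAr scalerA rmorphM.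
have size_incl (r : {poly O}) : size r^i = size r by rewrite size_map_inj_poly ?rmorph0.
case: (valO (c * d)) => [[e cdE]|[e re0 cdE]].
  have e0 : incl e != 0 by rewrite -cdE mulf_neq0.
  exists (e *: a1), b1; split.
  - by apply: incl_poly_inj; rewrite pE cdE -map_polyZ scalerAl.
  - by rewrite aE -size_incl map_polyZ !size_scale.
  - by rewrite bE size_scale.
have epE : e *: p = a1 * b1.
  by apply: incl_poly_inj; rewrite map_polyZ pE -cdE scalerA mulVf ?mulf_neq0 ?scale1r.
by case/eqP: (mulf_neq0 ra1 rb1); rewrite -rmorphM -epE /= map_polyZ re0 scale0r.
Qed.

Lemma gauss_irreducible (p : {poly O}) : p^r != 0 -> (1 < size p)%N ->
  (forall a b, p = a * b -> (size a <= 1)%N \/ (size b <= 1)%N) ->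
  irreducible_poly p^i.
Proof.
move=> rp0 p1 factor; have size_incl : size p^i = size p by rewrite size_map_inj_poly ?rmorph0.
split=> [|d d1 dvd]; first by rewrite size_incl.
have [e pE] := dvdpP _ _ dvd; have pi0 : p^i != 0 by rewrite -size_poly_gt0 size_incl ltnW.
have [e0 d0] : e != 0 /\ d != 0 by apply/andP; rewrite -negb_or -mulf_eq0 -pE.
have [e1 [d2 [pE1 se sd]]] := gauss_factor rp0 pE.
rewrite -dvdp_size_eqp // pE size_mul // -se -sd.
move: e0 d0 d1; rewrite -!size_poly_gt0 -se -sd => e0 d0 d1.
case: (factor _ _ pE1); last by rewrite leqNgt ltn_neqAle eq_sym d1 d0.
by move=> le_e1; rewrite (_ : size e1 = 1%N) //; apply/eqP; rewrite eqn_leq le_e1.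
Qed.

Definition not_in_max_square x := forall a b, res a = 0 -> res b = 0 -> x != a * b.

Lemma eisenstein (p : {poly O}) n :
  size p = n.+2 -> res (lead_coef p) != 0 -> p^r = res (lead_coef p) *: 'X^(n.+1) ->
  not_in_max_square p`_0 -> irreducible_poly p^i.
Proof.
move=> size_p lp0 rpE p0; apply: gauss_irreducible; rewrite ?size_p //.
  by rewrite rpE scaler_eq0 (negPf lp0) -size_poly_eq0 size_polyXn.
move=> a b pE; have [la lb] : res (lead_coef a) != 0 /\ res (lead_coef b) != 0.
  by apply/andP; rewrite -negb_or -mulf_eq0 -rmorphM -lead_coefM -pE.
have const0 (d : {poly O}) : (1 < size d)%N -> res (lead_coef d) != 0 -> d^r %| p^r -> res d`_0 = 0.
  move=> d1 ld; rewrite rpE dvdpZr // -['X]subr0 -polyC0 => /dvdp_exp_XsubCP[i _ dE].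
  have := eqp_size dE; rewrite size_exp_XsubC size_map_poly_id0 // => size_d.
  have : root d^r 0.
    rewrite (eqp_root dE) /root horner_exp hornerXsubC subrr expr0n.
    by rewrite -eqSS -size_d; case: (size d) d1 => [|[]].
  by rewrite /root horner_coef0 coef_map => /eqP.
case: (leqP (size a) 1) => [|a1]; [by left|right; rewrite leqNgt; apply/negP => b1].
suff : p`_0 != a`_0 * b`_0 by rewrite pE coef0M eqxx.
by apply: p0; apply: const0 => //; rewrite pE rmorphM ?dvdp_mulIl ?dvdp_mulIr.
Qed.

Lemma reversed_eisenstein (p : {poly O}) : (1 < size p)%N -> res p`_0 != 0 ->
  (forall i, res p`_i.+1 = 0) -> not_in_max_square (lead_coef p) ->
  irreducible_poly p^i.
Proof.
move=> p1 p0 pS lp; have rpE : p^r = (res p`_0)%:P.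
  by apply/polyP => -[|i]; rewrite coef_map coefC /=.
apply: gauss_irreducible => [||a b pE] //; first by rewrite rpE polyC_eq0.
have /eqP : size (a^r * b^r) = 1%N by rewrite -rmorphM -pE /= rpE size_polyC p0.
rewrite size_mul_eq1 => /andP[/eqP size_ra /eqP size_rb].
have lead0 (d : {poly O}) : (1 < size d)%N -> size d^r = 1%N -> res (lead_coef d) = 0.
  move=> d1 size_rd; rewrite lead_coefE -coef_map nth_default // size_rd.
  by case: (size d) d1 => [|[]].
case: (leqP (size a) 1) => [|a1]; [by left|right; rewrite leqNgt; apply/negP => b1].
suff : lead_coef p != lead_coef a * lead_coef b by rewrite pE lead_coefM eqxx.
by apply: lp; apply: lead0.
Qed.

End Gauss.

Section LaurentSeries.
Variable k : fieldType.

Lemma tofracV_ps (a : pseries k) : ps_const a != 0 -> tofrac a^-1 = (tofrac a)^-1.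
Proof.
move=> a0; have aF : tofrac a != 0 by rewrite tofrac_eq0 ps_const_neq0.
by apply: (mulIf aF); rewrite -rmorphM mulVr ?ps_unitE ?unitfE // mulVf // rmorph1.
Qed.

Lemma pseries_valuation_ring :
  valuation_ring (@tofrac (pseries k)) (@ps_const k).
Proof.
move=> x; have [[a b] /= [b0 ->]] := fractionP x.
have [->|a0] := eqVneq a 0; first by left; exists 0; rewrite !rmorph0 mul0r.
have [n [a' [a'0 ->]]] := ps_order a0; have [m [b' [b'0 ->]]] := ps_order b0.
have r0 i : tofrac (psX ^+ i) != 0 :> {fraction pseries k}.
  by rewrite tofrac_eq0 expf_neq0 // psX_neq0.
case: (leqP m n) => [le_mn|lt_nm]; [left|right].
  exists (psX ^+ (n - m) * a' * b'^-1); rewrite -{1}(subnK le_mn) exprD !rmorphM /=.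
  by rewrite tofracV_ps // [X in X / _]mulrAC [X in _ / X]mulrC -mulf_div divff // mulr1.
exists (psX ^+ (m - n) * b' * a'^-1).
  by rewrite !rmorphM rmorphXn /= ps_constX expr0n subn_eq0 leqNgt lt_nm !mul0r.
rewrite invf_div -{1}(subnK (ltnW lt_nm)) exprD !rmorphM /=.
by rewrite tofracV_ps // [X in X / _]mulrAC [X in _ / X]mulrC -mulf_div divff // mulr1.
Qed.

Lemma not_in_max_square_ps (a : pseries k) :
  pscoef a 1 != 0 -> not_in_max_square (@ps_const k) a.
Proof.
move=> a1 b c b0 c0; apply: contraNneq a1 => ->.
rewrite pscoefM !big_ord_recl big_ord0 /= subnn.
by rewrite -![pscoef _ 0]/(ps_const _) b0 c0 mul0r mulr0 !addr0.
Qed.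

End LaurentSeries.

(** * Frobenius polynomials *)

Section Frobenius.
Variables (Fq : finFieldType) (R : comNzRingType) (kap : {rmorphism Fq -> R}).
Local Notation q := #|Fq|.

Lemma pchar_card : [pchar R].-nat q.
Proof.
have [p pr_p pcharFp] := finPcharP Fq.
have pR : p \in [pchar R].
  by rewrite inE pr_p -(rmorph_nat kap) pcharf0 // rmorph0 eqxx.
rewrite (eq_pnat _ (pcharf_eq pR)) -cardsT.
exact: abelem_pgroup (fin_ring_pchar_abelem pcharFp).
Qed.

Lemma exprD_card (x y : R) : (x + y) ^+ q = x ^+ q + y ^+ q.
Proof. by rewrite exprDn_pchar ?pchar_card. Qed.

Lemma expr_card_rmorph c : kap c ^+ q = kap c.
Proof. by rewrite -rmorphXn expf_card. Qed.

Lemma natr_card : q%:R = 0 :> R.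
Proof.
have in_group : (1 : Fq) \in [set: Fq]%G by rewrite inE.
have := expg_cardG in_group; rewrite FinRing.zmodXgE cardsT FinRing.zmod1gE => card0.
by rewrite -(rmorph_nat kap) card0 rmorph0.
Qed.

End Frobenius.

Lemma exists_notin_seq (T : finType) (s : seq T) : (size s < #|T|)%N -> exists x, x \notin s.
Proof.
move=> lt_sT; apply/existsP; apply: contraLR lt_sT => /existsPn all_in.
rewrite -leqNgt; apply: leq_trans (card_size s); apply: subset_leq_card.
by apply/fintype.subsetP => x _; have := all_in x; rewrite negbK.
Qed.

Section FqLinear.
Variables (Fq : finFieldType) (R : nzRingType) (kap : {rmorphism Fq -> R}).

Definition fq_linear (f : R -> R) :=
  forall c x y, f (kap c * x + y) = kap c * f x + f y.

Lemma fq_linear_comp f g : fq_linear f -> fq_linear g -> fq_linear (f \o g).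
Proof. by move=> linf ling c x y; rewrite /= ling linf. Qed.

Lemma fq_linear_iter f n : fq_linear f -> fq_linear (iter n f).
Proof. by move=> linf; elim: n => [|n IHn] c x y //=; rewrite IHn linf. Qed.

Variable f : R -> R.
Hypothesis linf : fq_linear f.

Lemma fq_linearD : {morph f : x y / x + y}.
Proof. by move=> x y; have := linf 1 x y; rewrite rmorph1 !mul1r. Qed.

Lemma fq_linear0 : f 0 = 0.
Proof. by apply: (addIr (f 0)); rewrite -fq_linearD !add0r. Qed.

Lemma fq_linearZ c x : f (kap c * x) = kap c * f x.
Proof. by have := linf c x 0; rewrite fq_linear0 !addr0. Qed.

Lemma fq_linearB : {morph f : x y / x - y}.
Proof.
move=> x y; have := linf (-1) y x.
by rewrite rmorphN1 !mulN1r ![- _ + _]addrC.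
Qed.

Lemma fq_linear_sum n (b : 'I_n -> Fq) (x : 'I_n -> R) :
  f (\sum_i kap (b i) * x i) = \sum_i kap (b i) * f (x i).
Proof.
rewrite (big_morph f fq_linearD fq_linear0).
by apply: eq_bigr => i _; apply: fq_linearZ.
Qed.

End FqLinear.

(* Value at [x] of the skew polynomial [\sum_i s_i tau^i]. *)
Fixpoint tau_eval (R : pzSemiRingType) (q : nat) (s : seq R) (x : R) : R :=
  if s is a :: s' then a * x + tau_eval q s' (x ^+ q) else 0.

Lemma tau_evalE (R : pzSemiRingType) q (s : seq R) x :
  tau_eval q s x = \sum_(i < size s) s`_i * x ^+ (q ^ i).
Proof.
elim: s x => [|a s IHs] x; first by rewrite big_ord0.
rewrite /= IHs big_ord_recl /= expr1; congr (_ + _).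
by apply: eq_bigr => i _; rewrite -exprM expnS.
Qed.

Lemma rmorph_tau_eval (R S : pzSemiRingType) (f : {rmorphism R -> S}) q s x :
  f (tau_eval q s x) = tau_eval q (map f s) (f x).
Proof.
elim: s x => [|a s IHs] x /=; first exact: rmorph0.
by rewrite rmorphD rmorphM IHs rmorphXn.
Qed.

Lemma fq_linear_tau_eval (Fq : finFieldType) (R : comNzRingType)
    (kap : {rmorphism Fq -> R}) s :
  fq_linear kap (tau_eval #|Fq| s).
Proof.
elim: s => [|a s IHs] c x y /=; first by rewrite mulr0 addr0.
by rewrite (exprD_card kap) exprMn expr_card_rmorph IHs; ring.
Qed.

Lemma size_deriv_gt1 (R : nzRingType) (p : {poly R}) : deriv p != 0 -> (1 < size p)%N.
Proof. by rewrite ltnNge; apply: contra => /size1_polyC ->; rewrite derivC. Qed.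

Lemma separable_deriv_const (K : fieldType) (p : {poly K}) c :
  deriv p = c%:P -> c != 0 -> separable_poly p.
Proof.
move=> p' c0; rewrite separable_poly.unlock p' -[c%:P]mulr1 mul_polyC.
by rewrite (eqp_coprimepr _ (eqp_scale 1 c0)) coprimep1.
Qed.

Section TauPoly.
Variables (Fq : finFieldType) (R : comNzRingType) (kap : {rmorphism Fq -> R}).
Local Notation q := #|Fq|.
Implicit Type s : seq R.

Definition tau_poly s : {poly R} := tau_eval q (map polyC s) 'X.

Lemma horner_tau_poly s x : (tau_poly s).[x] = tau_eval q s x.
Proof.
rewrite -/(horner_eval x _) rmorph_tau_eval -map_comp /= /horner_eval hornerX.
by rewrite (eq_map (fun a => hornerC a x)) map_id.
Qed.

Lemma deriv_exp_card (p : {poly R}) : deriv (p ^+ q) = 0.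
Proof. by rewrite deriv_exp -mulr_natr -polyC_natr (natr_card kap) polyC0 mulr0. Qed.

Lemma deriv_tau_poly s : deriv (tau_poly s) = (s`_0)%:P.
Proof.
have deriv0 t (p : {poly R}) : deriv p = 0 -> deriv (tau_eval q (map polyC t) p) = 0.
  elim: t p => [|a t IHt] p p' /=; first exact: derivC.
  by rewrite derivD derivM derivC p' mul0r mulr0 IHt ?deriv_exp_card // !addr0.
rewrite /tau_poly; case: s => [|a s] /=; first by rewrite derivC polyC0.
by rewrite derivD derivM derivC derivX mul0r add0r mulr1 deriv0 ?deriv_exp_card ?addr0.
Qed.

Lemma size_tau_poly s : (size (tau_poly s) <= (q ^ (size s).-1).+1)%N.
Proof.
rewrite /tau_poly tau_evalE size_map; apply: leq_trans (size_sum _ _ _) _.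
apply/bigmax_leqP => i _; rewrite (nth_map 0) // mul_polyC.
apply: leq_trans (size_scale_leq _ _) _; rewrite size_polyXn ltnS leq_pexp2l //.
  exact: ltnW (finNzRing_gt1 Fq).
by case: (size s) i => [[]|n] //= i; rewrite -ltnS.
Qed.

End TauPoly.

Lemma map_tau_poly (Fq : finFieldType) (R S : comNzRingType) (f : {rmorphism R -> S}) s :
  map_poly f (tau_poly Fq s) = tau_poly Fq (map f s).
Proof.
rewrite /tau_poly rmorph_tau_eval /= map_polyX -!map_comp.
by congr (tau_eval _ _ _); apply: eq_map => a; rewrite /= map_polyC.
Qed.

Section TauEquation.
Variable Fq : finFieldType.
Local Notation q := #|Fq|.

Lemma deriv_tau_polyB (R : comNzRingType) (kap : {rmorphism Fq -> R}) (s : seq R) y :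
  deriv (tau_poly Fq s - y%:P) = (s`_0)%:P.
Proof. by rewrite derivB derivC subr0 (deriv_tau_poly kap). Qed.

Lemma root_tau_polyB (R : comNzRingType) (s : seq R) x y :
  root (tau_poly Fq s - y%:P) x = (tau_eval q s x == y).
Proof. by rewrite /root hornerD hornerN hornerC horner_tau_poly subr_eq0. Qed.

Lemma tau_eval_surjective (L : fieldType) (kap : {rmorphism Fq -> L}) s :
  separably_closed L -> s`_0 != 0 -> forall y : L, exists x, tau_eval q s x = y.
Proof.
move=> closedL s0 y; have p' := deriv_tau_polyB kap s y.
have [||x] := closedL (tau_poly Fq s - y%:P).
- exact: separable_deriv_const p' s0.
- by apply: size_deriv_gt1; rewrite p' polyC_eq0.
by rewrite root_tau_polyB => /eqP; exists x.
Qed.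

Lemma tau_eval_descent (E C : fieldType) (kap : {rmorphism Fq -> E})
    (u : {rmorphism E -> C}) s x y :
  relatively_separably_closed u -> s`_0 != 0 -> tau_eval q (map u s) x = u y ->
  exists2 e, u e = x & tau_eval q s e = y.
Proof.
move=> closu s0 sx.
have [||e ue] := closu (tau_poly Fq s - y%:P) x.
- exact: separable_deriv_const (deriv_tau_polyB kap s y) s0.
- by rewrite rmorphB /= map_tau_poly map_polyC root_tau_polyB sx.
by exists e => //; apply: (fmorph_inj u); rewrite rmorph_tau_eval ue.
Qed.

Lemma tau_eval_hensel (k : fieldType) (kap : {rmorphism Fq -> k})
    (s : seq (pseries k)) (y : pseries k) a :
  ps_const s`_0 != 0 -> tau_eval q (map ps_const s) a = ps_const y ->
  exists2 x, ps_const x = a & tau_eval q s x = y.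
Proof.
move=> s0 sa; have [||x xa] := @ps_hensel _ (tau_poly Fq s - y%:P) a.
- by rewrite rmorphB /= map_tau_poly map_polyC root_tau_polyB sa.
- by rewrite deriv_map (deriv_tau_polyB (psC \o kap)) map_polyC hornerC unitfE.
by rewrite root_tau_polyB => /eqP; exists x.
Qed.

Lemma tau_eval_kernel (L : fieldType) (kap : {rmorphism Fq -> L}) c g :
  separably_closed L -> c != 0 -> g != 0 ->
  exists2 x : L, x != 0 & tau_eval q [:: c; g] x = 0.
Proof.
move=> closedL c0 g0; have q0 : (0 < q)%N := ltnW (finNzRing_gt1 Fq).
have q1 : (0 < q.-1)%N by rewrite -subn1 subn_gt0 finNzRing_gt1.
pose p : {poly L} := 'X^(q.-1) + (c / g)%:P.
have cg0 : c / g != 0 by rewrite mulf_neq0 ?invr_eq0.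
have bezout : p + 'X * deriv p = (c / g)%:P.
  rewrite /p derivD derivC addr0 derivXn mulrnAr addrAC.
  have -> : 'X * 'X^(q.-2) *+ q.-1 = 'X^(q.-1) *+ q.-1 :> {poly L}.
    by rewrite -exprS; case: q.-1.
  rewrite -mulrS prednK // -mulr_natr -polyC_natr (natr_card kap).
  by rewrite polyC0 mulr0 add0r.
have [||x] := closedL p.
- rewrite separable_poly.unlock; apply/Bezout_coprimepP; exists (1, 'X).
  by rewrite mul1r bezout -[(c / g)%:P]mulr1 mul_polyC eqp_scale.
- by rewrite size_XnaddC.
rewrite /root hornerD hornerXn hornerC addr_eq0 => /eqP xq.
exists x; last by rewrite /= addr0 -(prednK q0) exprS xq; field.
apply: contra_eqN xq => /eqP->.
by rewrite expr0n gtn_eqF // eq_sym oppr_eq0.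
Qed.

End TauEquation.

Lemma closed_field_separably_closed (k : closedFieldType) : separably_closed k.
Proof.
by move=> p _ p1; apply/closed_rootP; rewrite neq_ltn p1 orbT.
Qed.

(* [p] has at most [q ^ n] roots, so the [F_q]-combinations of [n] independent
   roots exhaust them. *)
Lemma fq_span_roots (Fq : finFieldType) (L : idomainType) (kap : {rmorphism Fq -> L})
    n (w : 'rV[L]_n) (p : {poly L}) v :
  p != 0 -> (size p <= (#|Fq| ^ n).+1)%N ->
  (forall b : 'cV[Fq]_n, w *m map_mx kap b = 0 -> b = 0) ->
  (forall b : 'cV[Fq]_n, root p ((w *m map_mx kap b) 0 0)) ->
  root p v -> exists b : 'cV[Fq]_n, v%:M = w *m map_mx kap b.
Proof.
move=> p0 size_p free_w root_w root_v.
pose comb (b : 'cV[Fq]_n) := (w *m map_mx kap b) 0 0.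
have comb_inj : injective comb.
  move=> b b' eq_bb'; apply/subr0_eq/free_w; apply/matrixP => i j.
  rewrite map_mxB mulmxBr !ord1 mxE [LHS]addrC.
  by move: eq_bb'; rewrite /comb => ->; rewrite mxE addNr mxE.
pose combs := [seq comb b | b <- enum {: 'cV[Fq]_n}].
have [/mapP[b _ ->]|v_new] := boolP (v \in combs).
  by exists b; rewrite [RHS]mx11_scalar.
have : (size (v :: combs) < size p)%N.
  apply: max_poly_roots => //=.
    by rewrite root_v; apply/allP => x /mapP[b _ ->]; apply: root_w.
  by rewrite v_new map_inj_uniq ?enum_uniq.
rewrite /= size_map -cardE card_mx muln1 => lt_p.
by have := leq_trans lt_p size_p; rewrite ltnn.
Qed.

(** * Isogeny towers *)

Section Isogeny.
Variables (Fq : finFieldType) (R : comNzRingType).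
Local Notation q := #|Fq|.
Implicit Types (u c g : nat -> R).

Fixpoint isogeny u n x :=
  if n is n'.+1 then tau_eval q [:: u n'; 1] (isogeny u n' x) else x.

Fixpoint dual_isogeny c g n x :=
  if n is n'.+1 then dual_isogeny c g n' (tau_eval q [:: c n'; g n'] x) else x.

Lemma isogenyS u n x : isogeny u n.+1 x = tau_eval q [:: u n; 1] (isogeny u n x).
Proof. by []. Qed.

Lemma dual_isogenyS c g n x :
  dual_isogeny c g n.+1 x = dual_isogeny c g n (tau_eval q [:: c n; g n] x).
Proof. by []. Qed.

Lemma fq_linear_isogeny (kap : {rmorphism Fq -> R}) u n : fq_linear kap (isogeny u n).
Proof.
elim: n => [//|n IHn]; apply: fq_linear_comp IHn; exact: fq_linear_tau_eval.
Qed.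

Lemma fq_linear_dual_isogeny (kap : {rmorphism Fq -> R}) c g n :
  fq_linear kap (dual_isogeny c g n).
Proof.
elim: n => [//|n IHn]; apply: (fq_linear_comp IHn); exact: fq_linear_tau_eval.
Qed.

(* With [E_i = tau + u_i] and [F_i = c_i + g2_i tau], these equations say that
   [F_i E_i = D_i] and [E_i F_i = D_(i+1)] for [D_i = T + g1_i tau + g2_i tau^2]:
   the successive quotients of [D_0] by the kernels of the [E_i]. *)
Record isogeny_tower (T : R) (g1 g2 u c : nat -> R) : Prop := IsogenyTower {
  tower_T : forall i, c i * u i = T;
  tower_g1 : forall i, c i + g2 i * u i ^+ q = g1 i;
  tower_g1S : forall i, g1 i.+1 = c i ^+ q + u i * g2 i;
  tower_g2S : forall i, g2 i.+1 = g2 i ^+ q }.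

Section TowerFactorization.
Variables (kap : {rmorphism Fq -> R}) (T : R) (g1 g2 u c : nat -> R).
Hypothesis tower : isogeny_tower T g1 g2 u c.
Local Notation D i := (tau_eval q [:: T; g1 i; g2 i]).

Lemma tau_eval_dual_isogeny i x :
  tau_eval q [:: c i; g2 i] (tau_eval q [:: u i; 1] x) = D i x.
Proof.
by rewrite /= !addr0 mul1r (exprD_card kap) -(tower_g1 tower) -(tower_T tower i) exprMn; ring.
Qed.

Lemma tau_eval_isogeny_dual i x :
  tau_eval q [:: u i; 1] (tau_eval q [:: c i; g2 i] x) = D i.+1 x.
Proof.
rewrite /= !addr0 mul1r (exprD_card kap) (tower_g1S tower) (tower_g2S tower).
by rewrite -(tower_T tower i) !exprMn; ring.
Qed.

Lemma isogeny_iter n i x :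
  isogeny u n (iter i (D 0%N) x) = iter i (D n) (isogeny u n x).
Proof.
have isogenyD y : isogeny u n (D 0%N y) = D n (isogeny u n y).
  elim: n y => // n IHn y; rewrite !isogenyS IHn.
  by rewrite -(tau_eval_dual_isogeny n) tau_eval_isogeny_dual.
by elim: i => // i IHi; rewrite !iterS isogenyD IHi.
Qed.

Lemma iter_dual_isogeny n x :
  iter n (D 0%N) x = dual_isogeny c g2 n (isogeny u n x).
Proof.
elim: n x => // n IHn x; rewrite iterSr IHn isogenyS dual_isogenyS tau_eval_dual_isogeny.
by rewrite -[D 0%N x]/(iter 1 _ x) isogeny_iter.
Qed.

Lemma isogeny_tower_g2 n : g2 n = g2 0%N ^+ (q ^ n).
Proof.
elim: n => [|n IHn]; first by rewrite expn0 expr1.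
by rewrite (tower_g2S tower) IHn -exprM expnSr.
Qed.

End TowerFactorization.

End Isogeny.

Section IsogenyMap.
Variables (Fq : finFieldType) (R S : comNzRingType) (f : {rmorphism R -> S}).

Lemma rmorph_isogeny u n x : f (isogeny Fq u n x) = isogeny Fq (f \o u) n (f x).
Proof.
by elim: n => //= n IHn; rewrite !addr0 !mul1r rmorphD rmorphM rmorphXn IHn.
Qed.

Lemma rmorph_dual_isogeny c g n x :
  f (dual_isogeny Fq c g n x) = dual_isogeny Fq (f \o c) (f \o g) n (f x).
Proof.
by elim: n x => //= n IHn x; rewrite IHn !addr0 rmorphD !rmorphM rmorphXn.
Qed.

Lemma rmorph_isogeny_tower T g1 g2 u c : isogeny_tower Fq T g1 g2 u c ->
  isogeny_tower Fq (f T) (f \o g1) (f \o g2) (f \o u) (f \o c).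
Proof.
case=> uT ug1 ug1S ug2S; split=> i /=.
- by rewrite -rmorphM uT.
- by rewrite -rmorphXn -rmorphM -rmorphD ug1.
- by rewrite ug1S rmorphD rmorphM rmorphXn.
- by rewrite ug2S rmorphXn.
Qed.

End IsogenyMap.

Lemma eq_isogeny (Fq : finFieldType) (R : comNzRingType) (u u' : nat -> R) n :
  u =1 u' -> isogeny Fq u n =1 isogeny Fq u' n.
Proof. by move=> eq_u x; elim: n => //= n ->; rewrite eq_u. Qed.

Section IsogenyPoly.
Variables (Fq : finFieldType) (R : idomainType).
Local Notation q := #|Fq|.
Implicit Type u : nat -> R.

Definition isogeny_poly u n : {poly R} := isogeny Fq (polyC \o u) n 'X.

Lemma isogeny_polyS u n :
  isogeny_poly u n.+1 = isogeny_poly u n ^+ q + u n *: isogeny_poly u n.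
Proof. by rewrite /isogeny_poly /= addr0 mul1r mul_polyC addrC. Qed.

Lemma horner_isogeny_poly u n x : (isogeny_poly u n).[x] = isogeny Fq u n x.
Proof.
rewrite -/(horner_eval x _) rmorph_isogeny /= /horner_eval hornerX.
by apply: eq_isogeny => i /=; rewrite hornerC.
Qed.

Lemma isogeny_poly_monic_size u n :
  isogeny_poly u n \is monic /\ size (isogeny_poly u n) = (q ^ n).+1.
Proof.
elim: n => [|n [mon size_n]]; first by rewrite /isogeny_poly monicX size_polyX.
have monq : isogeny_poly u n ^+ q \is monic by rewrite monic_exp.
have sizeq : size (isogeny_poly u n ^+ q) = (q ^ n.+1).+1.
  by rewrite -[LHS]prednK ?size_poly_gt0 ?monic_neq0 // size_exp size_n mulnC -expnS.
have lt_size : (size (u n *: isogeny_poly u n)%R < size (isogeny_poly u n ^+ q)%R)%N.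
  rewrite sizeq (leq_ltn_trans (size_scale_leq _ _)) // size_n ltnS.
  by rewrite ltn_exp2l // finNzRing_gt1.
by rewrite isogeny_polyS monicE lead_coefDl ?size_polyDl // -monicE.
Qed.

Lemma monic_isogeny_poly u n : isogeny_poly u n \is monic.
Proof. exact: (isogeny_poly_monic_size u n).1. Qed.

Lemma size_isogeny_poly u n : size (isogeny_poly u n) = (q ^ n).+1.
Proof. exact: (isogeny_poly_monic_size u n).2. Qed.

Lemma coef0_isogeny_poly (kap : {rmorphism Fq -> R}) u n : (isogeny_poly u n)`_0 = 0.
Proof.
by rewrite -horner_coef0 horner_isogeny_poly (fq_linear0 (fq_linear_isogeny kap u n)).
Qed.

End IsogenyPoly.

Lemma map_isogeny_poly (Fq : finFieldType) (R S : idomainType) (f : {rmorphism R -> S}) u n :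
  map_poly f (isogeny_poly Fq u n) = isogeny_poly Fq (f \o u) n.
Proof.
by rewrite rmorph_isogeny /= map_polyX; apply: eq_isogeny => i /=; rewrite map_polyC.
Qed.

Lemma isogeny_surjective (Fq : finFieldType) (L : fieldType) (kap : {rmorphism Fq -> L}) u :
  separably_closed L -> (forall i, u i != 0) ->
  forall n (y : L), exists x, isogeny Fq u n x = y.
Proof.
move=> closedL u0; elim=> [|n IHn] y; first by exists y.
have [z <-] := tau_eval_surjective kap (s := [:: u n; 1]) closedL (u0 n) y.
by have [x <-] := IHn z; exists x.
Qed.

Section TowerDescent.
Variables (Fq : finFieldType) (E C : fieldType) (kap : {rmorphism Fq -> E}).
Variable v : {rmorphism E -> C}.
Hypothesis closv : relatively_separably_closed v.
Local Notation q := #|Fq|.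

Lemma kernel_coef_descent (T g1 g2 : E) x : T != 0 ->
  v g2 * x ^+ q.+1 - v g1 * x + v T = 0 -> exists e, v e = x.
Proof.
move=> T0 vx; pose p := g2 *: 'X^(q.+1) - g1 *: 'X + T%:P.
apply: (closv (p := p)); last first.
  rewrite /root /p rmorphD rmorphB /= !map_polyZ map_polyXn map_polyX map_polyC.
  by rewrite !hornerE vx.
have dp : deriv p = g2 *: 'X^q - g1%:P.
  rewrite /p derivD derivB !derivZ derivX derivXn derivC addr0 /=.
  rewrite -mulr_natr -natr1 -polyC_natr (natr_card kap) polyC0 add0r mulr1.
  by rewrite alg_polyC.
rewrite separable_poly.unlock dp; apply/Bezout_coprimepP; exists (1, - 'X) => /=.
rewrite (_ : _ + _ = T%:P); first by rewrite -[T%:P]mulr1 mul_polyC eqp_scale.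
by rewrite /p exprS -!mul_polyC; ring.
Qed.

Lemma isogeny_tower_descent (T g1 g2 : E) G1 G2 U c :
  T != 0 -> isogeny_tower Fq (v T) G1 G2 U c -> G1 0%N = v g1 -> G2 0%N = v g2 ->
  exists g1' g2' u' c',
    [/\ isogeny_tower Fq T g1' g2' u' c', g1' 0%N = g1, g2' 0%N = g2 &
      [/\ v \o g2' =1 G2, v \o u' =1 U & v \o c' =1 c]].
Proof.
move=> T0 tower G10 G20.
have ex_c i a b e : v a = G1 i -> v b = G2 i -> v e = U i -> v (a - b * e ^+ q) = c i.
  move=> va vb ve; rewrite rmorphB rmorphM rmorphXn /= va vb ve.
  by rewrite -(tower_g1 tower) addrK.
have ex_u i a b : v a = G1 i -> v b = G2 i -> exists e, v e = U i.
  move=> va vb; apply: (kernel_coef_descent (T := T) (g1 := a) (g2 := b)) => //.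
  by rewrite va vb exprS -(tower_g1 tower) -(tower_T tower i); ring.
have /choice[g gP] : forall i, exists g : E * E, v g.1 = G1 i /\ v g.2 = G2 i.
  elim=> [|i [[a b] [/= va vb]]]; first by exists (g1, g2).
  have [e ve] := ex_u _ _ _ va vb; have vc := ex_c _ _ _ _ va vb ve.
  exists ((a - b * e ^+ q) ^+ q + e * b, b ^+ q) => /=.
  rewrite (tower_g1S tower) (tower_g2S tower) rmorphD rmorphM !rmorphXn.
  by rewrite /= vc ve vb.
have /choice[u uE] : forall i, exists e, v e = U i.
  by move=> i; have [va vb] := gP i; apply: ex_u va vb.
pose c' i := (g i).1 - (g i).2 * u i ^+ q.
have cE i : v (c' i) = c i by have [va vb] := gP i; apply: ex_c.
have g1E i : v (g i).1 = G1 i by case: (gP i).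
have g2E i : v (g i).2 = G2 i by case: (gP i).
exists (fst \o g), (snd \o g), u, c'; split=> //;
  try by apply: (fmorph_inj v); rewrite /= ?g1E ?g2E.
split=> i; apply: (fmorph_inj v) => /=.
- by rewrite rmorphM cE uE (tower_T tower).
- by rewrite rmorphD rmorphM rmorphXn /= cE g2E uE (tower_g1 tower) g1E.
- by rewrite g1E (tower_g1S tower) rmorphD rmorphM rmorphXn /= cE uE g2E.
- by rewrite g2E (tower_g2S tower) rmorphXn /= g2E.
Qed.

End TowerDescent.

Section OrdinaryTower.
Variables (Fq : finFieldType) (k : fieldType).
Local Notation q := #|Fq|.

Lemma ordinary_kernel (T g1 g2 : pseries k) : ps_const g1 != 0 -> ps_const T * ps_const g2 = 0 ->
  exists u c, [/\ ps_const c != 0, c * u = T & c + g2 * u ^+ q = g1].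
Proof.
move=> g10 Tg2; have q0 : (0 < q)%N := ltnW (finNzRing_gt1 Fq).
pose p := g2 *: 'X^(q.+1) - g1 *: 'X + T%:P.
have constp : map_poly ps_const p
    = ps_const g2 *: 'X^(q.+1) - ps_const g1 *: 'X + (ps_const T)%:P.
  by rewrite rmorphD rmorphB /= !map_polyZ map_polyXn map_polyX map_polyC.
pose a := ps_const T / ps_const g1.
have g2a : ps_const g2 * a ^+ q = 0.
  move/eqP: Tg2; rewrite mulf_eq0 /a => /orP[]/eqP->; last by rewrite mul0r.
  by rewrite mul0r expr0n eqn0Ngt q0 mulr0.
have [||u ua] := @ps_hensel _ p a.
- rewrite constp /root !hornerD hornerN !hornerZ hornerXn hornerX hornerC.
  by rewrite exprSr mulrA g2a mul0r sub0r /a mulrCA divff // mulr1 addNr.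
- rewrite constp derivD derivB !derivZ derivX derivXn derivC addr0 !hornerE /=.
  by rewrite hornerMn hornerXn -mulr_natr mulrA g2a mul0r sub0r unitfE oppr_eq0.
rewrite /root /p !hornerE exprS => /eqP u_root; exists u, (g1 - g2 * u ^+ q); split.
- by rewrite rmorphB rmorphM rmorphXn /= ua g2a subr0.
- by apply: subr0_eq; rewrite -[RHS]oppr0 -u_root; ring.
- by rewrite subrK.
Qed.

Lemma exists_isogeny_tower (T g1 g2 : pseries k) :
  ps_const g1 != 0 -> ps_const T * ps_const g2 = 0 ->
  exists G1 G2 u c, [/\ isogeny_tower Fq T G1 G2 u c, G1 0%N = g1, G2 0%N = g2 &
    forall i, ps_const (c i) != 0].
Proof.
move=> g10 Tg2.
pose ordinary (g : pseries k * pseries k) := ps_const g.1 != 0 /\ ps_const T * ps_const g.2 = 0.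
have /choice[f fP] : forall g, exists uc : pseries k * pseries k, ordinary g ->
    [/\ ps_const uc.2 != 0, uc.2 * uc.1 = T & uc.2 + g.2 * uc.1 ^+ q = g.1].
  move=> g; have [[g1n0 Tg2n]|] := pselect (ordinary g); last by exists (0, 0).
  by have [u [c uc]] := ordinary_kernel g1n0 Tg2n; exists (u, c).
pose next (g : pseries k * pseries k) := ((f g).2 ^+ q + (f g).1 * g.2, g.2 ^+ q).
have ordinary_next (g : pseries k * pseries k) : ordinary g -> ordinary (next g).
  move=> ord_g; have [c0 cu _] := fP g ord_g; have [_ Tg] := ord_g; split=> /=.
    have -> : ps_const ((f g).2 ^+ q + (f g).1 * g.2) = ps_const (f g).2 ^+ q.
      apply: (mulfI c0); rewrite rmorphD rmorphM rmorphXn mulrDr mulrA -[X in _ + X * _]rmorphM.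
      by rewrite cu Tg addr0.
    by rewrite expf_neq0.
  by rewrite rmorphXn -(prednK (ltnW (finNzRing_gt1 Fq))) exprS mulrA Tg mul0r.
pose G i := iter i next (g1, g2).
have ordG i : ordinary (G i) by elim: i => [|i IHi] //=; apply: ordinary_next.
exists (fun i => (G i).1), (fun i => (G i).2), (fun i => (f (G i)).1), (fun i => (f (G i)).2).
split=> //; last by move=> i; case: (fP _ (ordG i)).
by split=> i //=; case: (fP _ (ordG i)).
Qed.

End OrdinaryTower.

(** * The Tate module *)

Lemma ker_tau_eval_span (Fq : finFieldType) (L : idomainType) (kap : {rmorphism Fq -> L})
    (s : seq L) n (w : 'rV[L]_n) v :
  s`_0 != 0 -> (size s <= n.+1)%N ->
  (forall b : 'cV[Fq]_n, w *m map_mx kap b = 0 -> b = 0) ->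
  (forall i, tau_eval #|Fq| s (w 0 i) = 0) -> tau_eval #|Fq| s v = 0 ->
  exists b : 'cV[Fq]_n, v%:M = w *m map_mx kap b.
Proof.
move=> s0 size_s free_w sw sv; have root_s x : root (tau_poly Fq s) x = (tau_eval #|Fq| s x == 0).
  by rewrite /root horner_tau_poly.
apply: (fq_span_roots (p := tau_poly Fq s)) => // [||b|]; last by rewrite root_s sv.
- apply: contraNneq s0 => p0; have := deriv_tau_poly kap s.
  by rewrite p0 derivC => /esym/eqP; rewrite polyC_eq0.
- apply: leq_trans (size_tau_poly Fq s) _; rewrite ltnS leq_pexp2l ?(ltnW (finNzRing_gt1 Fq)) //.
  by case: (size s) size_s.
rewrite root_s mxE; under eq_bigr do rewrite mxE mulrC.
rewrite (fq_linear_sum (fq_linear_tau_eval kap s) (fun i => b i 0) (w 0)).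
by rewrite big1 // => i _; rewrite sw mulr0.
Qed.

(* A compatible system [(x_n)] is encoded as the series [\sum_n x_n X^n]; the
   action of [F_q[[T]]] becomes multiplication of power series. *)
Definition tate_series (R : nmodType) (D : R -> R) (x : pseries R) : Prop :=
  pscoef x 0 = 0 /\ forall n, D (pscoef x n.+1) = pscoef x n.

Lemma tate_series_map (R S : comNzRingType) (f : {rmorphism R -> S}) q (s : seq R) x :
  tate_series (tau_eval q s) x -> tate_series (tau_eval q (map f s)) (ps_map f x).
Proof.
by move=> [x0 xS]; split=> [|n] /=; rewrite ?x0 ?rmorph0 // -[in RHS]xS rmorph_tau_eval.
Qed.

Section TateSeries.
Variables (Fq : finFieldType) (R : comNzRingType) (kap : {rmorphism Fq -> R}).
Variables (D : R -> R) (linD : fq_linear kap D).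
Local Notation K := (ps_map kap).
Local Notation tate := (tate_series D).
Implicit Types (x y : pseries R) (a : pseries Fq).

Lemma tate_seriesD x y : tate x -> tate y -> tate (x + y).
Proof.
move=> [x0 xS] [y0 yS]; split=> [|n]; rewrite !pscoefD; first by rewrite x0 y0 addr0.
by rewrite (fq_linearD linD) xS yS.
Qed.

Lemma tate_seriesB x y : tate x -> tate y -> tate (x - y).
Proof.
move=> [x0 xS] [y0 yS]; split=> [|n]; rewrite !pscoefB; first by rewrite x0 y0 subr0.
by rewrite (fq_linearB linD) xS yS.
Qed.

Lemma tate_seriesZ a x : tate x -> tate (K a * x).
Proof.
move=> [x0 xS]; split=> [|n]; first by rewrite pscoefM big_ord_recl big_ord0 x0 mulr0 addr0.
rewrite !pscoefM (fq_linear_sum linD (pscoef a \o val) (fun i => pscoef x (n.+1 - i))).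
rewrite big_ord_recr /= subnn x0 (fq_linear0 linD) mulr0 addr0; apply: eq_bigr => i _ /=.
by rewrite subSn ?xS // -ltnS.
Qed.

Lemma tate_series_sum n (F : 'I_n -> pseries R) :
  (forall i, tate (F i)) -> tate (\sum_i F i).
Proof.
move=> tateF; elim/big_ind: _ => //; last exact: tate_seriesD.
by split=> // n'; apply: fq_linear0 linD.
Qed.

Lemma tate_series_iter x n i : tate x -> iter i D (pscoef x n) = pscoef x (n - i).
Proof.
move=> [x0 xS]; elim: i => [|i IHi]; first by rewrite subn0.
rewrite iterS IHi; have [le_ni|lt_in] := leqP n i; last by rewrite -(subnSK lt_in) xS.
by rewrite (eqP (leqW le_ni : n - i.+1 == 0)%N) (eqP (le_ni : n - i == 0)%N) x0 (fq_linear0 linD).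
Qed.

Lemma tate_series_trunc x y n : tate x -> tate y ->
  pscoef x n = pscoef y n -> ps_trunc n.+1 x = ps_trunc n.+1 y.
Proof.
move=> tx ty xy; apply/ps_truncP => i; rewrite ltnS => le_in.
by rewrite -(subKn le_in) -!tate_series_iter // xy.
Qed.

Lemma tate_series_extend v n : (forall z, exists z', D z' = z) ->
  iter n D v = 0 -> exists2 x, tate x & pscoef x n = v.
Proof.
move=> surjD Dv; have [lift liftP] := choice surjD.
exists (PSeries (fun m => if (m <= n)%N then iter (n - m) D v else iter (m - n) lift v)).
  split=> [|m] /=; first by rewrite subn0.
  case: (ltngtP m n) => [lt_mn|lt_nm|->]; first by rewrite -iterS subnSK.
    by rewrite subSn ?(ltnW lt_nm) //= liftP.
  by rewrite subSn // subnn /= liftP.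
by rewrite /= leqnn subnn.
Qed.

Section Combinations.
Variables (m : nat) (f : 'rV[pseries R]_m).

Definition ps_comb (v : 'cV[pseries Fq]_m) : pseries R := (f *m map_mx K v) 0 0.

Lemma ps_combE v : ps_comb v = \sum_j K (v j 0) * f 0 j.
Proof. by rewrite /ps_comb mxE; apply: eq_bigr => j _; rewrite mxE mulrC. Qed.

Lemma ps_combB v w : ps_comb (v - w) = ps_comb v - ps_comb w.
Proof. by rewrite /ps_comb map_mxB mulmxBr !mxE. Qed.

Lemma ps_combD v w : ps_comb (v + w) = ps_comb v + ps_comb w.
Proof. by rewrite /ps_comb map_mxD mulmxDr mxE. Qed.

Hypothesis tate_f : forall j, tate (f 0 j).

Lemma tate_series_comb v : tate (ps_comb v).
Proof. by rewrite ps_combE; apply: tate_series_sum => j; apply: tate_seriesZ. Qed.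

Lemma ps_trunc_comb n (v w : 'cV_m) :
  map_mx (ps_trunc n) v = map_mx (ps_trunc n) w ->
  ps_trunc n.+1 (ps_comb v) = ps_trunc n.+1 (ps_comb w).
Proof.
move=> /matrixP vw; rewrite !ps_combE !raddf_sum; apply: eq_bigr => j _ /=.
have [fj0 _] := tate_f j; rewrite (ps_const_eq0 fj0) !mulrA ![_ * psX]mulrC -!mulrA.
apply: ps_trunc_XM; rewrite !ps_truncM; have := vw j 0; rewrite !mxE => vwj.
by rewrite (ps_map_trunc kap vwj).
Qed.

Lemma pscoef_comb_low n (v : 'cV_m) : map_mx (ps_trunc n) v = 0 ->
  pscoef (ps_comb v) n.+1
  = (map_mx (fun x => pscoef x 1) f *m map_mx (kap \o (fun a => pscoef a n)) v) 0 0.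
Proof.
move=> /matrixP v0; rewrite ps_combE mxE.
have -> : pscoef (\sum_j K (v j 0) * f 0 j) n.+1 = \sum_j pscoef (K (v j 0) * f 0 j) n.+1.
  by apply: (big_morph (fun x => pscoef x n.+1)).
apply: eq_bigr => j _; rewrite !mxE pscoefM 2!big_ord_recr /= subnn.
have [-> _] := tate_f j; rewrite mulr0 addr0 subSnn mulrC big1 ?addr0 ?add0r // => i _.
have := v0 j 0; rewrite !mxE => /ps_trunc_eq0P -> //.
by rewrite rmorph0 mul0r.
Qed.

End Combinations.

Local Notation level1 := (map_mx (fun x : pseries R => pscoef x 1)).

Record tate_free m (f : 'rV[pseries R]_m) : Prop := TateFree {
  tate_free_series : forall j, tate (f 0 j);
  tate_free_indep : forall b : 'cV[Fq]_m, level1 f *m map_mx kap b = 0 -> b = 0 }.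

Record tate_frame m (f : 'rV[pseries R]_m) : Prop := TateFrame {
  tate_frame_free :> tate_free f;
  tate_frame_span : forall z, D z = 0 ->
    exists b : 'cV[Fq]_m, z%:M = level1 f *m map_mx kap b }.

Section Free.
Variables (m : nat) (f : 'rV[pseries R]_m).
Hypothesis free_f : tate_free f.
Let tate_f := tate_free_series free_f.

Lemma ps_comb_trunc_eq0 n v :
  ps_trunc n.+1 (ps_comb f v) = 0 -> map_mx (ps_trunc n) v = 0.
Proof.
elim: n => [|n IHn] v0.
  by apply/matrixP => i j; rewrite !mxE; apply/ps_trunc_eq0P.
have {IHn} vn : map_mx (ps_trunc n) v = 0.
  apply: IHn; rewrite -(raddf0 (ps_trunc n.+1)); apply: ps_trunc_leq (leqnSn n.+1) _.
  by rewrite v0 raddf0.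
have coef_v : map_mx (fun a => pscoef a n) v = 0.
  apply: (tate_free_indep free_f).
  rewrite -map_mx_comp [LHS]mx11_scalar -(pscoef_comb_low tate_f) //.
  by move/ps_trunc_eq0P: v0 => ->; rewrite ?raddf0.
apply/matrixP => i j; move/matrixP: vn => /(_ i j); move/matrixP: coef_v => /(_ i j).
rewrite !mxE => cn /ps_trunc_eq0P vt.
by apply/ps_trunc_eq0P => l; rewrite ltnS leq_eqVlt => /predU1P[->|/vt].
Qed.

Lemma ps_comb_trunc n v w :
  ps_trunc n.+1 (ps_comb f v) = ps_trunc n.+1 (ps_comb f w) ->
  map_mx (ps_trunc n) v = map_mx (ps_trunc n) w.
Proof.
move=> vw; apply/subr0_eq; rewrite -map_mxB; apply: ps_comb_trunc_eq0.
by rewrite ps_combB raddfB /= vw subrr.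
Qed.

Lemma ps_comb_inj : injective (ps_comb f).
Proof.
move=> v w vw; apply/matrixP => i j; apply: ps_trunc_eq => n.
have /matrixP/(_ i j) : map_mx (ps_trunc n) v = map_mx (ps_trunc n) w.
  by apply: ps_comb_trunc; rewrite vw.
by rewrite !mxE.
Qed.

End Free.

Section Frame.
Variables (m : nat) (f : 'rV[pseries R]_m).
Hypothesis frame_f : tate_frame f.
Let tate_f := tate_free_series frame_f.

Lemma tate_series_approx x n : tate x ->
  exists v, ps_trunc n.+1 x = ps_trunc n.+1 (ps_comb f v).
Proof.
move=> tx; elim: n => [|n [v xv]].
  exists 0; apply/ps_truncP => -[|//] _; have [-> _] := tx.
  by have [-> _] := tate_series_comb tate_f 0.
have [y0 yS] := tate_seriesB tx (tate_series_comb tate_f v).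
have [|b bE] := tate_frame_span frame_f (z := pscoef (x - ps_comb f v) n.+1).
  by rewrite yS pscoefB; move/ps_truncP: xv => -> //; rewrite subrr.
pose w : 'cV[pseries Fq]_m := map_mx (fun c => psX ^+ n * psC c) b.
have wn : map_mx (ps_trunc n) w = 0.
  apply/matrixP => i j; rewrite !mxE; apply/ps_trunc_eq0P => l lt_ln.
  by rewrite pscoefXnM lt_ln.
exists (v + w); apply: tate_series_trunc => //; first exact: tate_series_comb.
rewrite ps_combD pscoefD (pscoef_comb_low tate_f wn) -map_mx_comp.
have -> : map_mx (kap \o (fun a => pscoef a n) \o (fun c => psX ^+ n * psC c)) b = map_mx kap b.
  apply/matrixP => i j; rewrite !mxE.
  by rewrite -[LHS]/(kap (pscoef (psX ^+ n * psC (b i j)) n)) pscoefXnM ltnn subnn.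
by rewrite -bE mxE eqxx mulr1n pscoefB addrC subrK.
Qed.

Lemma tate_series_basis x : tate x -> exists v, x = ps_comb f v.
Proof.
move=> tx; have [v vP] := choice (fun n => tate_series_approx n tx).
pose lim : 'cV[pseries Fq]_m := \col_i PSeries (fun n => pscoef (v n.+1 i 0) n).
have v_stable n l : map_mx (ps_trunc n) (v n) = map_mx (ps_trunc n) (v (n + l)%N).
  apply: (ps_comb_trunc frame_f); rewrite -vP; apply: ps_trunc_leq (vP (n + l)%N).
  by rewrite ltnS leq_addr.
have lim_v n : map_mx (ps_trunc n) lim = map_mx (ps_trunc n) (v n).
  apply/matrixP => i j; rewrite !mxE ord1; apply/ps_truncP => l lt_ln /=.
  have /matrixP/(_ i 0) := v_stable l.+1 (n - l.+1)%N; rewrite !mxE subnKC //.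
  by move/ps_truncP; apply.
exists lim; apply: ps_trunc_eq => n; apply: (ps_trunc_leq (leqnSn n)).
by rewrite vP; apply/esym/ps_trunc_comb.
Qed.

End Frame.
End TateSeries.

Lemma pscoef_scale_eq0 (Fq : finFieldType) (R : idomainType) (kap : {rmorphism Fq -> R})
    (D : R -> R) n (a : pseries Fq) x :
  fq_linear kap D -> tate_series D x -> pscoef x 1 != 0 ->
  pscoef (ps_map kap a * x) n.+1 = 0 -> ps_trunc n.+1 a = 0.
Proof.
move=> linD tx x1 ax0.
have free_x : tate_free kap D (x%:M : 'rV_1).
  split=> [j|b]; first by rewrite ord1 mxE eqxx.
  move=> /matrixP/(_ 0 0); rewrite mxE big_ord1 !mxE eqxx mulr1n => /eqP.
  rewrite mulf_eq0 (negPf x1) fmorph_eq0 => /eqP b0.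
  by apply/matrixP => i j; rewrite !ord1 b0 mxE.
have comb_x : ps_comb kap (x%:M : 'rV_1) a%:M = ps_map kap a * x.
  by rewrite ps_combE big_ord1 !mxE eqxx !mulr1n.
have tax := tate_seriesZ linD a tx.
have /(ps_comb_trunc_eq0 free_x)/matrixP/(_ 0 0) :
    ps_trunc n.+2 (ps_comb kap (x%:M : 'rV_1) a%:M) = 0.
  rewrite comb_x; apply/ps_trunc_eq0P => i; rewrite ltnS => le_in.
  rewrite -(subKn le_in) -(tate_series_iter linD _ _ tax) ax0.
  exact: (fq_linear0 (fq_linear_iter _ linD)).
by rewrite !mxE eqxx mulr1n.
Qed.

Lemma eq_ord2 (i j l : 'I_2) : i != j -> (l == j) = (l != i).
Proof. by case: i j l => [[|[|//]] ?] [[|[|//]] ?] [[|[|//]] ?]. Qed.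

Lemma sum_ord2 (V : nmodType) (F : 'I_2 -> V) (i j : 'I_2) :
  i != j -> \sum_l F l = F i + F j.
Proof.
by move=> neq_ij; rewrite (bigD1 i) //= (big_pred1 j) // => l; rewrite /= (eq_ord2 _ neq_ij).
Qed.

Lemma det_mx2 (R : comNzRingType) (M : 'M[R]_2) :
  \det M = M 0 0 * M 1 1 - M 0 1 * M 1 0.
Proof.
rewrite (expand_det_row _ 0) (sum_ord2 _ (i := 0) (j := 1)) // /cofactor !det_mx11 !mxE.
rewrite /= expr0 expr1 mul1r mulN1r mulrN.
by congr (_ * M _ _ - M _ _ * M _ _); apply: val_inj.
Qed.

Section GaloisMatrix.
Variables (Fq : finFieldType) (F L : fieldType) (iota : {rmorphism F -> L}).
Hypothesis sepF : separable_closure iota.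
Variables (kap : {rmorphism Fq -> L}) (D : L -> L) (linD : fq_linear kap D).
Local Notation galois := (in_galois_group iota).
Local Notation K := (ps_map kap).
Local Notation tate := (tate_series D).
Hypothesis galois_kap : forall s, galois s -> forall c, s (kap c) = kap c.
Hypothesis galois_D : forall s, galois s -> forall x, s (D x) = D (s x).

Lemma tate_series_galois s x : galois s -> tate x -> tate (ps_map s x).
Proof.
move=> gal_s [x0 xS]; split=> [|n] /=; first by rewrite x0 rmorph0.
by rewrite -galois_D // xS.
Qed.

Lemma ps_map_galois s (a : pseries Fq) : galois s -> ps_map s (K a) = K a.
Proof. by move=> gal_s; apply: pseriesP => n /=; apply: galois_kap. Qed.

Lemma map_mx_galois s m n (M : 'M[pseries Fq]_(m, n)) : galois s ->
  map_mx (ps_map s) (map_mx K M) = map_mx K M.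
Proof. by move=> gal_s; apply/matrixP => i j; rewrite !mxE ps_map_galois. Qed.

Definition galois_matrix m (f : 'rV[pseries L]_m) (M : 'M[pseries Fq]_m) : Prop :=
  exists2 s, galois s & map_mx (ps_map s) f = f *m map_mx K M.

Section Frame.
Variables (m : nat) (f : 'rV[pseries L]_m).
Hypothesis frame_f : tate_frame kap D f.
Let tate_f := tate_free_series frame_f.

Lemma mulmx_ps_comb (M : 'M[pseries Fq]_m) j : (f *m map_mx K M) 0 j = ps_comb kap f (col j M).
Proof. by rewrite /ps_comb !mxE; apply: eq_bigr => i _; rewrite !mxE. Qed.

Lemma ps_map_comb s M v : galois s -> map_mx (ps_map s) f = f *m map_mx K M ->
  ps_map s (ps_comb kap f v) = ps_comb kap f (M *m v).
Proof.
move=> gal_s sf.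
have -> : ps_map s (ps_comb kap f v) = map_mx (ps_map s) (f *m map_mx K v) 0 0.
  by rewrite mxE.
by rewrite map_mxM sf map_mx_galois // -mulmxA -map_mxM.
Qed.

Lemma galois_matrixM M N :
  galois_matrix f M -> galois_matrix f N -> galois_matrix f (M *m N).
Proof.
move=> [s gal_s sf] [t gal_t tf]; exists (s \o t); first exact: galois_comp.
rewrite (_ : map_mx _ f = map_mx (ps_map s) (map_mx (ps_map t) f)); last first.
  by apply/matrixP => i j; rewrite !mxE; apply: pseriesP.
by rewrite tf map_mxM sf map_mx_galois // map_mxM mulmxA.
Qed.

Lemma exists_galois_matrix s : galois s ->
  exists M, map_mx (ps_map s) f = f *m map_mx K M.
Proof.
move=> gal_s.
have /choice[v vP] : forall j, exists v, ps_map s (f 0 j) = ps_comb kap f v.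
  by move=> j; apply: (tate_series_basis linD frame_f); apply: tate_series_galois.
exists (\matrix_(i, j) v j i 0); apply/rowP => j; rewrite mulmx_ps_comb mxE vP.
by congr (ps_comb _ _ _); apply/colP => i; rewrite !mxE.
Qed.

Lemma galois_matrix_closed M :
  (forall n, exists2 N, galois_matrix f N & map_mx (@ps_trunc _ n) N = map_mx (@ps_trunc _ n) M) ->
  galois_matrix f M.
Proof.
move=> approx; pose g := f *m map_mx K M.
have [|s gal_s sfg] := galois_limit sepF
  (a := fun n j => pscoef (f 0 j) n) (b := fun n j => pscoef (g 0 j) n).
  move=> n; have [N [s gal_s sf] NM] := approx n; exists s => // l j lt_ln.
  have -> : s (pscoef (f 0 j) l) = pscoef (map_mx (ps_map s) f 0 j) l by rewrite mxE.
  rewrite sf /g !mulmx_ps_comb.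
  suff /ps_truncP : ps_trunc n.+1 (ps_comb kap f (col j N))
      = ps_trunc n.+1 (ps_comb kap f (col j M)).
    by apply; rewrite ltnS ltnW.
  by apply: (ps_trunc_comb kap tate_f); rewrite !map_col NM.
exists s => //; apply/rowP => j; rewrite mxE; apply: pseriesP => n; exact: sfg.
Qed.

End Frame.

Lemma mulrI_trunc n (a b c : pseries Fq) : ps_const a != 0 ->
  ps_trunc n (a * b) = ps_trunc n (a * c) -> ps_trunc n b = ps_trunc n c.
Proof.
move=> a0 abc; have au : a \is a GRing.unit by rewrite ps_unitE unitfE.
by rewrite -[b](mulKr au) -[c](mulKr au) ps_truncM abc -ps_truncM.
Qed.

Definition has_transvections (f1 : pseries L) : Prop :=
  forall n, exists2 x, tate x & forall b : pseries Fq, exists2 s, galois s &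
    ps_map s f1 = f1 /\ ps_trunc n.+2 (ps_map s x) = ps_trunc n.+2 (x + K b * f1).

Lemma has_transvections_galois h f1 :
  galois h -> has_transvections f1 -> has_transvections (ps_map h f1).
Proof.
move=> gal_h transv n; have [x tx xP] := transv n.
have [h' gal_h' [hK h'K]] := galois_inverse gal_h.
have h'KK y : ps_map h' (ps_map h y) = y by apply: pseriesP => l /=; rewrite hK.
exists (ps_map h x); first exact: tate_series_galois.
move=> b; have [s gal_s [sf1 sx]] := xP b.
exists (h \o (s \o h')); first by do 2![apply: galois_comp => //].
have conjE y : ps_map (h \o (s \o h')) (ps_map h y) = ps_map h (ps_map s y).
  by rewrite -[in RHS](h'KK y); apply: pseriesP.
rewrite !conjE sf1; split=> //.
by rewrite (ps_map_trunc h sx) rmorphD rmorphM /= ps_map_galois.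
Qed.

(* Such an element is trivial modulo the line of [x], so its determinant is [a]. *)
Definition has_reflection n (a : pseries Fq) (x : pseries L) : Prop :=
  exists2 s, galois s & ps_trunc n.+2 (ps_map s x) = ps_trunc n.+2 (K a * x) /\
    forall y, tate y -> exists b : pseries Fq,
      ps_trunc n.+2 (ps_map s y) = ps_trunc n.+2 (y + K b * x).

Section Plane.
Variable f : 'rV[pseries L]_2.
Hypothesis frame_f : tate_frame kap D f.
Let tate_f := tate_free_series frame_f.

Lemma ps_comb_delta j : ps_comb kap f (delta_mx j 0) = f 0 j.
Proof.
rewrite ps_combE (bigD1 j) //= mxE !eqxx rmorph1 mul1r big1 ?addr0 // => i neq_ij.
by rewrite mxE (negPf neq_ij) rmorph0 mul0r.
Qed.

Lemma ps_comb_scale (a : pseries Fq) v :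
  ps_comb kap f (a *: v) = K a * ps_comb kap f v.
Proof. by rewrite /ps_comb map_mxZ -scalemxAr mxE. Qed.

Lemma galois_translation_matrix i j s M n (b : pseries Fq) w : i != j ->
  galois s -> map_mx (ps_map s) f = f *m map_mx K M -> ps_map s (f 0 i) = f 0 i ->
  ps_trunc n.+2 (ps_map s (ps_comb kap f w)) = ps_trunc n.+2 (ps_comb kap f w + K b * f 0 i) ->
  [/\ col i M = delta_mx i 0, ps_trunc n.+1 (w j 0 * M i j) = ps_trunc n.+1 b
    & ps_trunc n.+1 (w j 0 * M j j) = ps_trunc n.+1 (w j 0)].
Proof.
move=> neq_ij gal_s sf sfi sw.
have colM : col i M = delta_mx i 0.
  by apply: (ps_comb_inj frame_f); rewrite -mulmx_ps_comb -sf mxE sfi ps_comb_delta.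
have [Mii Mji] : M i i = 1 /\ M j i = 0.
  move/colP: colM => colM; have := colM i; have := colM j; rewrite !mxE !eqxx /= eq_sym.
  by rewrite (negPf neq_ij).
have mulMw r : (M *m w) r 0 = M r i * w i 0 + M r j * w j 0.
  by rewrite mxE (sum_ord2 _ neq_ij).
have Mw r : ps_trunc n.+1 ((M *m w) r 0) = ps_trunc n.+1 (w r 0 + b * (r == i)%:R).
  have : ps_trunc n.+2 (ps_comb kap f (M *m w))
      = ps_trunc n.+2 (ps_comb kap f (w + b *: delta_mx i 0)).
    by rewrite ps_combD ps_comb_scale ps_comb_delta -(ps_map_comb _ gal_s sf).
  move=> /(ps_comb_trunc frame_f)/matrixP/(_ r 0).
  by rewrite [X in X = _ -> _]mxE => ->; rewrite !mxE andbT.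
split=> //.
  have := Mw i; rewrite mulMw Mii eqxx mulr1 mul1r !raddfD mulrC /=.
  by move/addrI.
have := Mw j; rewrite mulMw Mji eq_sym (negPf neq_ij) mulr0 mul0r add0r.
by rewrite addr0 mulrC.
Qed.

Lemma transvection_galois_matrix i j (t : pseries Fq) :
  i != j -> has_transvections (f 0 i) -> galois_matrix f (1%:M + t *: delta_mx i j).
Proof.
move=> neq_ij transv; apply: galois_matrix_closed => // n.
have [x tx xP] := transv n; have [w xE] := tate_series_basis linD frame_f tx.
have transl (b : pseries Fq) : exists M, galois_matrix f M /\
    [/\ col i M = delta_mx i 0, ps_trunc n.+1 (w j 0 * M i j) = ps_trunc n.+1 b
      & ps_trunc n.+1 (w j 0 * M j j) = ps_trunc n.+1 (w j 0)].
  have [s gal_s [sfi sx]] := xP b; have [M sf] := exists_galois_matrix frame_f gal_s.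
  exists M; split; first by exists s.
  by apply: galois_translation_matrix neq_ij gal_s sf sfi _; rewrite -xE.
have wj0 : ps_const (w j 0) != 0.
  have [M [_ [_ /ps_truncP/(_ 0%N isT) + _]]] := transl 1.
  rewrite -[pscoef _ 0]/(ps_const (w j 0 * M i j)) rmorphM /= => w_neq0.
  by apply: contra_eq_neq w_neq0 => ->; rewrite mul0r eq_sym oner_neq0.
have [M [galM [colM Mij Mjj]]] := transl (w j 0 * t); exists M => //.
apply/matrixP => r l; rewrite !mxE; have [->|neq_li] := eqVneq l i.
  have -> : M r i = (r == i)%:R by move/colP: colM => /(_ r); rewrite !mxE andbT.
  by rewrite (negPf neq_ij) andbF mulr0 addr0.
move: neq_li; rewrite -(eq_ord2 _ neq_ij) => /eqP->.
apply: (ps_trunc_leq (leqnSn n)); apply: (mulrI_trunc wj0).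
have [->|neq_ri] := eqVneq r i.
  by rewrite (negPf neq_ij) eqxx add0r mulr1 Mij.
move: neq_ri; rewrite -(eq_ord2 _ neq_ij) => /eqP->.
by rewrite eqxx Mjj !mulr0 addr0 mulr1.
Qed.

Lemma exists_unit_coordinate w : pscoef (ps_comb kap f w) 1 != 0 ->
  exists i, ps_const (w i 0) != 0.
Proof.
move=> w1; apply: contrapT => none; case/eqP: w1.
have /ps_truncP/(_ 1%N isT) -> : ps_trunc 2 (ps_comb kap f w) = ps_trunc 2 (ps_comb kap f 0).
  apply: (ps_trunc_comb kap tate_f).
  apply/matrixP => i j; rewrite !mxE ord1; apply/ps_truncP => -[|//] _.
  by apply/eqP/negPn/negP => wi0; apply: none; exists i.
by rewrite /ps_comb map_mx0 mulmx0 mxE.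
Qed.

Lemma reflection_galois_matrix n (a : pseries Fq) x :
  tate x -> pscoef x 1 != 0 -> has_reflection n a x ->
  exists2 M, galois_matrix f M & ps_trunc n.+1 (\det M) = ps_trunc n.+1 a.
Proof.
move=> tx x1 [s gal_s [sx sP]]; have [w xE] := tate_series_basis linD frame_f tx.
have [M sf] := exists_galois_matrix frame_f gal_s.
exists M; first by exists s.
have /choice[be beP] : forall j, exists b : pseries Fq, forall i,
    ps_trunc n.+1 (M i j) = ps_trunc n.+1 ((i == j)%:R + b * w i 0).
  move=> j; have [b sfj] := sP _ (tate_f j); exists b => i.
  have : ps_trunc n.+2 (ps_comb kap f (col j M))
      = ps_trunc n.+2 (ps_comb kap f (delta_mx j 0 + b *: w)).
    by rewrite ps_combD ps_comb_scale ps_comb_delta -xE -sfj -mulmx_ps_comb -sf mxE.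
  move=> /(ps_comb_trunc frame_f)/matrixP/(_ i 0).
  by rewrite !mxE andbT.
have wM i : ps_trunc n.+1 (M i 0 * w 0 0 + M i 1 * w 1 0) = ps_trunc n.+1 (a * w i 0).
  have : ps_trunc n.+2 (ps_comb kap f (M *m w)) = ps_trunc n.+2 (ps_comb kap f (a *: w)).
    by rewrite ps_comb_scale -(ps_map_comb _ gal_s sf) -xE.
  move=> /(ps_comb_trunc frame_f)/matrixP/(_ i 0).
  by rewrite [X in X = _ -> _]mxE [(M *m w) i 0]mxE (sum_ord2 _ (i := 0) (j := 1)) // !mxE.
pose de := 1 + be 0 * w 0 0 + be 1 * w 1 0.
have w_de i : ps_trunc n.+1 (w i 0 * de) = ps_trunc n.+1 (w i 0 * a).
  rewrite [w i 0 * a]mulrC -wM raddfD /= !ps_truncM !beP -!ps_truncM -raddfD.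
  congr (ps_trunc _ _).
  have -> : w i 0 = (i == 0)%:R * w 0 0 + (i == 1)%:R * w 1 0.
    by case: i => [[|[|//]] ?]; rewrite /= !(mul1r, mul0r, addr0, add0r);
      congr (w _ _); apply: val_inj.
  by rewrite /de; ring.
have [i wi0] : exists i, ps_const (w i 0) != 0 by apply: exists_unit_coordinate; rewrite -xE.
apply: (mulrI_trunc wi0); rewrite -w_de !ps_truncM; congr (take_poly _ (_ * _)).
rewrite det_mx2 raddfB /= !ps_truncM !beP -!ps_truncM -raddfB.
by congr (ps_trunc _ _); rewrite /de /=; ring.
Qed.

End Plane.
End GaloisMatrix.

Section EqScalars.
Variables (Fq : finFieldType) (F L : fieldType) (iota : {rmorphism F -> L}).
Variables (kap kap' : {rmorphism Fq -> L}) (D : L -> L).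
Hypothesis eq_kap : kap =1 kap'.

Lemma eq_has_transvections f1 :
  has_transvections iota kap D f1 -> has_transvections iota kap' D f1.
Proof.
move=> transv n; have [x tx xP] := transv n; exists x => // b.
by rewrite -(eq_ps_map eq_kap); apply: xP.
Qed.

Lemma eq_has_reflection n a x :
  has_reflection iota kap D n a x -> has_reflection iota kap' D n a x.
Proof.
move=> [s gal_s [sx sP]]; exists s => //; split=> [|y ty].
  by rewrite -(eq_ps_map eq_kap).
by have [b sy] := sP y ty; exists b; rewrite -(eq_ps_map eq_kap).
Qed.

End EqScalars.

(** * Generation of GL_2 over power series *)

Section TwoByTwo.
Variable R : comNzRingType.
Implicit Types (a b c d t : R) (M : 'M[R]_2).

Definition mx2 a b c d : 'M[R]_2 :=
  \matrix_(i, j) if i == 0 then if j == 0 then a else b else if j == 0 then c else d.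

Lemma mx2_eta M : mx2 (M 0 0) (M 0 1) (M 1 0) (M 1 1) = M.
Proof.
apply/matrixP => -[[|[|//]] ?] [[|[|//]] ?]; rewrite mxE /=;
  by congr (M _ _); apply: val_inj.
Qed.

Lemma mulmx2 a b c d a' b' c' d' :
  mx2 a b c d *m mx2 a' b' c' d'
  = mx2 (a * a' + b * c') (a * b' + b * d') (c * a' + d * c') (c * b' + d * d').
Proof.
apply/matrixP => i j; rewrite mxE (sum_ord2 _ (i := 0) (j := 1)) // !mxE /=.
by case: (i == 0); case: (j == 0).
Qed.

Lemma det_mx2E a b c d : \det (mx2 a b c d) = a * d - b * c.
Proof. by rewrite det_mx2 !mxE. Qed.

Lemma transvection_mx2 t :
  1%:M + t *: delta_mx 0 1 = mx2 1 t 0 1 /\ 1%:M + t *: delta_mx 1 0 = mx2 1 0 t 1.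
Proof.
by split; apply/matrixP => -[[|[|//]] ?] [[|[|//]] ?];
  rewrite !mxE /= ?(mulr1, mulr0, addr0, add0r).
Qed.

End TwoByTwo.

Section GL2Generation.
Variables (F : fieldType) (H : set 'M[pseries F]_2).
Hypothesis mulH : forall M N, H M -> H N -> H (M *m N).
Hypothesis transvectionH : forall i j t, i != j -> H (1%:M + t *: delta_mx i j).

Let upperH t : H (mx2 1 t 0 1).
Proof. by rewrite -(transvection_mx2 t).1; apply: transvectionH. Qed.

Let lowerH t : H (mx2 1 0 t 1).
Proof. by rewrite -(transvection_mx2 t).2; apply: transvectionH. Qed.

Lemma SL2_generated M : \det M = 1 -> H M.
Proof.
rewrite -(mx2_eta M); move: (M 0 0) (M 0 1) (M 1 0) (M 1 1) => {M} a b c d.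
rewrite det_mx2E.
have unit_c a' b' c' d' : ps_const c' != 0 -> a' * d' - b' * c' = 1 -> H (mx2 a' b' c' d').
  move=> c0 det1; have cV : c' * c'^-1 = 1 by rewrite mulrV // ps_unitE unitfE.
  pose x := (a' - 1) * c'^-1; pose y := (d' - 1) * c'^-1.
  have xc : x * c' = a' - 1 by rewrite -mulrA [_^-1 * _]mulrC cV mulr1.
  have cy : c' * y = d' - 1 by rewrite mulrCA cV mulr1.
  have b_xy : a' * y + x = b'.
    rewrite (_ : _ + x = (a' * d' - 1) * c'^-1); last by rewrite /x /y; ring.
    by rewrite -det1 opprB addrCA subrr addr0 -mulrA cV mulr1.
  have -> : mx2 a' b' c' d' = mx2 1 x 0 1 *m mx2 1 0 c' 1 *m mx2 1 y 0 1.
    rewrite !mulmx2 !(mul1r, mul0r, mulr1, mulr0, addr0, add0r) xc cy.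
    by rewrite [1 + _]addrC !subrK b_xy.
  exact: mulH (mulH (upperH x) (lowerH c')) (upperH y).
move=> det1; have [c0|/unit_c] := eqVneq (ps_const c) 0; last exact.
have a0 : ps_const a != 0.
  apply: contra_eq_neq det1 => a0; apply: contraTneq (oner_neq0 F) => det1.
  by rewrite -(rmorph1 ps_const) -det1 rmorphB !rmorphM /= a0 c0 mul0r mulr0 subrr negbK.
have -> : mx2 a b c d = mx2 1 0 (-1) 1 *m mx2 a b (c + a) (d + b).
  by rewrite mulmx2 !(mul1r, mul0r, addr0, mulN1r) ![- _ + _]addrC !addrK.
apply: mulH (lowerH (-1)) _; apply: unit_c; first by rewrite rmorphD /= c0 add0r.
by rewrite -det1; ring.
Qed.

Hypothesis closedH : forall M,
  (forall n, exists2 N, H N & map_mx (@ps_trunc _ n) N = map_mx (@ps_trunc _ n) M) -> H M.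
Hypothesis detH : forall n a, ps_const a != 0 ->
  exists2 M, H M & ps_trunc n.+1 (\det M) = ps_trunc n.+1 a.

Lemma GL2_generated M : M \in unitmx -> H M.
Proof.
rewrite unitmxE ps_unitE unitfE => detM0; apply: closedH => n.
have [N HN detNM] := detH n detM0.
have detN0 : ps_const (\det N) != 0.
  by move/ps_truncP: detNM => /(_ 0%N isT); rewrite /ps_const => ->.
have [detMu detNu] : \det M \is a GRing.unit /\ \det N \is a GRing.unit.
  by rewrite !ps_unitE !unitfE.
pose e := \det N / \det M; pose S : 'M[pseries F]_2 := mx2 1 0 0 e.
exists (S *m M).
  rewrite -(mulmxKV (_ : N \in unitmx) (S *m M)) ?unitmxE //; apply: mulH => //.
  apply: SL2_generated.
  by rewrite !det_mulmx det_inv det_mx2E; rewrite mul1r mul0r subr0 /e divrK // divrr.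
have e1 : ps_trunc n e = ps_trunc n 1.
  rewrite -(divrr detMu) !ps_truncM.
  by rewrite (ps_trunc_leq (leqnSn n) detNM).
apply/matrixP => i j; rewrite !mxE (sum_ord2 _ (i := 0) (j := 1)) // !mxE /=.
case: i => [[|[|//]] lt_i]; rewrite ?(mul1r, mul0r, addr0, add0r) /=.
  by congr (ps_trunc _ (M _ _)); apply: val_inj.
rewrite ps_truncM e1 -ps_truncM mul1r.
by congr (ps_trunc _ (M _ _)); apply: val_inj.
Qed.

End GL2Generation.

(** * Galois action on torsion through isogeny towers *)

Section IsogenyTate.
Variables (Fq : finFieldType) (R : comNzRingType) (kap : {rmorphism Fq -> R}).
Variables (T : R) (g1 g2 u c : nat -> R).
Hypothesis tower : isogeny_tower Fq T g1 g2 u c.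
Local Notation q := #|Fq|.
Local Notation D := (tau_eval q [:: T; g1 0%N; g2 0%N]).

Lemma isogeny_tate_iter n (x : pseries R) i : tate_series D x -> isogeny Fq u n (pscoef x n) = 0 ->
  isogeny Fq u n (pscoef x (n - i)) = 0.
Proof.
move=> tx xn0; rewrite -(tate_series_iter (fq_linear_tau_eval kap _) n i tx).
rewrite (isogeny_iter kap tower) xn0.
exact: (fq_linear0 (fq_linear_iter i (fq_linear_tau_eval kap _))).
Qed.

Lemma isogeny_pscoef_scale n m (a : pseries Fq) (x : pseries R) :
  isogeny Fq u n (pscoef (ps_map kap a * x) m)
  = \sum_(i < m.+1) kap (pscoef a i) * isogeny Fq u n (pscoef x (m - i)).
Proof.
by rewrite pscoefM (fq_linear_sum (fq_linear_isogeny kap u n) (pscoef a \o val)).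
Qed.

End IsogenyTate.

Section TowerGalois.
Variables (Fq : finFieldType) (F L E : fieldType).
Variables (iota : {rmorphism F -> L}) (eta : {rmorphism F -> E}) (v : {rmorphism E -> L}).
Hypotheses (sepF : separable_closure iota) (v_eta : forall a, v (eta a) = iota a).
Variables (kap : {rmorphism Fq -> E}) (T : E) (g1 g2 u c : nat -> E).
Hypotheses (tower : isogeny_tower Fq T g1 g2 u c) (T0 : T != 0).
Local Notation q := #|Fq|.
Local Notation kL := (v \o kap).
Local Notation D := (tau_eval q [:: T; g1 0%N; g2 0%N]).
Local Notation DL := (tau_eval q [:: v T; v (g1 0%N); v (g2 0%N)]).

Let linDL : fq_linear kL DL := fq_linear_tau_eval kL _.
Let towerL := rmorph_isogeny_tower v tower.

Let uL_neq0 i : (v \o u) i != 0.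
Proof.
by rewrite /= fmorph_eq0; apply: contraNneq T0 => ui0; rewrite -(tower_T tower i) ui0 mulr0.
Qed.

Let DL_surjective y : exists x, DL x = y.
Proof. by apply: (tau_eval_surjective kL sepF.2); rewrite fmorph_eq0. Qed.

Let tate_series_fixing (s : {rmorphism L -> L}) x : (forall e, s (v e) = v e) ->
  tate_series DL x -> tate_series DL (ps_map s x).
Proof.
by move=> sv /(tate_series_map s); rewrite /= !sv.
Qed.

(* The roots of [isogeny_poly u n.+1 - z] are conjugate, and they differ by
   the [F_q[T]]-multiples of the torsion point given by [e]. *)
Lemma has_transvections_of_tower (e : pseries E) :
  tate_series D e -> (forall n, isogeny Fq u n (pscoef e n) = 0) ->
  (forall n, exists2 z, dual_isogeny Fq c g2 n.+1 z = 0 &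
     irreducible_poly (isogeny_poly Fq u n.+1 - z%:P)) ->
  has_transvections iota kL DL (ps_map v e).
Proof.
move=> te isog_e lattice n; have [z dual_z irr] := lattice n.
have [x0 isog_x0] := isogeny_surjective kL sepF.2 uL_neq0 n.+1 (v z).
have [|x tx xn] := tate_series_extend (v := x0) (n := n.+1) DL_surjective.
  by rewrite (iter_dual_isogeny kL towerL) isog_x0 -rmorph_dual_isogeny dual_z rmorph0.
exists x => // b; pose y := pscoef (ps_map kap b * e) n.+1.
have isog_y : isogeny Fq u n.+1 y = 0.
  rewrite isogeny_pscoef_scale big1 // => i _.
  by rewrite (isogeny_tate_iter kap tower i te) ?mulr0.
have root_m t : root (map_poly v (isogeny_poly Fq u n.+1 - z%:P)) t
    = (isogeny Fq (v \o u) n.+1 t == v z).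
  rewrite rmorphB /= map_isogeny_poly map_polyC /root hornerD hornerN hornerC.
  by rewrite horner_isogeny_poly subr_eq0.
have [||s gal_s [sv sx0]] := galois_conjugate sepF v_eta irr (x := x0) (y := x0 + v y).
- by rewrite root_m isog_x0.
- rewrite root_m (fq_linearD (fq_linear_isogeny kL _ _)) isog_x0 -rmorph_isogeny isog_y.
  by rewrite rmorph0 addr0.
exists s => //; split; first by apply: pseriesP => l /=; rewrite sv.
apply: (tate_series_trunc linDL); first exact: tate_series_fixing.
  by apply: (tate_seriesD linDL tx); apply: (tate_seriesZ linDL); apply: tate_series_map te.
by rewrite pscoefD -ps_map_comp -rmorphM /= xn sx0.
Qed.

Section Reflection.
Hypothesis q_gt2 : (2 < q)%N.
Variable n : nat.
Hypothesis irr : irreducible_poly (isogeny_poly Fq u n ^+ q.-1 + (u n)%:P).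
Hypothesis dual_kernel : forall m x,
  dual_isogeny Fq (v \o c) (v \o g2) m x = 0 -> exists e, v e = x.

Section TorsionSeries.
Variable x : pseries L.
Hypotheses (tx : tate_series DL x).
Let z := isogeny Fq (v \o u) n (pscoef x n.+1).
Hypotheses (z0 : z != 0) (Ez : tau_eval q [:: v (u n); 1] z = 0).

Let z_kummer : z ^+ q.-1 = - v (u n).
Proof.
apply: (mulfI z0); rewrite -exprS prednK ?(ltnW (finNzRing_gt1 Fq)) // mulrN mulrC.
by apply/eqP; rewrite -addr_eq0 addrC; move/eqP: Ez; rewrite /= addr0 mul1r.
Qed.

Let isogeny_scale (a : pseries Fq) :
  isogeny Fq (v \o u) n (pscoef (ps_map kL a * x) n.+1) = kL (ps_const a) * z.
Proof.
rewrite isogeny_pscoef_scale big_ord_recl subn0 big1 ?addr0 // => i _.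
rewrite -(tate_series_iter linDL _ _ tx) (isogeny_iter kL towerL) iterSr.
rewrite -(tau_eval_dual_isogeny kL towerL n) -/z Ez (fq_linear0 (fq_linear_tau_eval kL _)).
by rewrite (fq_linear0 (fq_linear_iter i (fq_linear_tau_eval kL _))) mulr0.
Qed.

Let isogenyS_scale (a : pseries Fq) :
  isogeny Fq (v \o u) n.+1 (pscoef (ps_map kL a * x) n.+1) = 0.
Proof.
by rewrite isogenyS isogeny_scale (fq_linearZ (fq_linear_tau_eval kL _)) Ez mulr0.
Qed.

Let torsion_conjugate (a : pseries Fq) : ps_const a != 0 ->
  exists2 s, in_galois_group iota s &
    (forall e, s (v e) = v e) /\ s (pscoef x n.+1) = pscoef (ps_map kL a * x) n.+1.
Proof.
move=> a0; have root_m t : root (map_poly v (isogeny_poly Fq u n ^+ q.-1 + (u n)%:P)) t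
    = (isogeny Fq (v \o u) n t ^+ q.-1 == - v (u n)).
  rewrite rmorphD rmorphXn /= map_isogeny_poly map_polyC /root hornerD horner_exp hornerC.
  by rewrite horner_isogeny_poly addr_eq0.
apply: (galois_conjugate sepF v_eta irr); rewrite root_m.
  by rewrite -/z z_kummer.
have a_unity : ps_const a ^+ q.-1 = 1.
  apply: (mulfI a0); rewrite -exprS prednK ?(ltnW (finNzRing_gt1 Fq)) // expf_card.
  by rewrite mulr1.
by rewrite isogeny_scale exprMn -rmorphXn a_unity rmorph1 mul1r z_kummer.
Qed.

(* Otherwise [z] would be rational over [E], hence fixed by the element that
   multiplies it by a scalar different from [1]. *)
Let torsion_level1_neq0 : pscoef x 1 != 0.
Proof.
apply/eqP => x1; have [|e ve] := @dual_kernel n z.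
  rewrite /z -(iter_dual_isogeny kL towerL) (tate_series_iter linDL _ _ tx) subSnn.
  exact: x1.
have [a0] : exists a : Fq, a \notin [:: 0; 1] by apply: exists_notin_seq.
rewrite !inE negb_or => /andP[a00 a01].
have [|s _ [sv sx]] := @torsion_conjugate (psC a0); first by rewrite ps_constC.
have : kL a0 * z = kL 1 * z.
  rewrite rmorph1 mul1r -[in RHS]ve -sv ve {2}/z rmorph_isogeny sx.
  rewrite (@eq_isogeny _ _ _ (v \o u)) ?isogeny_scale ?ps_constC // => i /=.
  exact: sv.
by move/(mulIf z0)/fmorph_inj/eqP; rewrite (negPf a01).
Qed.

Let isogeny_kernel_span y : isogeny Fq (v \o u) n.+1 y = 0 ->
  exists b : pseries Fq, y = pscoef (ps_map kL b * x) n.+1.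
Proof.
move=> isog_y; pose w : 'rV[L]_n.+1 := \row_i pscoef x (n.+1 - i).
pose ser (b : 'cV[Fq]_n.+1) : pseries Fq :=
  PSeries (fun i => if insub i is Some j then b j 0 else 0).
have w_ser b : (w *m map_mx kL b) 0 0 = pscoef (ps_map kL (ser b) * x) n.+1.
  rewrite mxE pscoefM [in RHS]big_ord_recr /= subnn (proj1 tx) mulr0 addr0.
  by apply: eq_bigr => i _; rewrite !mxE mulrC /= valK.
have [|||||b yb] := @fq_span_roots _ _ kL _ w (isogeny_poly Fq (v \o u) n.+1) y.
- exact: monic_neq0 (monic_isogeny_poly _ _ _).
- by rewrite size_isogeny_poly.
- move=> b /matrixP/(_ 0 0); rewrite w_ser mxE.
  move/(pscoef_scale_eq0 linDL tx torsion_level1_neq0)/ps_trunc_eq0P => b0.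
  by apply/colP => i; have := b0 i (ltn_ord i); rewrite /= valK mxE.
- by move=> b; rewrite w_ser /root horner_isogeny_poly isogenyS_scale.
- by rewrite /root horner_isogeny_poly isog_y.
by exists (ser b); rewrite -w_ser -yb mxE eqxx.
Qed.

Lemma has_reflection_torsion (a : pseries Fq) : ps_const a != 0 ->
  pscoef x 1 != 0 /\ has_reflection iota kL DL n a x.
Proof.
move=> a0; split=> //; have [s gal_s [sv sx]] := torsion_conjugate a0; exists s => //; split.
  apply: (tate_series_trunc linDL); rewrite ?sx //; first exact: tate_series_fixing.
  exact: (tate_seriesZ linDL).
move=> y ty; have [|e ve] := @dual_kernel n.+1 (isogeny Fq (v \o u) n.+1 (pscoef y n.+1)).
  by rewrite -(iter_dual_isogeny kL towerL) (tate_series_iter linDL _ _ ty) subnn; case: ty.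
have [|b bE] := @isogeny_kernel_span (s (pscoef y n.+1) - pscoef y n.+1).
  rewrite (fq_linearB (fq_linear_isogeny kL _ _)) -ve.
  rewrite -(@eq_isogeny _ _ (s \o (v \o u))) => [|i /=]; last exact: sv.
  by rewrite -rmorph_isogeny -ve sv subrr.
exists b; apply: (tate_series_trunc linDL); first exact: tate_series_fixing.
  by apply: (tate_seriesD linDL) => //; apply: (tate_seriesZ linDL).
by rewrite pscoefD -bE addrC subrK.
Qed.

End TorsionSeries.

Lemma has_reflections_of_tower : exists2 x, tate_series DL x &
  pscoef x 1 != 0 /\ forall a : pseries Fq, ps_const a != 0 -> has_reflection iota kL DL n a x.
Proof.
have [z z0 Ez] := tau_eval_kernel kL sepF.2 (uL_neq0 n) (oner_neq0 L).
have [x0 isog_x0] := isogeny_surjective kL sepF.2 uL_neq0 n z.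
have [|x tx xn] := tate_series_extend (v := x0) (n := n.+1) DL_surjective.
  rewrite (iter_dual_isogeny kL towerL) isogenyS isog_x0 Ez.
  exact: (fq_linear0 (fq_linear_dual_isogeny kL _ _ _)).
rewrite -isog_x0 -xn in z0 Ez; exists x => //.
split=> [|a a0]; last by case: (has_reflection_torsion tx z0 Ez a0).
by case: (has_reflection_torsion tx z0 Ez (a := 1)); rewrite // rmorph1 oner_neq0.
Qed.

End Reflection.
End TowerGalois.

(** * Drinfeld modules over Laurent series *)

Section PowerSeriesEquations.
Variables (Fq : finFieldType) (k : closedFieldType) (kap : {rmorphism Fq -> k}).
Local Notation q := #|Fq|.
Local Notation O := (pseries k).

Let closed_k : separably_closed k := @closed_field_separably_closed k.

Lemma tau_eval_ps_surjective (s : seq O) :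
  ps_const s`_0 != 0 -> forall y, exists x, tau_eval q s x = y.
Proof.
move=> s0 y; have [|a sa] := tau_eval_surjective kap (s := map ps_const s) closed_k _ (ps_const y).
  by case: s s0.
by have [x _ sx] := tau_eval_hensel kap s0 sa; exists x.
Qed.

Lemma tau_eval_ps_kernel (c g : O) (s : seq O) :
  ps_const c != 0 -> ps_const g != 0 -> {in s, forall b, ps_const b = 0} ->
  exists2 x, ps_const x != 0 & tau_eval q [:: c, g & s] x = 0.
Proof.
move=> c0 g0 s0; have [a a0 sa] := tau_eval_kernel kap closed_k c0 g0.
have tail0 x : tau_eval q (map ps_const s) x = 0.
  elim: s s0 x => //= b s IHs s0 x; rewrite s0 ?mem_head // mul0r add0r IHs // => b' b's.
  by rewrite s0 // inE b's orbT.
have [|x xa sx] := tau_eval_hensel kap (s := [:: c, g & s]) (y := 0) (a := a) c0.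
  by rewrite rmorph0 -[RHS]sa /= tail0.
by exists x; rewrite ?xa.
Qed.

Lemma exists_ps_tate_series (c g : O) (s : seq O) :
  ps_const c != 0 -> ps_const g != 0 -> {in s, forall b, ps_const b = 0} ->
  exists2 e, tate_series (tau_eval q [:: c, g & s]) e & pscoef e 1 != 0.
Proof.
move=> c0 g0 s0; have [x x0 sx] := tau_eval_ps_kernel c0 g0 s0.
have [e te eE] := tate_series_extend (n := 1) (tau_eval_ps_surjective (s := [:: c, g & s]) c0) sx.
by exists e; rewrite // eE ps_const_neq0.
Qed.

Lemma dual_isogeny_ps_eq0 (c g : nat -> O) n x :
  (forall i, ps_const (c i) != 0) -> (forall i, ps_const (g i) = 0) ->
  dual_isogeny Fq c g n x = 0 -> x = 0.
Proof.
move=> c0 g0; elim: n x => // n IHn x; rewrite dual_isogenyS => /IHn/= /eqP.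
rewrite addr0 -(prednK (ltnW (finNzRing_gt1 Fq))) exprS mulrCA mulrC -mulrDr mulf_eq0.
case/orP => [/eqP //|/eqP/(congr1 ps_const)/eqP].
by rewrite rmorphD rmorphM /= g0 mul0r addr0 (negPf (c0 n)).
Qed.

Lemma exists_isogeny_kernel_series (T : O) (g1 g2 u c : nat -> O) :
  isogeny_tower Fq T g1 g2 u c -> ps_const T != 0 -> ps_const (g1 0%N) != 0 ->
  (forall i, ps_const (c i) != 0) -> (forall i, ps_const (g2 i) = 0) ->
  exists e, [/\ tate_series (tau_eval q [:: T; g1 0%N; g2 0%N]) e, pscoef e 1 != 0 &
    forall n, isogeny Fq u n (pscoef e n) = 0].
Proof.
move=> tower T0 g10 c0 g20.
have [|e te e1] := exists_ps_tate_series (s := [:: g2 0%N]) T0 g10.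
  by move=> b; rewrite inE => /eqP ->.
exists e; split=> // n; apply: (dual_isogeny_ps_eq0 (n := n) c0 g20).
rewrite -(iter_dual_isogeny (psC \o kap) tower).
rewrite (tate_series_iter (fq_linear_tau_eval (psC \o kap) _) _ _ te) subnn.
by case: te.
Qed.

End PowerSeriesEquations.

Section Lattice.
Variables (Fq : finFieldType) (k : closedFieldType) (kap : {rmorphism Fq -> k}).
Local Notation q := #|Fq|.
Local Notation O := (pseries k).
Local Notation toC := (@tofrac O).
Local Notation r := (psX : O).

Lemma tau_eval_polar (c h a : O) :
  tau_eval q [:: toC c; toC (r ^+ q.-1 * h)] (toC a / toC r)
  = toC (tau_eval q [:: c; h] a) / toC r.
Proof.
have r0 : toC r != 0 by rewrite tofrac_eq0 psX_neq0.
have rq : (toC r ^+ q)^-1 = (toC r)^-1 * (toC r ^+ q.-1)^-1.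
  by rewrite -invfM -exprS prednK // ltnW // finNzRing_gt1.
rewrite /= !addr0 rmorphD !rmorphM !rmorphXn /= exprMn exprVn rq mulrDl mulrA; congr (_ + _).
rewrite [_ * toC h]mulrC -!mulrA; congr (_ * _); rewrite mulrCA; congr (_ * _).
by rewrite mulrCA divff ?mulr1 // expf_neq0.
Qed.

(* A lattice point of order [-1]: its image under [F_i] has order [-1] again as
   long as [i > 0], and the last one is killed by [F_0]. *)
Lemma exists_lattice_point (T h : O) (g1 g2 u c : nat -> O) n :
  isogeny_tower Fq T g1 g2 u c -> (forall i, ps_const (c i) != 0) ->
  g2 0%N = r ^+ q.-1 * h -> ps_const h != 0 ->
  exists2 a, ps_const a != 0 &
    dual_isogeny Fq (toC \o c) (toC \o g2) n.+1 (toC a / toC r) = 0.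
Proof.
move=> tower c0 g20 h0; elim: n => [|n [b b0 dual_b]].
  have [|a a0 Fa] := @tau_eval_ps_kernel _ _ kap (c 0%N) h [::] (c0 0%N) h0; first by [].
  exists a => //; rewrite dual_isogenyS /comp g20 tau_eval_polar Fa.
  by rewrite rmorph0 mul0r.
have q1 : (0 < q.-1)%N by rewrite -subn1 subn_gt0 finNzRing_gt1.
have g2_const : ps_const (g2 n) = 0.
  rewrite (isogeny_tower_g2 tower) g20 rmorphXn rmorphM rmorphXn /= ps_constX.
  by rewrite expr0n gtn_eqF // mul0r expr0n gtn_eqF // expn_gt0 ltnW // finNzRing_gt1.
have g2E : g2 n.+1 = r ^+ q.-1 * (r * ps_shift (g2 n) ^+ q).
  rewrite (tower_g2S tower) {1}(ps_const_eq0 g2_const) exprMn mulrA -exprSr.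
  by rewrite prednK // ltnW // finNzRing_gt1.
pose s := [:: c n.+1; r * ps_shift (g2 n) ^+ q].
have [|a ab Fa] := tau_eval_hensel kap (s := s) (y := b)
    (a := ps_const b / ps_const (c n.+1)) (c0 n.+1).
  by rewrite /= rmorphM /= ps_constX !mul0r !addr0 mulrC divfK.
exists a; first by rewrite ab mulf_neq0 ?invr_eq0.
by rewrite dual_isogenyS [(toC \o g2) n.+1]/= g2E tau_eval_polar Fa.
Qed.

Lemma irreducible_lattice_poly (u : nat -> O) (a : O) n : ps_const a != 0 ->
  irreducible_poly (isogeny_poly Fq (toC \o u) n - (toC a / toC r)%:P).
Proof.
move=> a0; have r0 : toC r != 0 by rewrite tofrac_eq0 psX_neq0.
have ra : toC r * (toC a / toC r) = toC a by rewrite mulrC divfK.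
pose p := r *: isogeny_poly Fq u n - a%:P.
have pE : map_poly toC p = toC r *: (isogeny_poly Fq (toC \o u) n - (toC a / toC r)%:P).
  rewrite /p rmorphB /= map_polyZ map_polyC map_isogeny_poly scalerBr.
  by rewrite -[_ *: (_ / _)%:P]mul_polyC -polyCM ra.
have size_rp : size (r *: isogeny_poly Fq u n) = (q ^ n).+1.
  by rewrite size_scale ?psX_neq0 // size_isogeny_poly.
have qn0 : (0 < q ^ n)%N by rewrite expn_gt0 ltnW // finNzRing_gt1.
have lt_size : (size (- a%:P)%R < size (r *: isogeny_poly Fq u n)%R)%N.
  by rewrite size_polyN size_rp (leq_ltn_trans (size_polyC_leq1 _)).
suff : irreducible_poly (map_poly toC p).
  rewrite pE => -[size_p irr]; split=> [|d d1 dvd]; first by rewrite size_scale in size_p.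
  by rewrite -(eqp_rtrans (eqp_scale _ r0)) irr // dvdpZr.
apply: (reversed_eisenstein (@tofrac_inj _) (@pseries_valuation_ring k)).
- by rewrite size_polyDl // size_rp.
- rewrite coefB coefZ (coef0_isogeny_poly (psC \o kap)) mulr0 coefC sub0r.
  by rewrite rmorphN oppr_eq0.
- by move=> i; rewrite coefB coefZ coefC subr0 rmorphM /= ps_constX mul0r.
- apply: not_in_max_square_ps; rewrite lead_coefDl // lead_coefZ.
  by rewrite (monicP (monic_isogeny_poly _ _ _)) mulr1 oner_eq0.
Qed.

Lemma irreducible_kummer_poly (u : nat -> O) n : (2 < q)%N ->
  (forall i, ps_const (u i) = 0) -> pscoef (u n) 1 != 0 ->
  irreducible_poly (isogeny_poly Fq (toC \o u) n ^+ q.-1 + (toC (u n))%:P).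
Proof.
move=> q_gt2 u0 un1; have qn0 : (0 < q ^ n)%N by rewrite expn_gt0 ltnW // finNzRing_gt1.
have q1 : (0 < q.-1)%N by rewrite -subn1 subn_gt0 finNzRing_gt1.
have -> : isogeny_poly Fq (toC \o u) n ^+ q.-1 + (toC (u n))%:P
    = map_poly toC (isogeny_poly Fq u n ^+ q.-1 + (u n)%:P).
  by rewrite rmorphD rmorphXn /= map_isogeny_poly map_polyC.
have mon : isogeny_poly Fq u n ^+ q.-1 \is monic.
  by rewrite monic_exp // monic_isogeny_poly.
have size_pow : size (isogeny_poly Fq u n ^+ q.-1) = (q ^ n * q.-1).-1.+2.
  rewrite -[LHS]prednK ?size_poly_gt0 ?monic_neq0 // size_exp size_isogeny_poly /=.
  by rewrite prednK // muln_gt0 qn0.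
have lt_size : (size ((u n)%:P) < size (isogeny_poly Fq u n ^+ q.-1)%R)%N.
  by rewrite size_pow (leq_ltn_trans (size_polyC_leq1 _)).
have lead1 : lead_coef (isogeny_poly Fq u n ^+ q.-1 + (u n)%:P) = 1.
  by rewrite lead_coefDl // (monicP mon).
have const_isogeny : map_poly ps_const (isogeny_poly Fq u n) = 'X^(q ^ n).
  rewrite map_isogeny_poly; elim: (n) => [|i IHi]; first by rewrite expn0 expr1.
  by rewrite isogeny_polyS /= u0 scale0r addr0 IHi -exprM -expnSr.
apply: (eisenstein (n := (q ^ n * q.-1).-1) (@tofrac_inj _) (@pseries_valuation_ring k)).
- by rewrite size_polyDl.
- by rewrite lead1 rmorph1 oner_eq0.
- rewrite lead1 rmorph1 scale1r rmorphD rmorphXn /= map_polyC /= u0 polyC0 addr0.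
  by rewrite const_isogeny -exprM prednK // muln_gt0 qn0.
apply: not_in_max_square_ps; rewrite coefD coefC /= -horner_coef0 horner_exp horner_coef0.
by rewrite (coef0_isogeny_poly (psC \o kap)) expr0n gtn_eqF // add0r.
Qed.

End Lattice.

(** * Torsion at a place of the rational function field *)

Section IntegralDescent.
Variables (Fq : finFieldType) (E L : fieldType) (k : closedFieldType).
Local Notation q := #|Fq|.
Local Notation toC := (@tofrac (pseries k)).
Variables (kap : {rmorphism Fq -> k}) (kapE : {rmorphism Fq -> E}).
Variables (w : {rmorphism E -> {fraction pseries k}}) (v : {rmorphism E -> L}).
Hypotheses (closw : relatively_separably_closed w).
Hypothesis w_kap : forall a, w (kapE a) = toC (psC (kap a)).

Lemma unit_lift_neq0 e a : w e = toC a -> ps_const a != 0 -> e != 0.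
Proof. by move=> we /ps_const_neq0; rewrite -(fmorph_eq0 w) we tofrac_eq0. Qed.

Lemma tate_series_descent (s : seq E) (x : pseries {fraction pseries k}) : s`_0 != 0 ->
  tate_series (tau_eval q (map w s)) x ->
  exists2 y, tate_series (tau_eval q s) y & ps_map w y = x.
Proof.
move=> s0 [x0 xS]; have /choice[y yx] : forall n, exists e, w e = pscoef x n.
  elim=> [|n [e we]]; first by exists 0; rewrite rmorph0 x0.
  have [e' we' _] := tau_eval_descent kapE closw s0 (y := e) (etrans (xS n) (esym we)).
  by exists e'.
exists (PSeries y); last by apply: pseriesP => n /=.
split=> [|n] /=; apply: (fmorph_inj w); first by rewrite yx x0 rmorph0.
by rewrite rmorph_tau_eval !yx xS.
Qed.

Lemma dual_isogeny_descent (c g : nat -> E) n x y : (forall i, c i != 0) ->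
  dual_isogeny Fq (w \o c) (w \o g) n x = w y ->
  exists2 e, w e = x & dual_isogeny Fq c g n e = y.
Proof.
move=> c0; elim: n x => [|n IHn] x; first by exists y.
rewrite dual_isogenyS => /IHn[e we eE].
have [|e' we' e'E] := tau_eval_descent kapE closw (s := [:: c n; g n]) (x := x) (y := e) (c0 n).
  by rewrite we.
by exists e'; rewrite // dual_isogenyS e'E.
Qed.

Definition integral_at (e : E) : Prop := exists a, w e = toC a.

(* A root is a root over the complete ring plus an [F_q]-multiple of a nonzero
   element of the kernel, which is integral too. *)
Lemma tau_eval_integral_root (c g y : E) (c0 g0 : pseries k) x :
  w c = toC c0 -> w g = toC g0 -> ps_const c0 != 0 -> ps_const g0 != 0 ->
  integral_at y -> tau_eval q [:: v c; v g] x = v y ->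
  exists2 e, integral_at e & v e = x.
Proof.
move=> wc wg cc gg [y0 wy] sx; have c_neq0 := unit_lift_neq0 wc cc.
have lift z0 z : w z = toC (tau_eval q [:: c0; g0] z0) ->
    exists2 e, w e = toC z0 & tau_eval q [:: c; g] e = z.
  move=> wz; apply: (tau_eval_descent kapE closw).
    by rewrite -(fmorph_eq0 w) /= wc tofrac_eq0; apply: contraNneq cc => ->; rewrite rmorph0.
  by rewrite wz rmorph_tau_eval /= wc wg.
have [a aE] := tau_eval_ps_surjective kap (s := [:: c0; g0]) cc y0.
have [|e we eE] := lift a y; first by rewrite wy aE.
have [|z0 z0c z0E] := tau_eval_ps_kernel kap (s := [::]) cc gg; first by [].
have [|z wz zE] := lift z0 0; first by rewrite z0E !rmorph0.
have z_neq0 := unit_lift_neq0 wz z0c.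
have [||b|i||b xeE] := @ker_tau_eval_span _ _ (v \o kapE) [:: v c; v g] 1 (v z)%:M (x - v e).
- by rewrite fmorph_eq0.
- by [].
- rewrite mul_scalar_mx => /matrixP/(_ 0 0)/eqP.
  rewrite !mxE mulf_eq0 !fmorph_eq0 (negPf z_neq0) /= => /eqP b0.
  by apply/colP => i; rewrite ord1 mxE.
- by rewrite ord1 mxE eqxx -[[:: v c; v g]]/(map v [:: c; g]) -rmorph_tau_eval zE rmorph0.
- rewrite (fq_linearB (fq_linear_tau_eval (v \o kapE) _)) sx.
  by rewrite -[[:: v c; v g]]/(map v [:: c; g]) -rmorph_tau_eval eE subrr.
exists (e + kapE (b 0 0) * z).
  by exists (a + psC (kap (b 0 0)) * z0); rewrite !rmorphD !rmorphM we wz w_kap.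
move/matrixP: xeE => /(_ 0 0); rewrite mul_scalar_mx !mxE mulr1n => xeE.
by rewrite rmorphD rmorphM mulrC -xeE addrC subrK.
Qed.

Lemma dual_isogeny_integral_root (c g : nat -> E) (c0 g0 : nat -> pseries k) n x y :
  w \o c = toC \o c0 -> w \o g = toC \o g0 ->
  (forall i, ps_const (c0 i) != 0) -> (forall i, ps_const (g0 i) != 0) ->
  integral_at y -> dual_isogeny Fq (v \o c) (v \o g) n x = v y ->
  exists2 e, integral_at e & v e = x.
Proof.
move=> wc wg cc gg int_y; elim: n x => [|n IHn] x; first by exists y.
rewrite dual_isogenyS => /IHn[e int_e /esym].
exact: tau_eval_integral_root (congr1 (@^~ n) wc) (congr1 (@^~ n) wg) (cc n) (gg n) int_e.
Qed.

Record tower_lift (T0 : pseries k) (G1 G2 U C : nat -> pseries k)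
    (T : E) (g1 g2 u c : nat -> E) : Prop := TowerLift {
  tower_lift_integral : isogeny_tower Fq T0 G1 G2 U C;
  tower_lift_unit : forall i, ps_const (C i) != 0;
  tower_lift_rational : isogeny_tower Fq T g1 g2 u c;
  tower_lift_T : w T = toC T0;
  tower_lift_g1 : w (g1 0%N) = toC (G1 0%N);
  tower_lift_g2 : w \o g2 = toC \o G2;
  tower_lift_u : w \o u = toC \o U;
  tower_lift_c : w \o c = toC \o C }.

Lemma exists_tower_lift (T g1 g2 : E) (T0 g10 g20 : pseries k) :
  w T = toC T0 -> w g1 = toC g10 -> w g2 = toC g20 -> T != 0 ->
  ps_const g10 != 0 -> ps_const T0 * ps_const g20 = 0 ->
  exists G1 G2 U C G1' G2' U' C', [/\ tower_lift T0 G1 G2 U C T G1' G2' U' C',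
    G1 0%N = g10 /\ G2 0%N = g20 & G1' 0%N = g1 /\ G2' 0%N = g2].
Proof.
move=> wT wg1 wg2 Tn0 g1c Tg2c.
have [G1 [G2 [U [C [tower G1E G2E C0]]]]] := exists_isogeny_tower Fq g1c Tg2c.
have towerC : isogeny_tower Fq (w T) (toC \o G1) (toC \o G2) (toC \o U) (toC \o C).
  by rewrite wT; apply: rmorph_isogeny_tower.
have [||G1' [G2' [U' [C' [tower' G1'E G2'E [wG wU wC]]]]]] :=
  isogeny_tower_descent kapE closw Tn0 towerC (g1 := g1) (g2 := g2).
- by rewrite /= G1E wg1.
- by rewrite /= G2E wg2.
exists G1, G2, U, C, G1', G2', U', C'; split=> //; split=> //; try exact: funext.
by rewrite G1'E G1E.
Qed.

Section LiftedTower.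
Variables (T0 : pseries k) (G1 G2 U C : nat -> pseries k).
Variables (T : E) (g1 g2 u c : nat -> E).
Hypothesis lift : tower_lift T0 G1 G2 U C T g1 g2 u c.

Lemma exists_isogeny_kernel_descent :
  ps_const T0 != 0 -> ps_const (G1 0%N) != 0 -> (forall i, ps_const (G2 i) = 0) ->
  exists e, [/\ tate_series (tau_eval q [:: T; g1 0%N; g2 0%N]) e, pscoef e 1 != 0 &
    forall n, isogeny Fq u n (pscoef e n) = 0].
Proof.
move=> T0c G1c G2c.
have [e0 [te0 e01 isog_e0]] :=
  exists_isogeny_kernel_series kap (tower_lift_integral lift) T0c G1c (tower_lift_unit lift) G2c.
have [||e te eE] := tate_series_descent (s := [:: T; g1 0%N; g2 0%N]) (x := ps_map toC e0).
- exact: unit_lift_neq0 (tower_lift_T lift) T0c.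
- have := tate_series_map toC te0; rewrite /= (tower_lift_T lift) (tower_lift_g1 lift).
  by rewrite -[w (g2 0%N)]/((w \o g2) 0%N) (tower_lift_g2 lift).
have we n : w (pscoef e n) = toC (pscoef e0 n).
  by rewrite -[LHS]/(pscoef (ps_map w e) n) eE.
exists e; split=> // [|n]; first by rewrite -(fmorph_eq0 w) we tofrac_eq0.
apply: (fmorph_inj w); rewrite rmorph_isogeny (tower_lift_u lift) we -rmorph_isogeny.
by rewrite isog_e0 !rmorph0.
Qed.

Lemma exists_lattice_descent (h : pseries k) n :
  G2 0%N = psX ^+ q.-1 * h -> ps_const h != 0 ->
  exists2 z, dual_isogeny Fq c g2 n.+1 z = 0 &
    irreducible_poly (isogeny_poly Fq u n.+1 - z%:P).
Proof.
move=> G2E h0; have [a a0] :=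
  exists_lattice_point kap n (tower_lift_integral lift) (tower_lift_unit lift) G2E h0.
rewrite -(tower_lift_c lift) -(tower_lift_g2 lift) -(rmorph0 w).
have c_neq0 i := unit_lift_neq0 (congr1 (@^~ i) (tower_lift_c lift)) (tower_lift_unit lift i).
move=> /(dual_isogeny_descent c_neq0)[z wz dual_z].
exists z => //; apply: (irreducible_map_poly (u := w)).
rewrite rmorphB /= map_isogeny_poly map_polyC /= wz (tower_lift_u lift).
exact: (irreducible_lattice_poly kap U n.+1 a0).
Qed.

Lemma irreducible_kummer_descent n : (2 < q)%N ->
  (forall i, ps_const (U i) = 0) -> pscoef (U n) 1 != 0 ->
  irreducible_poly (isogeny_poly Fq u n ^+ q.-1 + (u n)%:P).
Proof.
move=> q_gt2 Uc U1; apply: (irreducible_map_poly (u := w)).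
rewrite rmorphD rmorphXn /= map_isogeny_poly map_polyC /= (tower_lift_u lift).
rewrite -[w (u n)]/((w \o u) n) (tower_lift_u lift).
exact: (irreducible_kummer_poly kap q_gt2 Uc U1).
Qed.

Lemma dual_isogeny_kernel_lift n x : (forall i, ps_const (G2 i) != 0) ->
  dual_isogeny Fq (v \o c) (v \o g2) n x = 0 -> exists e, v e = x.
Proof.
move=> G2_unit; rewrite -(rmorph0 v) => dual_x.
have [|e _ ve] := dual_isogeny_integral_root (tower_lift_c lift) (tower_lift_g2 lift)
  (tower_lift_unit lift) G2_unit _ dual_x; last by exists e.
by exists 0; rewrite !rmorph0.
Qed.

End LiftedTower.

End IntegralDescent.

Section Expansion.
Variables (Fq : finFieldType) (k : fieldType) (kap : {rmorphism Fq -> k}) (c : Fq) (m : nat).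

(* [T] goes to [c + X^m]: a ramified parameter at the place [T = c]. *)
Definition expand : {rmorphism {poly Fq} -> pseries k} :=
  horner_morph (fun a => mulrC (psC (kap c) + psX ^+ m) ((psC \o kap) a)).

Lemma expandC a : expand a%:P = psC (kap a).
Proof. exact: horner_morphC. Qed.

Lemma expandX : expand 'X = psC (kap c) + psX ^+ m.
Proof. exact: horner_morphX. Qed.

Lemma expandXsubC : expand ('X - c%:P) = psX ^+ m.
Proof. by rewrite rmorphB /= [X in X - _]expandX [X in _ - X]expandC addrC addKr. Qed.

Hypothesis m_gt0 : (0 < m)%N.

Lemma ps_const_expand a : ps_const (expand a) = kap a.[c].
Proof.
elim/poly_ind: a => [|a b IHa]; first by rewrite !rmorph0 horner0 rmorph0.
rewrite rmorphD rmorphM hornerMXaddC !rmorphD !rmorphM [in LHS]/= IHa; congr (_ * _ + _).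
  rewrite [expand 'X]expandX rmorphD rmorphXn /= ps_constC ps_constX.
  by rewrite expr0n gtn_eqF // addr0.
by rewrite [expand _]expandC /= ps_constC.
Qed.

Lemma expand_inj : injective expand.
Proof.
move=> a1 a2 /eqP; rewrite -subr_eq0 -rmorphB; apply: contraTeq; rewrite -subr_eq0.
move: (a1 - a2) => a a_neq0.
have [n [b b_c ->]] := multiplicity_XsubC a c; rewrite a_neq0 /= in b_c.
rewrite rmorphM rmorphXn [X in _ * X ^+ n]expandXsubC mulf_neq0 ?expf_neq0 ?psX_neq0 //.
apply: contraNneq b_c => b0; rewrite /root -(fmorph_eq0 kap) -ps_const_expand b0.
by rewrite rmorph0.
Qed.

End Expansion.

Section Places.
Variables (Fq : finFieldType) (L : fieldType).
Local Notation A := {poly Fq}.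
Local Notation q := #|Fq|.
Variable iota : {rmorphism {fraction A} -> L}.
Hypothesis sepF : separable_closure iota.
Local Notation jL := (iota \o @tofrac A).
Local Notation kL := (jL \o polyC).
Variables (k : closedFieldType) (kap : {rmorphism Fq -> k}).
Local Notation toC := (@tofrac (pseries k)).

Variable w : A * A.
Local Notation D := (tau_eval q [:: jL 'X; jL w.1; jL w.2]).

Lemma exists_place_tower (c : Fq) m : (0 < m)%N -> w.1.[c] != 0 -> c * w.2.[c] = 0 ->
  exists (E : fieldType) (eta : {rmorphism {fraction A} -> E})
    (u : {rmorphism E -> {fraction pseries k}}) (v : {rmorphism E -> L}) G1 G2 U C g1 g2 r s,
  [/\ forall a, v (eta a) = iota a, forall a, u (eta (tofrac a)) = toC (expand kap c m a),
      relatively_separably_closed u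
    & [/\ tower_lift Fq u (expand kap c m 'X) G1 G2 U C (eta (tofrac 'X)) g1 g2 r s,
          G1 0%N = expand kap c m w.1 /\ G2 0%N = expand kap c m w.2
        & g1 0%N = eta (tofrac w.1) /\ g2 0%N = eta (tofrac w.2)]].
Proof.
move=> m_gt0 w1c w2c; have inj : injective (toC \o expand kap c m).
  by apply: inj_comp (expand_inj m_gt0); apply: tofrac_inj.
have [h hE] := fraction_lift inj.
have [E [eta [u [v [u_eta v_eta closu _]]]]] := exists_maximal_span h iota.
have {}u_eta a : u (eta (tofrac a)) = toC (expand kap c m a) by rewrite u_eta hE.
have {}closu : relatively_separably_closed u by apply/closu/sepF.2.
pose kE : {rmorphism Fq -> E} := eta \o @tofrac A \o polyC.
exists E, eta, u, v.
have [|||G1 [G2 [U [C [g1 [g2 [r [s lift]]]]]]]] :=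
  exists_tower_lift kE closu (u_eta 'X) (u_eta w.1) (u_eta w.2).
- by rewrite fmorph_eq0 tofrac_eq0 polyX_eq0.
- by rewrite ps_const_expand // fmorph_eq0.
- by rewrite !ps_const_expand // hornerX -rmorphM w2c rmorph0.
by exists G1, G2, U, C, g1, g2, r, s.
Qed.

(* Adjoining [(T - c)^(1/(q-1))] makes the periods of order [-1] integral multiples
   of the inverse of the uniformizer. *)
Lemma has_transvections_at_degeneration (c : Fq) (g : A) :
  c != 0 -> w.1.[c] != 0 -> w.2 = ('X - c%:P) * g -> g.[c] != 0 ->
  exists f, [/\ tate_series D f, pscoef f 1 != 0 & has_transvections iota kL D f].
Proof.
move=> c0 w1c w2E gc; have q1 : (0 < q.-1)%N by rewrite -subn1 subn_gt0 finNzRing_gt1.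
have constE := ps_const_expand kap c q1.
have [|E [eta [u [v [G1 [G2 [U [C [g1 [g2 [r [s [v_eta u_eta closu
  [lift [G1E G2E] [g1E g2E]]]]]]]]]]]]]]] := exists_place_tower q1 w1c.
  by rewrite w2E hornerM hornerXsubC subrr mul0r mulr0.
pose kE : {rmorphism Fq -> E} := eta \o @tofrac A \o polyC.
have T0 : eta (tofrac 'X) != 0 by rewrite fmorph_eq0 tofrac_eq0 polyX_eq0.
have G20 : G2 0%N = psX ^+ q.-1 * expand kap c q.-1 g.
  by rewrite G2E w2E rmorphM [X in X * _]expandXsubC.
have G2c i : ps_const (G2 i) = 0.
  rewrite (isogeny_tower_g2 (tower_lift_integral lift)) G20 rmorphXn rmorphM rmorphXn /=.
  by rewrite ps_constX expr0n gtn_eqF // mul0r expr0n gtn_eqF // expn_gt0 ltnW // finNzRing_gt1.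
have [||e [te e1 isog_e]] := exists_isogeny_kernel_descent kap kE closu lift _ _ G2c.
- by rewrite constE hornerX fmorph_eq0.
- by rewrite G1E constE fmorph_eq0.
exists (ps_map v e); split.
- by have := tate_series_map v te; rewrite /= g1E g2E !v_eta.
- by rewrite /= fmorph_eq0.
apply: (@eq_has_transvections _ _ _ _ (v \o kE)) => [a /=|]; first by rewrite v_eta.
have := has_transvections_of_tower sepF v_eta kE (tower_lift_rational lift) T0 te isog_e.
rewrite g1E g2E /= !v_eta; apply=> n.
by apply: (exists_lattice_descent kap kE closu lift n G20); rewrite constE fmorph_eq0.
Qed.

Lemma has_reflections_at_ordinary_reduction : (2 < q)%N -> w.1.[0] != 0 -> w.2.[0] != 0 ->
  forall n, exists2 x, tate_series D x & pscoef x 1 != 0 /\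
    forall a : pseries Fq, ps_const a != 0 -> has_reflection iota kL D n a x.
Proof.
move=> q_gt2 w1 w2 n; have constE := ps_const_expand kap 0 (ltn0Sn 0).
have [E [eta [u [v [G1 [G2 [U [C [g1 [g2 [r [s [v_eta u_eta closu
  [lift [G1E G2E] [g1E g2E]]]]]]]]]]]]]]] := exists_place_tower (ltn0Sn 0) w1 (mul0r _).
pose kE : {rmorphism Fq -> E} := eta \o @tofrac A \o polyC.
have u_kE a : u (kE a) = toC (psC (kap a)) by rewrite /= u_eta expandC.
have T0 : eta (tofrac 'X) != 0 by rewrite fmorph_eq0 tofrac_eq0 polyX_eq0.
have tower := tower_lift_integral lift.
have expand0 : expand kap 0 1 'X = psX by rewrite [LHS]expandX !rmorph0 add0r.
have G2_unit i : ps_const (G2 i) != 0.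
  by rewrite (isogeny_tower_g2 tower) rmorphXn expf_neq0 //= G2E constE fmorph_eq0.
have U0 i : ps_const (U i) = 0.
  have := congr1 ps_const (tower_T tower i); rewrite expand0 rmorphM /= ps_constX => /eqP.
  by rewrite mulf_eq0 (negPf (tower_lift_unit lift i)) => /eqP.
have U1 : pscoef (U n) 1 != 0.
  have := tower_T tower n; rewrite expand0 {1}(ps_const_eq0 (U0 n)) mulrCA -[RHS]mulr1.
  move=> /(mulfI (psX_neq0 k))/(congr1 ps_const); rewrite rmorphM rmorph1 /= => CU.
  by apply: contra_eq_neq CU => U1; rewrite [ps_const (ps_shift _)]U1 mulr0 eq_sym oner_neq0.
have irr := irreducible_kummer_descent kap lift q_gt2 U0 U1.
have dual_kernel m x : dual_isogeny Fq (v \o s) (v \o g2) m x = 0 -> exists e, v e = x.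
  by move=> dual_x; apply: (dual_isogeny_kernel_lift closu u_kE lift G2_unit dual_x).
have [x tx [x1 refl]] :=
  has_reflections_of_tower sepF v_eta kE (tower_lift_rational lift) T0 q_gt2 irr dual_kernel.
rewrite g1E g2E /= !v_eta in tx refl; exists x => //; split=> // a a0.
apply: (@eq_has_reflection _ _ _ _ (v \o kE)) => [b /=|]; first by rewrite v_eta.
exact: refl.
Qed.

End Places.

(** * Surjectivity *)

(* By descent: ['X - c%:P] divides [b], then [a]. *)
Lemma eisenstein_no_root (F : fieldType) (c : F) (t m1 m2 : {poly F}) n :
  (0 < n)%N -> t.[c] != 0 -> m2.[c] != 0 -> forall a b, b != 0 ->
  t * b ^+ n.+1 + ('X - c%:P) * m1 * a * b ^+ n + ('X - c%:P) * m2 * a ^+ n.+1 != 0.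
Proof.
move=> n_gt0 tc m2c a b; have [l] := ubnP (size b).
elim: l a b => // l IHl a b lt_bl b0; apply/eqP => eq0.
have pi0 : 'X - c%:P != 0 :> {poly F} by rewrite polyXsubC_eq0.
have /factor_theorem[b1 bE] : root b c.
  have /eqP := congr1 (horner^~ c) eq0.
  rewrite /= !hornerD !hornerM hornerXsubC subrr !mul0r !addr0 horner0 horner_exp.
  by rewrite mulf_eq0 (negPf tc) expf_eq0.
have eq1 : t * b1 ^+ n.+1 * ('X - c%:P) ^+ n + m1 * a * b1 ^+ n * ('X - c%:P) ^+ n
    + m2 * a ^+ n.+1 = 0.
  by apply: (mulfI pi0); rewrite mulr0 -[RHS]eq0 bE !exprMn !exprS; ring.
have /factor_theorem[a1 aE] : root a c.
  have /eqP := congr1 (horner^~ c) eq1.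
  rewrite /= !hornerD !hornerM !horner_exp hornerXsubC subrr expr0n gtn_eqF // !mulr0.
  by rewrite !add0r horner0 mulf_eq0 (negPf m2c) expf_eq0.
have b10 : b1 != 0 by apply: contraNneq b0 => b10; rewrite bE b10 mul0r.
have lt_b1 : (size b1 < l)%N.
  by rewrite -ltnS (leq_trans _ lt_bl) // bE size_mul // size_XsubC addn2.
case/eqP: (IHl a1 b1 lt_b1 b10); apply: (mulfI (expf_neq0 n.+1 pi0)).
by rewrite mulr0 -[RHS]eq0 bE aE !exprMn !exprS; ring.
Qed.

Section Surjectivity.
Variables (Fq : finFieldType) (L : fieldType).
Local Notation A := {poly Fq}.
Local Notation q := #|Fq|.
Variable iota : {rmorphism {fraction A} -> L}.
Hypothesis sepF : separable_closure iota.
Local Notation jL := (iota \o @tofrac A).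
Local Notation kL := (jL \o polyC).
Local Notation galois := (in_galois_group iota).
Variable w : A * A.
Local Notation D := (tau_eval q [:: jL 'X; jL w.1; jL w.2]).

Let linD : fq_linear kL D := fq_linear_tau_eval kL _.

Lemma galois_scalar s : galois s -> forall c, s (kL c) = kL c.
Proof. by move=> [_ fix_s] c; apply: fix_s. Qed.

Lemma galois_tau_eval s : galois s -> forall x, s (D x) = D (s x).
Proof. by move=> [_ fix_s] x; rewrite rmorph_tau_eval /= !fix_s. Qed.

Lemma jL_inj : injective jL.
Proof. by move=> a b /fmorph_inj/tofrac_inj. Qed.

(* If the line of [v] were stable, [v ^+ q.-1] would be rational. *)
Lemma exists_galois_moving_line (c : Fq) (m1 m2 : A) v :
  c != 0 -> w.1 = ('X - c%:P) * m1 -> w.2 = ('X - c%:P) * m2 -> m2.[c] != 0 ->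
  v != 0 -> D v = 0 -> exists2 s, galois s & forall d, s v != kL d * v.
Proof.
move=> c0 w1E w2E m2c v0 Dv; apply: contrapT => stable.
have q1 : (0 < q)%N := ltnW (finNzRing_gt1 Fq).
have vq : v ^+ q = v * v ^+ q.-1 by rewrite -exprS prednK.
have [s gal_s|x xE] := galois_fixed sepF (x := v ^+ q.-1).
  have [d sv] : exists d, s v = kL d * v.
    apply: contrapT => moved; apply: stable; exists s => // d.
    by apply/eqP => sv; apply: moved; exists d.
  have d0 : d != 0.
    apply: contraNneq v0 => d0; move/eqP: sv.
    by rewrite d0 rmorph0 mul0r fmorph_eq0.
  have d_unity : d ^+ q.-1 = 1.
    by apply: (mulfI d0); rewrite -exprS prednK // expf_card mulr1.
  by rewrite rmorphXn sv exprMn -rmorphXn d_unity rmorph1 mul1r.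
have [[a b] /= [b0 xab]] := fractionP x.
have jLb : jL b != 0 by rewrite -(rmorph0 jL) (inj_eq jL_inj).
have jLa : jL a = v ^+ q.-1 * jL b.
  by rewrite -xE xab /= rmorphM fmorphV divfK.
have := eisenstein_no_root (t := 'X) m1 q1 _ m2c a b0.
rewrite hornerX -w1E -w2E => /(_ c0)/eqP; apply; apply: jL_inj.
apply: (mulfI v0); rewrite rmorph0 mulr0 -[RHS](mul0r (jL b ^+ q.+1)) -Dv.
rewrite !rmorphD !rmorphM !rmorphXn /= in jLa *.
by rewrite jLa vq !exprMn vq !exprS; ring.
Qed.

Definition conjugate_row (h : {rmorphism L -> L}) f1 : 'rV[pseries L]_2 :=
  \row_j if j == 0 then f1 else ps_map h f1.

Lemma tate_frame_conjugate f1 h : tate_series D f1 -> pscoef f1 1 != 0 -> galois h ->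
  (forall d, h (pscoef f1 1) != kL d * pscoef f1 1) ->
  tate_frame kL D (conjugate_row h f1).
Proof.
move=> t1 f1_neq0 gal_h moved; set f := conjugate_row h f1.
have t2 : tate_series D (ps_map h f1) by apply: tate_series_galois gal_h t1; apply: galois_tau_eval.
have tf j : tate_series D (f 0 j) by rewrite mxE; case: ifP.
have free_f (b : 'cV[Fq]_2) : map_mx (fun x => pscoef x 1) f *m map_mx kL b = 0 -> b = 0.
  move=> /matrixP/(_ 0 0); rewrite !mxE (sum_ord2 _ (i := 0) (j := 1)) // !mxE /= => /eqP.
  rewrite addr_eq0 => /eqP fb0; have b1 : b 1 0 = 0.
    apply/eqP/negPn/negP => b1_neq0; case/eqP: (moved (- (b 0 0 / b 1 0))).
    have kb1 : kL (b 1 0) != 0 by rewrite fmorph_eq0.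
    apply: (mulIf kb1); rewrite mulrAC -rmorphM mulNr divfK // rmorphN mulNr [in RHS]mulrC /=.
    by rewrite fb0 opprK.
  apply/colP => -[[|[|//]] lt_i2]; rewrite mxE; last by rewrite -b1; congr (b _ _); apply: val_inj.
  move/eqP: fb0; rewrite b1 !rmorph0 mulr0 oppr0 mulf_eq0 (negPf f1_neq0) !fmorph_eq0.
  by rewrite tofrac_eq0 polyC_eq0 => /eqP <-; congr (b _ _); apply: val_inj.
split; first by split.
move=> z Dz; apply: (ker_tau_eval_span (s := [:: jL 'X; jL w.1; jL w.2])) => //.
- by rewrite fmorph_eq0 tofrac_eq0 polyX_eq0.
- by move=> j; rewrite mxE; have [f0 fS] := tf j; rewrite fS.
Qed.

Lemma exists_full_galois_frame (c c' : Fq) (g m1 m2 : A) :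
  (2 < q)%N -> w.1.[0] != 0 -> w.2.[0] != 0 ->
  c != 0 -> w.1.[c] != 0 -> w.2 = ('X - c%:P) * g -> g.[c] != 0 ->
  c' != 0 -> w.1 = ('X - c'%:P) * m1 -> w.2 = ('X - c'%:P) * m2 -> m2.[c'] != 0 ->
  exists2 f : 'rV_2, tate_frame kL D f & forall M, M \in unitmx -> galois_matrix iota kL f M.
Proof.
move=> q_gt2 w10 w20 c0 w1c w2E gc c'0 w1E' w2E' m2c'.
have [k [kap _]] := countable_algebraic_closure Fq.
have [f1 [t1 f1_neq0 transv1]] := has_transvections_at_degeneration sepF kap c0 w1c w2E gc.
have Df1 : D (pscoef f1 1) = 0 by have [f10 ->] := t1.
have [h gal_h moved] := exists_galois_moving_line c'0 w1E' w2E' m2c' f1_neq0 Df1.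
have frame := tate_frame_conjugate t1 f1_neq0 gal_h moved.
exists (conjugate_row h f1) => //.
have transv j : has_transvections iota kL D (conjugate_row h f1 0 j).
  rewrite mxE; case: ifP => // _.
  exact: (has_transvections_galois (@galois_scalar) (@galois_tau_eval)).
apply: GL2_generated.
- by move=> M N; apply: (galois_matrixM (@galois_scalar)).
- move=> i j t neq_ij.
  exact: (transvection_galois_matrix sepF linD (@galois_scalar) (@galois_tau_eval) frame).
- by move=> M; apply: (galois_matrix_closed sepF frame).
move=> n a a0.
have [x tx [x1 refl]] := has_reflections_at_ordinary_reduction sepF kap q_gt2 w10 w20 n.
exact: (reflection_galois_matrix linD (@galois_scalar) (@galois_tau_eval) frame tx x1 (refl a a0)).
Qed.

End Surjectivity.

(** * The Tate module of a Drinfeld module *)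

Section Evaluation.
Variables (Fq : finFieldType) (K L : fieldType).
Local Notation A := {poly Fq}.
Local Notation q := #|Fq|.
Variables (gam : {rmorphism A -> K}) (iota : {rmorphism K -> L}).
Local Notation frob := (frobq gam).
Local Notation kL := (iota \o gam \o polyC).
Implicit Types (f g : twisted gam) (x : L).

Definition poly_tau_eval (p : {poly K}) x := tau_eval q (map iota p) x.

Lemma poly_tau_evalE n (p : {poly K}) x : (size p <= n)%N ->
  poly_tau_eval p x = \sum_(i < n) iota p`_i * x ^+ (q ^ i).
Proof.
move=> le_pn; rewrite /poly_tau_eval tau_evalE size_map.
rewrite (big_ord_widen n (fun i => (map iota p)`_i * x ^+ (q ^ i))) //.
rewrite big_mkcond; apply: eq_bigr => i _ /=.
by case: ltnP => [lt_ip|le_pi]; [rewrite (nth_map 0)|rewrite nth_default // rmorph0 mul0r].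
Qed.

Lemma poly_tau_evalD p p' x : poly_tau_eval (p + p') x = poly_tau_eval p x + poly_tau_eval p' x.
Proof.
pose n := maxn (size p) (size p').
rewrite (@poly_tau_evalE n (p + p')) ?size_polyD //.
rewrite (@poly_tau_evalE n p) ?leq_maxl // (@poly_tau_evalE n p') ?leq_maxr //.
by rewrite -big_split; apply: eq_bigr => i _; rewrite coefD rmorphD mulrDl.
Qed.

Lemma poly_tau_eval0 x : poly_tau_eval 0 x = 0.
Proof. by rewrite /poly_tau_eval polyseq0. Qed.

Lemma poly_tau_evalZ c p x : poly_tau_eval (c *: p) x = iota c * poly_tau_eval p x.
Proof.
rewrite !(@poly_tau_evalE (size p)) ?size_scale_leq // mulr_sumr.
by apply: eq_bigr => i _; rewrite coefZ rmorphM mulrA.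
Qed.

Lemma poly_tau_evalMX p x : poly_tau_eval (p * 'X) x = poly_tau_eval p (x ^+ q).
Proof.
have [->|p0] := eqVneq p 0; first by rewrite mul0r !poly_tau_eval0.
by rewrite /poly_tau_eval polyseqMX //= rmorph0 mul0r add0r.
Qed.

Lemma poly_tau_eval_frob p x : poly_tau_eval (map_poly frob p) (x ^+ q) = poly_tau_eval p x ^+ q.
Proof.
have polyseq_map : map_poly frob p = map frob p :> seq K.
  apply: (@eq_from_nth _ 0) => [|i]; first by rewrite size_map size_map_poly.
  by rewrite size_map_poly => lt_ip; rewrite coef_map (nth_map 0).
rewrite [RHS](rmorph_tau_eval (frobq (iota \o gam))) -map_comp /poly_tau_eval polyseq_map -map_comp.
by congr tau_eval; apply: eq_map => c /=; rewrite /frobq rmorphXn.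
Qed.

Lemma poly_tau_evalM p p' x :
  poly_tau_eval (skew_mul frob p p') x = poly_tau_eval p (poly_tau_eval p' x).
Proof.
have shift i : poly_tau_eval (iter i (map_poly frob) p' * 'X^i) x = poly_tau_eval p' x ^+ (q ^ i).
  elim: i p' x => [|i IHi] p' x; first by rewrite mulr1 expr1.
  rewrite iterSr exprSr mulrA poly_tau_evalMX IHi.
  by rewrite poly_tau_eval_frob -exprM -expnS.
rewrite /skew_mul.
rewrite (big_morph (poly_tau_eval^~ x) (fun a b => poly_tau_evalD a b x) (poly_tau_eval0 x)).
rewrite [RHS](@poly_tau_evalE (size p)) //.
by apply: eq_bigr => i _; rewrite poly_tau_evalZ shift.
Qed.

Definition twisted_eval f x := poly_tau_eval (skew_poly f) x.

Lemma twisted_evalD f g x : twisted_eval (f + g) x = twisted_eval f x + twisted_eval g x.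
Proof. exact: poly_tau_evalD. Qed.

Lemma twisted_eval0 x : twisted_eval 0 x = 0.
Proof. exact: poly_tau_eval0. Qed.

Lemma twisted_evalM f g x : twisted_eval (f * g) x = twisted_eval f (twisted_eval g x).
Proof. exact: poly_tau_evalM. Qed.

Lemma twisted_evalC c x : twisted_eval (skewC frob c) x = iota c * x.
Proof.
by rewrite /twisted_eval (@poly_tau_evalE 1) ?size_polyC_leq1 // big_ord1 coefC expr1.
Qed.

Lemma twisted_eval_tau x : twisted_eval (tau frob) x = x ^+ q.
Proof.
by rewrite /twisted_eval /poly_tau_eval polyseqX /= rmorph0 rmorph1 mul0r add0r addr0 mul1r.
Qed.

Lemma twisted_evalX f n x : twisted_eval (f ^+ n) x = iter n (twisted_eval f) x.
Proof.
elim: n => [|n IHn]; first by rewrite /twisted_eval /poly_tau_eval polyseq1 /= rmorph1 mul1r addr0.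
by rewrite exprS twisted_evalM IHn.
Qed.

Variable w : A * A.
Local Notation D := (tau_eval q [:: iota (gam 'X); iota (gam w.1); iota (gam w.2)]).
Local Notation phi_eval := (phi_eval gam iota w).

Lemma phi_eval_twisted a x : phi_eval a x = twisted_eval (drinfeld gam w a) x.
Proof.
rewrite /phi_eval /linearized rmorph_sum horner_sum /twisted_eval (@poly_tau_evalE _ _ _ (leqnn _)).
by apply: eq_bigr => i _; rewrite /= map_polyZ map_polyXn hornerZ hornerXn.
Qed.

Lemma phi_eval_Xn n x : phi_eval 'X^n x = iter n D x.
Proof.
rewrite phi_eval_twisted rmorphXn twisted_evalX [drinfeld gam w 'X]horner_morphX.
elim: n => //= n ->.
by rewrite !twisted_evalD !twisted_evalM !twisted_evalC !twisted_eval_tau /= addr0 addrA.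
Qed.

Lemma phi_eval_coef (a : A) n x : (size a <= n)%N ->
  phi_eval a x = \sum_(i < n) kL a`_i * iter i D x.
Proof.
move=> le_an; have aE : a = \sum_(i < n) (a`_i)%:P * 'X^i.
  rewrite -[LHS]coefK poly_def (big_ord_widen n (fun i => a`_i *: 'X^i)) // big_mkcond.
  apply: eq_bigr => i _ /=; rewrite mul_polyC.
  by case: ltnP => // le_ai; rewrite nth_default // scale0r.
rewrite phi_eval_twisted {1}aE rmorph_sum.
rewrite (big_morph (twisted_eval^~ x) (fun f g => twisted_evalD f g x) (twisted_eval0 x)).
apply: eq_bigr => i _; rewrite rmorphM twisted_evalM.
rewrite -[X in twisted_eval _ X]phi_eval_twisted phi_eval_Xn.
by rewrite [drinfeld gam w _]horner_morphC twisted_evalC.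
Qed.

Lemma tateP (x : nat -> L) : tate gam iota w x <-> tate_series D (PSeries x).
Proof.
have torsionP n y : torsion gam iota w 'X^n y <-> iter n D y = 0.
  by rewrite -phi_eval_Xn; split=> [/rootP|y0]; last apply/rootP.
have phi_T y : phi_eval 'X y = D y := phi_eval_Xn 1 y.
split=> [[tors xS]|[x0 xS]].
  by split=> [|n]; [exact/(torsionP 0%N)/tors|rewrite -phi_T; apply: xS].
split=> n; last by rewrite phi_T; apply: xS.
apply/torsionP; have tx : tate_series D (PSeries x) by [].
by rewrite (tate_series_iter (fq_linear_tau_eval kL _) n n tx) subnn.
Qed.

Lemma tate_scaleE a (x : nat -> L) : tate_series D (PSeries x) ->
  tate_scale gam iota w a x = pscoef (ps_map kL a * PSeries x).
Proof.
move=> tx; apply: funext => n.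
rewrite /tate_scale (@phi_eval_coef _ n) ?size_poly // pscoefM big_ord_recr /= subnn.
have [x0 _] := tx; rewrite [x 0%N]x0 mulr0 addr0; apply: eq_bigr => i _.
rewrite coef_poly ltn_ord; congr (_ * _).
exact: (tate_series_iter (fq_linear_tau_eval kL _) n i tx).
Qed.

Lemma tate_combE (a : 'cV[pseries Fq]_2) e : (forall i, tate_series D (PSeries (e i))) ->
  tate_comb gam iota w a e = pscoef (ps_comb kL (\row_i PSeries (e i)) a).
Proof.
move=> te; apply: funext => n; rewrite /tate_comb ps_combE.
rewrite (big_morph (fun y => pscoef y n) (fun y z => pscoefD y z n) (pscoef0 _ n)).
by apply: eq_bigr => i _; rewrite tate_scaleE // mxE.
Qed.

Lemma rho_surjective_of_galois_matrix (f : 'rV[pseries L]_2) : tate_frame kL D f ->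
  (forall M, M \in unitmx -> galois_matrix iota kL f M) -> rho_surjective gam iota w.
Proof.
move=> frame_f full; pose e i := pscoef (f 0 i).
have PSeriesK (a : pseries L) : PSeries (pscoef a) = a by case: a.
have tf := tate_free_series frame_f.
have combE a : tate_comb gam iota w a e = pscoef (ps_comb kL f a).
  rewrite tate_combE => [|i]; last by rewrite PSeriesK.
  by congr (pscoef (ps_comb _ _ _)); apply/rowP => i; rewrite mxE PSeriesK.
exists e.
  split=> [i|x /tateP tx]; first by apply/tateP; rewrite PSeriesK.
  have [a xE] := tate_series_basis (fq_linear_tau_eval kL _) frame_f tx.
  exists a; split=> [|b xE']; first by rewrite combE -xE.
  apply: (ps_comb_inj frame_f); rewrite -xE; apply: pseriesP => n.
  by rewrite -combE -xE'.
move=> M /full[s gal_s sf]; exists s => // j.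
by rewrite combE -mulmx_ps_comb -sf mxE.
Qed.

End Evaluation.

(** * Density of a residue class *)

Lemma limn_einf_ge (R : realType) (u : (\bar R)^nat) (l : \bar R) :
  (\forall n \near \oo, (l <= u n)%E) -> (l <= limn_einf u)%E.
Proof.
move=> [N _ l_le]; rewrite limn_einf_lim; apply: lime_ge; first exact: is_cvg_einfs.
exists N => // n /= le_Nn; apply: le_ereal_inf_tmp => _ [m /= le_nm <-].
exact/l_le/(leq_trans le_Nn).
Qed.

Section FinsetCardinal.
Variables (I : finType) (T : choiceType) (f : I -> T) (A : set T).
Hypothesis finA : finite_set A.

Lemma leq_card_fset_set_inj : injective f -> (forall i, A (f i)) ->
  (#|I| <= #|` fset_set A|)%N.
Proof.
move=> injf Af; rewrite cardE -(size_map f); apply: uniq_leq_size.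
  by rewrite map_inj_uniq ?enum_uniq.
by move=> _ /mapP[i _ ->]; rewrite -[_ \in _]/(f i \in fset_set A) in_fset_set // inE.
Qed.

Lemma card_fset_set_leq_surj : A `<=` range f -> (#|` fset_set A| <= #|I|)%N.
Proof.
move=> Af; rewrite cardE -(size_map f); apply: uniq_leq_size; first exact: fset_uniq.
move=> y; rewrite -[_ \in _]/(y \in fset_set A) in_fset_set // inE => /Af[i _ <-].
by rewrite map_f ?mem_enum.
Qed.

End FinsetCardinal.

Section AffineFamily.
Variable Fq : finFieldType.
Local Notation A := {poly Fq}.
Local Notation q := #|Fq|.

Lemma size_affine (Q K h : A) n : (size Q <= n)%N -> (size K <= n)%N ->
  (size h <= n - (size K).-1)%N -> (size (Q + K * h)%R <= n)%N.
Proof.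
move=> le_Qn le_Kn le_hn; apply: leq_trans (size_polyD _ _) _; rewrite geq_max le_Qn.
apply: leq_trans (size_polyMleq _ _) _; case: (size K) le_Kn le_hn => [|d] le_dn le_hn /=.
  by rewrite subn0 in le_hn; apply: leq_trans (leq_pred _) le_hn.
by rewrite -(subnKC (ltnW le_dn)) leq_add2l.
Qed.

Variables (c1 c2 : nat) (S : set (A * A)) (Q1 K1 Q2 K2 : A).
Hypotheses (c1_gt0 : (0 < c1)%N) (c2_gt0 : (0 < c2)%N).
Hypotheses (K1_neq0 : K1 != 0) (K2_neq0 : K2 != 0).
Hypothesis family_in : forall h1 h2, (S `&` @pairs Fq) (Q1 + K1 * h1, Q2 + K2 * h2).
Local Notation d1 := (size K1).-1.
Local Notation d2 := (size K2).-1.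
Local Notation below X := (pairs_below Fq c1 c2 X).

Lemma finite_subpairs_below X : finite_set (S `&` below X).
Proof. by apply: sub_finite_set (finite_pairs_below Fq c1 c2 X); apply: subIsetr. Qed.

Lemma card_affine_family X :
  (size Q1 <= X)%N -> (size K1 <= X)%N -> (size Q2 <= X)%N -> (size K2 <= X)%N ->
  (q ^ (c1 * X - d1) * q ^ (c2 * X - d2) <= #|` fset_set (S `&` below X)|)%N.
Proof.
move=> Q1X K1X Q2X K2X.
have le1 n : (n <= X)%N -> (n <= c1 * X)%N by move/leq_trans; apply; rewrite leq_pmull.
have le2 n : (n <= X)%N -> (n <= c2 * X)%N by move/leq_trans; apply; rewrite leq_pmull.
pose f (v : 'rV[Fq]_(c1 * X - d1) * 'rV[Fq]_(c2 * X - d2)) : A * A :=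
  (Q1 + K1 * rVpoly v.1, Q2 + K2 * rVpoly v.2).
have := @leq_card_fset_set_inj _ _ f _ (finite_subpairs_below X).
rewrite card_prod !card_mx !mul1n; apply=> [[v1 v2] [v1' v2']|v].
  move=> [/addrI/(mulfI K1_neq0) v1E /addrI/(mulfI K2_neq0) v2E].
  by rewrite -[v1]rVpolyK -[v2]rVpolyK v1E v2E !rVpolyK.
have [Sf pairs_f] := family_in (rVpoly v.1) (rVpoly v.2); split=> //; split=> //.
by split; apply: size_affine; rewrite ?size_poly ?le1 ?le2.
Qed.

Lemma card_pairs_below X :
  (#|` fset_set (below X)| <= q ^ (c1 * X) * q ^ (c2 * X))%N.
Proof.
pose f (v : 'rV[Fq]_(c1 * X) * 'rV[Fq]_(c2 * X)) : A * A := (rVpoly v.1, rVpoly v.2).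
have := @card_fset_set_leq_surj _ _ f _ (finite_pairs_below Fq c1 c2 X).
rewrite card_prod !card_mx !mul1n; apply=> -[g1 g2] [_ [/= size_g1 size_g2]].
by exists (poly_rV g1, poly_rV g2); rewrite /f //= !poly_rV_K.
Qed.

Lemma lower_density_affine_family (R : realType) :
  (0 < limn_einf (fun X : nat =>
     ((#|` fset_set (S `&` below X)|)%fset%:R / (#|` fset_set (below X)|)%fset%:R : R)%:E))%E.
Proof.
have q0 : (0 < q)%N := ltnW (finNzRing_gt1 Fq).
pose del : R := (q ^ (d1 + d2))%:R^-1.
have del_gt0 : 0 < del by rewrite invr_gt0 ltr0n expn_gt0 q0.
apply: (@lt_le_trans _ _ del%:E); first by rewrite lte_fin.
apply: limn_einf_ge; pose N := maxn (maxn (size Q1) (size K1)) (maxn (size Q2) (size K2)).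
exists N => // X /=; rewrite !geq_max => /andP[/andP[Q1X K1X] /andP[Q2X K2X]].
have family_card := card_affine_family Q1X K1X Q2X K2X.
have a_gt0 : (0 < #|` fset_set (S `&` below X)|)%N.
  by apply: leq_trans family_card; rewrite muln_gt0 !expn_gt0 q0.
have b_gt0 : (0 < #|` fset_set (below X)|)%N.
  apply: leq_trans a_gt0 (fsubset_leq_card _).
  rewrite -fset_set_sub; [exact: subIsetr|exact: finite_subpairs_below|].
  exact: finite_pairs_below.
have card_le : (#|` fset_set (below X)| <= q ^ (d1 + d2) * #|` fset_set (S `&` below X)|)%N.
  apply: leq_trans (card_pairs_below X) _.
  apply: leq_trans (leq_mul (leqnn (q ^ (d1 + d2))) family_card).
  by rewrite expnD mulnACA leq_mul // -expnD leq_pexp2l // -leq_subLR.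
rewrite lee_fin ler_pdivlMr ?ltr0n // mulrC ler_pdivrMr ?ltr0n ?expn_gt0 ?q0 //.
by rewrite -natrM ler_nat mulnC.
Qed.

End AffineFamily.

Section SurjectiveFamily.
Variables (Fq : finFieldType) (L : fieldType).
Variable iota : {rmorphism {fraction {poly Fq}} -> L}.
Hypotheses (sepF : separable_closure iota) (q_gt2 : (2 < #|Fq|)%N).
Variables (c : Fq) (h1 h2 : {poly Fq}).
Hypotheses (c0 : c != 0) (c1 : c != 1).
Local Notation T1 := ('X - 1%:P : {poly Fq}).
Local Notation Tc := ('X - c%:P : {poly Fq}).

Lemma surjective_pairs_family :
  surjective_pairs iota (Tc + Tc * ('X * T1) * h1, T1 * Tc + T1 * Tc * ('X * T1 * Tc) * h2).
Proof.
set w := (_, _); have hornerDM := (hornerXsubC, hornerD, hornerM, hornerX, hornerC).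
have w10 : w.1.[0] != 0 by rewrite !hornerDM !(mul0r, mulr0) addr0 sub0r oppr_eq0.
have w20 : w.2.[0] != 0.
  by rewrite !hornerDM !(mul0r, mulr0) addr0 !sub0r mulN1r opprK.
have w11 : w.1.[1] != 0.
  by rewrite !hornerDM subrr !(mul0r, mulr0) addr0 subr_eq0 eq_sym.
pose m2 := 1 + 'X * T1 * Tc * h2.
have m2E a : a \in [:: 1; c] -> m2.[a] = 1.
  by rewrite !inE => /orP[] /eqP ->; rewrite !hornerDM subrr !(mul0r, mulr0) addr0.
have [|||||f frame_f full] := @exists_full_galois_frame _ _ _ sepF w 1 c (Tc * m2)
  (1 + 'X * T1 * h1) (T1 * m2) q_gt2 w10 w20 (oner_neq0 _) w11 _ _ c0.
- by rewrite /w /m2 /=; ring.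
- by rewrite hornerM hornerXsubC m2E ?mem_head // mulr1 subr_eq0 eq_sym.
- by rewrite /w /=; ring.
- by rewrite /w /m2 /=; ring.
- by rewrite hornerM hornerXsubC m2E ?inE ?eqxx ?orbT // mulr1 subr_eq0.
split; last exact: rho_surjective_of_galois_matrix frame_f full.
by apply: contraNneq w20 => /= ->; rewrite horner0.
Qed.

End SurjectiveFamily.

Theorem theorem1p1 (R : realType) (Fq : finFieldType)
    (Fsep : fieldType) (iota : {rmorphism {fraction {poly Fq}} -> Fsep})
    (c1 c2 : nat) :
  (5 <= #|Fq|)%N -> odd #|Fq| -> (0 < c1)%N -> (0 < c2)%N ->
  separable_closure iota ->
  (0 < limn_einf (fun X : nat =>
         ((#|` fset_set (surjective_pairs iota `&` pairs_below Fq c1 c2 X)|)%fset%:R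
          / (#|` fset_set (pairs_below Fq c1 c2 X)|)%fset%:R : R)%:E))%E.
Proof.
move=> q_ge5 _ c1_gt0 c2_gt0 sepF; have q_gt2 : (2 < #|Fq|)%N by apply: leq_trans q_ge5.
have [c] : exists c : Fq, c \notin [:: 0; 1] by apply: exists_notin_seq.
rewrite !inE negb_or => /andP[c_neq0 c_neq1].
have surj h1 h2 := surjective_pairs_family sepF q_gt2 h1 h2 c_neq0 c_neq1.
have family h1 h2 := conj (surj h1 h2) (surj h1 h2).1.
by apply: (lower_density_affine_family c1_gt0 c2_gt0 _ _ family);
  rewrite !mulf_neq0 ?polyX_eq0 ?polyXsubC_eq0.
Qed.
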